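(* Chromatic Sum is NP-complete for $(C_5,4P_1,2P_1+P_2,2P_2)$-free graphs.
   Context: All graphs are finite, undirected and simple. A colouring of a graph $G=(V,E)$ is a function $c:V\to\{1,2,\ldots\}$ with $c(u)\neq c(v)$ for every edge $uv\in E$; its sum is $\sum_{v\in V}c(v)$. The decision problem Chromatic Sum takes a graph $G$ and an integer $k$ and asks whether $G$ admits a colouring with sum at most $k$; ''for'' a graph class means that input graphs are restricted to that class. A graph is $(H_1,\ldots,H_p)$-free if it has no induced subgraph isomorphic to any $H_i$. $P_r$ and $C_r$ denote the path and the cycle on $r$ vertices, $G_1+G_2$ denotes disjoint union, and $rG$ the disjoint union of $r$ copies of $G$. *)

(* Defs.v *)
From Stdlib Require List.
From mathcomp Require Import all_boot all_order all_algebra.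

Set Implicit Arguments.
Unset Strict Implicit.
Unset Printing Implicit Defensive.

Import Order.TTheory GRing.Theory Num.Theory.
Local Open Scope ring_scope.

Section Tapes.
Variable S : Type.

Inductive move := MoveLeft | Stay | MoveRight.

(* A two-way infinite tape, almost everywhere blank ([None]): [left_of] lists
   the cells to the left of the head, nearest first, and [right_of] those to
   its right; all the cells not listed are blank. *)
Record tape := Tape {
  left_of : seq (option S); scanned : option S; right_of : seq (option S) }.

Definition tape_of_seq (s : seq (option S)) : tape :=
  Tape [::] (head None s) (behead s).

Definition write (a : option S) (t : tape) : tape :=
  Tape (left_of t) a (right_of t).

Definition shift (m : move) (t : tape) : tape :=
  match m with
  | MoveLeft => Tape (behead (left_of t)) (head None (left_of t))
                     (scanned t :: right_of t)
  | Stay => t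
  | MoveRight => Tape (scanned t :: left_of t) (head None (right_of t))
                      (behead (right_of t))
  end.
End Tapes.

(* The tape symbols are the blank [None], the input letters [Some (inl b)] and
   finitely many auxiliary symbols [Some (inr a)].  There is at least one tape;
   [accepting_state] only matters on halting states. *)
Record tm := TM {
  extra_tapes : nat;
  state : finType;
  aux : finType;
  start : state;
  halting_state : pred state;
  accepting_state : pred state;
  trans : state -> {ffun 'I_extra_tapes.+1 -> option (bool + aux)} ->
          state * {ffun 'I_extra_tapes.+1 -> option (bool + aux) * move} }.

Section Runs.
Variable M : tm.

Record config := Config {
  cstate : state M;
  ctapes : {ffun 'I_(extra_tapes M).+1 -> tape (bool + aux M)} }.

(* The i-th input word is written on the i-th tape, with the head on its first
   letter; the other tapes are blank. *)
Definition init (ws : seq (seq bool)) : config :=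
  Config (start M)
    [ffun i : 'I_(extra_tapes M).+1 =>
       tape_of_seq [seq Some (inl b) | b <- nth [::] ws i]].

Definition step (c : config) : config :=
  if halting_state (cstate c) then c else
  let: (q, acts) :=
    trans (cstate c) [ffun i => scanned (ctapes c i)] in
  Config q [ffun i => shift (acts i).2 (write (acts i).1 (ctapes c i))].

(* Halting configurations are fixed by [step], so that if [M] halts within [t]
   steps then [run ws t] is its final configuration. *)
Definition run (ws : seq (seq bool)) (t : nat) : config := iter t step (init ws).

Definition halted (c : config) : bool := halting_state (cstate c).

Definition accepting (c : config) : bool := halted c && accepting_state (cstate c).

Fixpoint leading_letters (s : seq (option (bool + aux M))) : seq bool :=
  if s is Some (inl b) :: s' then b :: leading_letters s' else [::].

(* The output is the longest word over the input alphabet that starts at the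
   head of the first tape. *)
Definition output (c : config) : seq bool :=
  let t := ctapes c ord0 in leading_letters (scanned t :: right_of t).
End Runs.

Definition language := seq bool -> Prop.

Definition poly_time_computable (f : seq bool -> seq bool) : Prop :=
  exists (M : tm) (p : {poly nat}), forall x : seq bool,
    let c := run M [:: x] p.[size x] in halted c /\ output c = f x.

(* A verifier gets the input on its first tape and the certificate on its
   second tape. *)
Definition NP (L : language) : Prop :=
  exists (M : tm) (p q : {poly nat}),
    let final x y := run M [:: x; y] q.[(size x + size y)%N] in
    (forall x y : seq bool, halted (final x y)) /\
    (forall x : seq bool,
       L x <-> exists y : seq bool,
                 (size y <= p.[size x])%N /\ accepting (final x y)).

Definition poly_reducible (L1 L2 : language) : Prop :=
  exists f : seq bool -> seq bool,
    poly_time_computable f /\ forall x : seq bool, L1 x <-> L2 (f x).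

Definition NP_hard (L : language) : Prop :=
  forall L' : language, NP L' -> poly_reducible L' L.

Definition NP_complete (L : language) : Prop := NP L /\ NP_hard L.

Record graph := Graph {
  vertex :> finType;
  adj : rel vertex;
  adj_sym : symmetric adj;
  adj_irrefl : irreflexive adj }.

Definition path_adj (r : nat) : rel 'I_r :=
  fun i j => (i.+1 == j :> nat) || (j.+1 == i :> nat).

Lemma path_adj_sym r : symmetric (@path_adj r).
Proof. by move=> i j; rewrite /path_adj orbC. Qed.

Lemma path_adj_irrefl r : irreflexive (@path_adj r).
Proof. by move=> i; rewrite /path_adj orbb gtn_eqF. Qed.

Definition pathG (r : nat) : graph := Graph (@path_adj_sym r) (@path_adj_irrefl r).

(* This is the cycle on r vertices for r >= 3. *)
Definition cycle_adj (r : nat) : rel 'I_r :=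
  fun i j => (i != j) && ((i.+1 %% r == j)%N || (j.+1 %% r == i)%N).

Lemma cycle_adj_sym r : symmetric (@cycle_adj r).
Proof. by move=> i j; rewrite /cycle_adj eq_sym orbC. Qed.

Lemma cycle_adj_irrefl r : irreflexive (@cycle_adj r).
Proof. by move=> i; rewrite /cycle_adj eqxx. Qed.

Definition cycleG (r : nat) : graph :=
  Graph (@cycle_adj_sym r) (@cycle_adj_irrefl r).

Definition union_adj (G H : graph) : rel (G + H)%type :=
  fun x y => match x, y with
             | inl u, inl v => adj u v
             | inr u, inr v => adj u v
             | _, _ => false
             end.

Lemma union_adj_sym G H : symmetric (@union_adj G H).
Proof. by move=> [u|u] [v|v] //=; apply: adj_sym. Qed.

Lemma union_adj_irrefl G H : irreflexive (@union_adj G H).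
Proof. by move=> [u|u]; apply: adj_irrefl. Qed.

Definition unionG (G H : graph) : graph :=
  Graph (@union_adj_sym G H) (@union_adj_irrefl G H).

Definition copies_adj (r : nat) (G : graph) : rel ('I_r * G)%type :=
  fun x y => (x.1 == y.1) && adj x.2 y.2.

Lemma copies_adj_sym r G : symmetric (@copies_adj r G).
Proof. by move=> x y; rewrite /copies_adj eq_sym adj_sym. Qed.

Lemma copies_adj_irrefl r G : irreflexive (@copies_adj r G).
Proof. by move=> x; rewrite /copies_adj adj_irrefl andbF. Qed.

Definition copiesG (r : nat) (G : graph) : graph :=
  Graph (@copies_adj_sym r G) (@copies_adj_irrefl r G).

Definition has_induced (H G : graph) : Prop :=
  exists f : H -> G, injective f /\ forall u v : H, adj (f u) (f v) = adj u v.

Definition induced_free (Hs : seq graph) (G : graph) : Prop :=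
  forall H : graph, List.In H Hs -> ~ has_induced H G.

Definition colouring (G : graph) (c : G -> nat) : Prop :=
  (forall v : G, (0 < c v)%N) /\ (forall u v : G, adj u v -> c u <> c v).

Definition has_colouring_of_sum_at_most (G : graph) (k : int) : Prop :=
  exists c : G -> nat, colouring c /\ (\sum_(v : G) c v)%N%:Z <= k.

(* The number of vertices in unary, then the rows of an adjacency matrix.  As
   [G] ranges over all the graphs, [enum G] gives every order of the vertices. *)
Definition graph_code (G : graph) : seq bool :=
  nseq #|G| true ++ false :: [seq adj u v | u <- enum G, v <- enum G].

(* Sign and magnitude in binary: a sign bit ([true] for minus), then the bits
   of the absolute value, least significant first. *)
Definition int_of_bits (s : seq bool) : int :=
  (-1) ^+ head false s *
    (foldr (fun (b : bool) (m : nat) => b + m.*2)%N 0%N (behead s))%:Z.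

Definition encodes (w : seq bool) (G : graph) (k : int) : Prop :=
  exists s : seq bool, w = graph_code G ++ s /\ int_of_bits s = k.

Definition chromatic_sum (C : graph -> Prop) : language :=
  fun w => exists (G : graph) (k : int),
    [/\ encodes w G k, C G & has_colouring_of_sum_at_most G k].

(* Main.v *)
(* Membership: verifying a colouring is arithmetic on the letters of the input and
   the certificate.  Turing machine fragments with unary counters compute a class
   of polynomially bounded functions that is closed under bounded sums, hence under
   bounded quantification and division, so that it is enough to write the verifier,
   and later each bit of the reduction, as such an expression.

   Hardness: let G be the complement of a graph h on 3m vertices without cycles of
   length 4 or 5.  Then G is free of the four graphs, and a colour class of G is a
   clique of h, with at most three vertices; hence G has a colouring of sum at most
   3(1 + ... + m) iff h can be partitioned into triangles.  The computations of a
   machine become such partitions in two steps.  Relative to the heads, a run of T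
   steps is a tiling of a grid with T + 1 rows of 2T + 1 cells by tiles whose common
   edges match, and a tiling is an exact cover: the set of a tile in a cell covers
   the cell, the colours it sends to the right and upwards, and all the colours
   except those it expects from the left and from below.  Each set then becomes an
   even wheel with triangles on its rim edges, and the two ways of taking every
   other triangle tell whether the set belongs to the cover. *)

Require Import Defs.
From mathcomp Require Import all_boot all_order all_algebra zify.

Set Implicit Arguments.
Unset Strict Implicit.
Unset Printing Implicit Defensive.

Import Order.TTheory GRing.Theory Num.Theory.

(** * Machine fragments with unary counters *)

(** The wheels must not create cycles of length 4 or 5, with or without chords. Hence rims have
    length at least six, and elements sit only on every other rim edge: of two consecutive rim edges
    one has a private apex, so a short cycle through two apexes stays in one wheel. Apexes off the
    chosen triangles need triangles too. Three copies of everything are taken, and the three copies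
    of an apex that no set has to cover are joined to each other; these edges close no cycle of
    length 4 or 5. A tile takes the complement of its entrance colours because a colour of a grid
    edge is then covered by the exit if it is the colour sent, and by the entrance if it is not the
    colour expected: once for every colour exactly when the two agree. The grid has 2T + 1 columns
    because nothing controls its side borders. Wrong symbols may enter there, but they advance by at
    most one cell per row, so the middle of the last row is still right. On the machine side unary
    counters rule out exponentials; powers of two occur only capped by polynomially bounded
    numbers. *)

Definition tape_at S (t : tape S) (z : int) : option S :=
  match z with
  | Posz n => nth None (scanned t :: right_of t) n
  | Negz n => nth None (left_of t) n
  end.

Definition offset (m : move) : int :=
  match m with MoveLeft => -1 | Stay => 0 | MoveRight => 1 end.

(** In coordinates relative to the head a move translates the whole tape, which spares any further
    reasoning about the two lists and their blank ends. *)
Lemma tape_at_shift_write S (a : option S) m (t : tape S) z :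
  tape_at (shift m (write a t)) z =
    if (z + offset m == 0)%R then a else tape_at t (z + offset m)%R.
Proof.
case: t => l s r; rewrite /shift /write /=.
case: m => /=.
- case: z => [[|n]|n] /=.
  + by rewrite nth0.
  + have -> : (n.+1%:Z - 1 = n)%R by lia.
    by case: n.
  + by rewrite addn0 nth_behead.
- by rewrite addr0; case: z => [[|n]|n].
- case: z => [n|[|n]].
  + have -> : (n%:Z + 1 = n.+1)%R by lia.
    by case: n => [|n] /=; rewrite ?nth0 ?nth_behead.
  + by [].
  + by have -> : (Negz n.+1 + 1 = Negz n)%R by lia.
Qed.

Definition sym := option (bool + unit).
Definition mark : sym := Some (inr tt).
(** Infinitely many tapes, each with its head at 0; a fragment uses finitely many of them, and their
    number is fixed only when a machine is built from it. *)
Definition contents := nat -> int -> sym.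

(* A program fragment reads and writes a single tape in each state; leaving the
   fragment is the transition to [None]. *)
Record frag := Frag {
  fstate : finType;
  finit : fstate;
  ftape : fstate -> nat;
  fnext : fstate -> sym -> option fstate * sym * move }.

Definition act (i : nat) (a : sym) (m : move) (c : contents) : contents :=
  fun j z => if j == i
             then if (z + offset m == 0)%R then a else c i (z + offset m)%R
             else c j z.

(** A relation, because a fragment may run forever; the count includes the step that leaves the
    fragment. *)
Inductive exits (F : frag) : fstate F -> contents -> nat -> contents -> Prop :=
| exits_last s c a m :
    fnext s (c (ftape s) 0%R) = (None, a, m) ->
    exits s c 1 (act (ftape s) a m c)
| exits_step s s' c a m n c' :
    fnext s (c (ftape s) 0%R) = (Some s', a, m) ->
    exits s' (act (ftape s) a m c) n c' -> exits s c n.+1 c'.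

Definition fbasic (i : nat) (g : sym -> sym * move) : frag :=
  @Frag unit tt (fun _ => i) (fun _ a => (None, (g a).1, (g a).2)).

Definition fseq (F G : frag) : frag :=
  @Frag (fstate F + fstate G)%type (inl (finit F))
    (fun s => match s with inl s => ftape s | inr s => ftape s end)
    (fun s a => match s with
       | inl s => let: (o, b, m) := fnext s a in
                  (Some (if o is Some s' then inl s' else inr (finit G)), b, m)
       | inr s => let: (o, b, m) := fnext s a in (omap inr o, b, m)
       end).

Definition fwhen (i : nat) (p : pred sym) (F : frag) : frag :=
  @Frag (option (fstate F)) None
    (fun s => if s is Some s then ftape s else i)
    (fun s a => match s with
       | None => (if p a then Some (Some (finit F)) else None, a, Stay)
       | Some s => let: (o, b, m) := fnext s a in (omap Some o, b, m)
       end).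

(** Leaving the body becomes [Some None], the transition back to the test state; in [fwhen],
    [omap Some] turns it into leaving the whole fragment. *)
Definition fwhile (i : nat) (p : pred sym) (F : frag) : frag :=
  @Frag (option (fstate F)) None
    (fun s => if s is Some s then ftape s else i)
    (fun s a => match s with
       | None => (if p a then Some (Some (finit F)) else None, a, Stay)
       | Some s => let: (o, b, m) := fnext s a in (Some o, b, m)
       end).

Lemma exits_basic i g (c : contents) :
  exits (finit (fbasic i g)) c 1 (act i (g (c i 0%R)).1 (g (c i 0%R)).2 c).
Proof. exact: exits_last. Qed.

Lemma exits_seq F G c n c1 m c2 :
  exits (finit F) c n c1 -> exits (finit G) c1 m c2 ->
  exits (finit (fseq F G)) c (n + m) c2.
Proof.
move=> eF eG.
have eGr : exits (F := fseq F G) (inr (finit G)) c1 m c2.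
  elim: eG => [s c' a mm e|s s' c' a mm k c'' e _ IH].
    by apply: (@exits_last (fseq F G) (inr s)); rewrite /= e.
  by apply: (@exits_step (fseq F G) (inr s) (inr s') _ a mm _ _ _ IH); rewrite /= e.
rewrite /=; elim: eF eGr => [s c' a mm e|s s' c' a mm k c'' e _ IH] eGr.
  by apply: (@exits_step (fseq F G) (inl s) _ _ a mm _ _ _ eGr); rewrite /= e.
rewrite addSn.
by apply: (@exits_step (fseq F G) (inl s) (inl s') _ a mm _ _ _ (IH eGr)); rewrite /= e.
Qed.

Lemma exits_whenF i (p : pred sym) F (c : contents) : ~~ p (c i 0%R) ->
  exits (finit (fwhen i p F)) c 1 (act i (c i 0%R) Stay c).
Proof. by move=> /negPf np; apply: (@exits_last (fwhen i p F) None); rewrite /= np. Qed.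

Lemma exits_whenT i (p : pred sym) F (c : contents) n c' : p (c i 0%R) ->
  exits (finit F) (act i (c i 0%R) Stay c) n c' ->
  exits (finit (fwhen i p F)) c n.+1 c'.
Proof.
move=> pi eF.
apply: (@exits_step (fwhen i p F) None (Some (finit F)) _ (c i 0%R) Stay).
  by rewrite /= pi.
rewrite /=; elim: eF => [s c1 a mm e|s s' c1 a mm k c'' e _ IH].
  by apply: (@exits_last (fwhen i p F) (Some s)); rewrite /= e.
by apply: (@exits_step (fwhen i p F) (Some s) (Some s') _ a mm _ _ _ IH); rewrite /= e.
Qed.

Lemma exits_whileF i (p : pred sym) F (c : contents) : ~~ p (c i 0%R) ->
  exits (finit (fwhile i p F)) c 1 (act i (c i 0%R) Stay c).
Proof. by move=> /negPf np; apply: (@exits_last (fwhile i p F) None); rewrite /= np. Qed.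

Lemma exits_whileT i (p : pred sym) F (c : contents) n c1 m c' : p (c i 0%R) ->
  exits (finit F) (act i (c i 0%R) Stay c) n c1 ->
  exits (finit (fwhile i p F)) c1 m c' ->
  exits (finit (fwhile i p F)) c (n + m).+1 c'.
Proof.
move=> pi eF eW.
apply: (@exits_step (fwhile i p F) None (Some (finit F)) _ (c i 0%R) Stay).
  by rewrite /= pi.
rewrite /=; elim: eF eW => [s c2 a mm e|s s' c2 a mm k c'' e _ IH] eW.
  by apply: (@exits_step (fwhile i p F) (Some s) None _ a mm _ _ _ eW); rewrite /= e.
rewrite addSn.
by apply: (@exits_step (fwhile i p F) (Some s) (Some s') _ a mm _ _ _ (IH eW)); rewrite /= e.
Qed.

Lemma act_stay i (c : contents) j z : act i (c i 0%R) Stay c j z = c j z.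
Proof. by rewrite /act addr0; case: eqP => // ->; case: eqP => // ->. Qed.

(** The marks lie immediately to the left of the head, so that an increment writes a mark and moves
    right, and one move to the left tests for zero. *)
Definition counter (n : nat) (z : int) : sym :=
  if z is Negz m then if m < n then mark else None else None.

Definition upd T (E : nat -> T) (i : nat) (n : T) : nat -> T :=
  fun j => if j == i then n else E j.

Definition holds_at (O : contents) (E : nat -> nat) (c : contents) :=
  (forall i z, i < 3 -> c i z = O i z) /\
  (forall i z, c i.+3 z = counter (E i) z).

(** A Hoare triple for total correctness, with a time bound. Three tapes carry arbitrary contents;
    all the others are counters. *)
Variant tri F O E O' E' T : Prop := Tri of forall c, holds_at O E c ->
  exists n c', [/\ exits (finit F) c n c', holds_at O' E' c' & n <= T].

Lemma tri_run F O E O' E' T c : tri F O E O' E' T -> holds_at O E c ->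
  exists n c', [/\ exits (finit F) c n c', holds_at O' E' c' & n <= T].
Proof. by case=> h /h. Qed.

Definition move_head (m : move) (f : int -> sym) : int -> sym :=
  fun z => f (z + offset m)%R.

Lemma tri_weaken F O1 E1 O2 E2 O1' E1' O2' E2' T T' :
  tri F O1 E1 O2 E2 T -> T <= T' ->
  (forall i z, i < 3 -> O1' i z = O1 i z) -> E1' =1 E1 ->
  (forall i z, i < 3 -> O2 i z = O2' i z) -> E2 =1 E2' ->
  tri F O1' E1' O2' E2' T'.
Proof.
move=> [tF] leT eO1 eE1 eO2 eE2; split=> c [h1 h2].
have [|n [c' [ex [h1' h2'] le]]] := tF c.
  by split=> [i z lt3|i z]; [rewrite h1 // eO1|rewrite h2 eE1].
exists n, c'; split=> //; last exact: leq_trans leT.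
by split=> [i z lt3|i z]; [rewrite h1' // eO2|rewrite h2' eE2].
Qed.

Lemma tri_time F O E O' E' T T' : T <= T' ->
  tri F O E O' E' T -> tri F O E O' E' T'.
Proof. by move=> le t; apply: (tri_weaken t le). Qed.

Lemma tri_ext F O E O' E' E1 E1' T : E1 =1 E -> E' =1 E1' ->
  tri F O E O' E' T -> tri F O E1 O' E1' T.
Proof. by move=> h h' t; apply: (tri_weaken t (leqnn _) _ h _ h'). Qed.

Lemma tri_conv F O E O' E' E1 E1' T :
  tri F O E O' E' T -> E1 =1 E -> E' =1 E1' -> tri F O E1 O' E1' T.
Proof. by move=> t h h'; apply: tri_ext t. Qed.

Lemma tri_seq F G O E O1 E1 O2 E2 T1 T2 :
  tri F O E O1 E1 T1 -> tri G O1 E1 O2 E2 T2 ->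
  tri (fseq F G) O E O2 E2 (T1 + T2).
Proof.
move=> [tF] [tG]; split=> c /tF [n [c1 [e1 /tG [m [c2 [e2 i2 le2]]] le1]]].
exists (n + m), c2; split=> //; first exact: exits_seq e1 e2.
exact: leq_add.
Qed.

Definition finc (i : nat) := fbasic i.+3 (fun _ => (mark, MoveRight)).
Definition fleft (i : nat) := fbasic i (fun a => (a, MoveLeft)).
Definition fright (i : nat) := fbasic i (fun a => (a, MoveRight)).
Definition fskip := fbasic 0 (fun a => (a, Stay)).
Definition fdec (i : nat) := fseq (fleft i.+3)
  (fbasic i.+3 (fun a => if a == mark then (None, Stay) else (a, MoveRight))).

Lemma tri_basic i g O E : i < 3 ->
  tri (fbasic i g) O E
      (upd O i (fun z => if (z + offset (g (O i 0%R)).2 == 0)%R then (g (O i 0%R)).1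
                         else O i (z + offset (g (O i 0%R)).2)%R)) E 1.
Proof.
move=> i3; split=> c [h1 h2]; exists 1; eexists; split; [exact: exits_basic| |by []].
rewrite (h1 _ _ i3); split=> [j z j3|j z]; rewrite /act /upd.
  by case: eqP => // _; rewrite !h1.
by case: eqP => // ji; lia.
Qed.

Lemma tri_move i m O E : i < 3 ->
  tri (fbasic i (fun a => (a, m))) O E (upd O i (move_head m (O i))) E 1.
Proof.
move=> i3; apply: (tri_weaken (@tri_basic i (fun a => (a, m)) O E i3)) => //.
by move=> j z j3 /=; rewrite /upd; case: eqP => // _; case: eqP => // e; rewrite /move_head e.
Qed.

Lemma tri_skip O E : tri fskip O E O E 1.
Proof.
apply: (tri_weaken (@tri_move 0 Stay O E _)) => //.
by move=> j z j3; rewrite /upd; case: eqP => // ->; rewrite /move_head addr0.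
Qed.

Lemma counter0 z : counter 0 z = None.
Proof. by case: z. Qed.

Lemma counterS n z : counter n.+1 z = if (z + 1 == 0)%R then mark else counter n (z + 1)%R.
Proof.
case: z => [k|[|k]] //.
  have -> : (k%:Z + 1 = k.+1)%R by lia.
  by [].
by have -> : (Negz k.+1 + 1 = Negz k)%R by lia.
Qed.

Lemma tri_inc i O E : tri (finc i) O E O (upd E i (E i).+1) 1.
Proof.
split=> c [h1 h2]; exists 1; eexists; split; [exact: exits_basic| |by []].
split=> [j z j3|j z] /=; rewrite /act /upd.
  by case: eqP => [ji|_]; [lia|rewrite h1].
by rewrite !eqSS; case: (j =P i) => [_|_]; rewrite h2 // counterS.
Qed.

(* After the initial move to the left the head scans a mark iff the counter is
   positive. *)
Lemma counter_shift n : counter n (-1)%R = if 0 < n then mark else None.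
Proof. by []. Qed.

Lemma tri_dec i O E : tri (fdec i) O E O (upd E i (E i).-1) 2.
Proof.
split=> c [h1 h2]; exists 2; eexists; split; [|shelve|by []].
  by apply: (@exits_seq _ _ _ 1 _ 1); exact: exits_basic.
Unshelve.
set c1 := act _ _ _ c.
have c1i z : c1 i.+3 z = counter (E i) (z - 1)%R.
  by rewrite /c1 /act eqxx /= h2; case: eqP => // ->.
have c1j j z : j != i.+3 -> c1 j z = c j z by rewrite /c1 /act => /negPf ->.
rewrite c1i sub0r counter_shift.
split=> [j z j3|j z]; rewrite /act /=.
  by case: eqP => [|_]; [lia|rewrite c1j ?h1 //; lia].
rewrite /upd !eqSS; case: (j =P i) => [_|/eqP ji]; last by rewrite c1j ?h2.
case: (E i) c1i => [|n] c1i /=.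
  by rewrite c1i !counter0; case: eqP.
rewrite addr0; case: eqP => [-> //|]; rewrite c1i.
case: z => [[|k]|k] // _.
have -> : (Negz k - 1 = Negz k.+1)%R by lia.
by rewrite /= ltnS.
Qed.

(** The test needs the head on the last mark. Erasing this mark leaves the head just to the right of
    the remaining ones, so the body starts from a proper counter that is already decremented. *)
Definition floop (i : nat) (F : frag) : frag :=
  fseq (fleft i.+3)
    (fseq (fwhile i.+3 (pred1 mark)
             (fseq (fbasic i.+3 (fun _ => (None, Stay))) (fseq F (fleft i.+3))))
          (fright i.+3)).

(* The invariant with the head of the [i]-th counter one cell to the left. *)
Definition left_holds_at i (O : contents) (E : nat -> nat) (c : contents) :=
  (forall j z, j < 3 -> c j z = O j z) /\
  (forall j z, c j.+3 z = counter (E j) (if j == i then (z - 1)%R else z)).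

Lemma exits_left i O E c : holds_at O E c ->
  exists2 c', exits (finit (fleft i.+3)) c 1 c' & left_holds_at i O E c'.
Proof.
move=> [h1 h2]; eexists; first exact: exits_basic.
split=> [j z j3|j z]; rewrite /act /=.
  by case: eqP => [|_]; [lia|rewrite h1].
rewrite !eqSS; case: (j =P i) => [->|_]; rewrite !h2 //.
by case: eqP => // ->.
Qed.

Lemma exits_right i O E c : left_holds_at i O E c ->
  exists2 c', exits (finit (fright i.+3)) c 1 c' & holds_at O E c'.
Proof.
move=> [h1 h2]; eexists; first exact: exits_basic.
split=> [j z j3|j z]; rewrite /act /=.
  by case: eqP => [|_]; [lia|rewrite h1].
rewrite !eqSS; case: (j =P i) => [->|/eqP/negPf ji]; rewrite !h2 ?ji // eqxx.
have -> : (z + 1 - 1 = z)%R by lia.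
by case: eqP => // e; congr (counter _ _); lia.
Qed.

Lemma exits_erase i O E c n : left_holds_at i O E c -> E i = n.+1 ->
  exists2 c', exits (finit (fbasic i.+3 (fun _ => (None, Stay)))) c 1 c' &
    holds_at O (upd E i n) c'.
Proof.
move=> [h1 h2] Ei; eexists; first exact: exits_basic.
split=> [j z j3|j z]; rewrite /act /=.
  by case: eqP => [|_]; [lia|rewrite h1].
rewrite !eqSS /upd; case: (j =P i) => [_|/eqP/negPf ji]; rewrite !h2 ?ji // eqxx Ei addr0.
case: z => [[|k]|k] //.
by have -> : (Negz k - 1 = Negz k.+1)%R by lia.
Qed.

(** The body may use the counter as an index running downwards from [n - 1], provided that it
    restores it. *)
Lemma tri_loop i F n O E t :
  (forall k, k <= n -> E k i = n - k) ->
  (forall k, k < n -> tri F (O k) (upd (E k) i (n - k).-1) (O k.+1) (E k.+1) t) ->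
  tri (floop i F) (O 0) (E 0) (O n) (E n) (n * (t + 3) + 3).
Proof.
set W := fwhile i.+3 (pred1 mark)
           (fseq (fbasic i.+3 (fun _ => (None, Stay))) (fseq F (fleft i.+3))).
move=> En tF; split=> c /(exits_left i) [c1 e1 i1].
have scan k c' : k <= n -> left_holds_at i (O k) (E k) c' ->
    pred1 mark (c' i.+3 0%R) = (0 < n - k).
  by move=> kn [_ h2]; rewrite /= h2 eqxx sub0r En // counter_shift; case: (0 < _).
have stay k c' : left_holds_at i (O k) (E k) c' ->
    left_holds_at i (O k) (E k) (act i.+3 (c' i.+3 0%R) Stay c').
  by move=> [h1 h2]; split=> [j z j3|j z]; rewrite act_stay; [rewrite h1|rewrite h2].
suff main r k c' : k + r = n -> left_holds_at i (O k) (E k) c' ->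
    exists m c2, [/\ exits (finit W) c' m c2, left_holds_at i (O n) (E n) c2 & m <= r * (t + 3) + 1].
  have [m [c2 [e2 /exits_right [c3 e3 i3] lem]]] := main n 0 c1 (erefl _) i1.
  exists (1 + (m + 1)), c3; split=> //; last lia.
  exact: exits_seq e1 (exits_seq e2 e3).
elim: r k c' => [|r IH] k c' kn ic'.
  have kE : k = n by lia.
  subst k; exists 1; eexists; split; [|exact: stay ic'|by lia].
  by apply: exits_whileF; rewrite (scan n) // subnn.
have Ek : E k i = (n - k).-1.+1 by rewrite En //; lia.
have [c2 e2 i2] := exits_erase (stay _ _ ic') Ek.
have [|m [c3 [e3 i3 lem]]] := tri_run (tF k _) i2; first by lia.
have [c4 e4 i4] := exits_left i i3.
have [|m' [c5 [e5 i5 lem']]] := IH k.+1 c4 _ i4; first by lia.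
exists (1 + (m + 1) + m').+1, c5; split=> //; last by rewrite mulSn; lia.
apply: exits_whileT (exits_seq e2 (exits_seq e3 e4)) e5.
by rewrite /= -[_ == _]/(pred1 mark _) (scan k) //; lia.
Qed.

Lemma tri_whenT i (p : pred sym) F O E O' E' T : i < 3 -> p (O i 0%R) ->
  tri F O E O' E' T -> tri (fwhen i p F) O E O' E' T.+1.
Proof.
move=> i3 pi [tF]; split=> c [h1 h2].
have [|n [c' [e' i' le]]] := tF (act i (c i 0%R) Stay c).
  by split=> [j z j3|j z]; rewrite act_stay; [rewrite h1|rewrite h2].
by exists n.+1, c'; split=> //; apply: exits_whenT => //; rewrite h1.
Qed.

Lemma tri_whenF i (p : pred sym) F O E : i < 3 -> ~~ p (O i 0%R) ->
  tri (fwhen i p F) O E O E 1.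
Proof.
move=> i3 pi; split=> c [h1 h2]; exists 1; eexists; split=> //.
  by apply: exits_whenF; rewrite h1.
by split=> [j z j3|j z]; rewrite act_stay; [rewrite h1|rewrite h2].
Qed.

Lemma tri_while i (p : pred sym) F n O E t : i < 3 ->
  (forall k, k < n -> p (O k i 0%R)) -> ~~ p (O n i 0%R) ->
  (forall k, k < n -> tri F (O k) (E k) (O k.+1) (E k.+1) t) ->
  tri (fwhile i p F) (O 0) (E 0) (O n) (E n) (n * t.+1 + 1).
Proof.
move=> i3; elim: n O E => [|n IH] O E pT pF tF; split=> c [h1 h2].
  exists 1; eexists; split=> //; first by apply: exits_whileF; rewrite h1.
  by split=> [j z j3|j z]; rewrite act_stay; [rewrite h1|rewrite h2].
have [||m [c' [e' i' le]]] := tri_run (c := act i (c i 0%R) Stay c) (tF 0 _) => //.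
  by split=> [j z j3|j z]; rewrite act_stay; [rewrite h1|rewrite h2].
have [k kn|k kn|m' [c2 [e2 i2 le2]]] :=
  tri_run (IH (fun k => O k.+1) (fun k => E k.+1) _ pF _) i'.
- exact: pT.
- exact: tF.
exists (m + m').+1, c2; split=> //; last by rewrite mulSn; lia.
by apply: exits_whileT e' e2; rewrite h1 // pT.
Qed.

Definition wsym (w : seq bool) (z : int) : sym :=
  if z is Posz n then nth None [seq Some (inl b) | b <- w] n else None.

(** * Polynomially bounded computable functions *)

(* A context lists two words and the values of finitely many variables, all of
   them functions of the elements of [ct]. *)
Record ctx := Ctx {
  ct :> Type;
  wordx : ct -> seq bool;
  wordy : ct -> seq bool;
  nvars : nat;
  var : ct -> nat -> nat }.
Arguments wordx {c}. Arguments wordy {c}. Arguments var {c}.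

Definition ext (C : ctx) : ctx :=
  @Ctx (C * nat)%type (fun u => wordx u.1) (fun u => wordy u.1) (nvars C).+1
    (fun u i => if i == nvars C then u.2 else var u.1 i).

Definition csize (C : ctx) (u : C) : nat :=
  size (wordx u) + size (wordy u) + \sum_(i < nvars C) var u i.

Lemma csize_ext (C : ctx) (u : C) i : csize (C := ext C) (u, i) = csize u + i.
Proof.
rewrite /csize /= big_ord_recr /= eqxx addnA; congr (_ + _ + _).
by apply: eq_bigr => j _; rewrite /= ltn_eqF.
Qed.

(** As the base is at least 2, a larger exponent absorbs constants, sums and products. *)
Definition poly_bounded (C : ctx) (f : C -> nat) :=
  exists k, forall u, f u <= (csize u + 2) ^ k.

Lemma leq_expn m n e : m <= n -> m ^ e <= n ^ e.
Proof. by case: e => // e le; rewrite leq_exp2r. Qed.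

Section Bounds.
Variable C : ctx.
Implicit Types f g : C -> nat.

Lemma pb_le f g : (forall u, f u <= g u) -> poly_bounded g -> poly_bounded f.
Proof. by move=> le [k h]; exists k => u; apply: leq_trans (le u) (h u). Qed.

Lemma pb_const n : poly_bounded (fun _ : C => n).
Proof.
exists n => u; apply: ltnW; apply: ltn_expl; lia.
Qed.

Lemma pb_mul f g : poly_bounded f -> poly_bounded g -> poly_bounded (fun u => f u * g u).
Proof. by move=> [k h] [l h']; exists (k + l) => u; rewrite expnD leq_mul. Qed.

Lemma pb_add f g : poly_bounded f -> poly_bounded g -> poly_bounded (fun u => f u + g u).
Proof.
move=> [k h] [l h']; exists (k + l).+1 => u; rewrite expnS expnD.
move: (h u) (h' u); set B := _ + 2; set x := B ^ k; set y := B ^ l => h1 h2.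
have x0 : 0 < x by rewrite expn_gt0 /B; lia.
have y0 : 0 < y by rewrite expn_gt0 /B; lia.
have B2 : 2 <= B by rewrite /B; lia.
have : 2 * (x * y) <= B * (x * y) by rewrite leq_mul2r B2 orbT.
nia.
Qed.

(** The bound on [g] is in terms of [csize u + i], and the index [i] is itself polynomially bounded,
    being below [f u]; a power of a power is a power. *)
Lemma pb_sum f (g : ext C -> nat) : poly_bounded f -> poly_bounded g ->
  poly_bounded (fun u => \sum_(i < f u) g (u, val i)).
Proof.
move=> pf [l hl]; have [k hk] := pb_add pf (pb_const 2).
apply: (pb_le (g := fun u => f u * (csize u + 2) ^ (k.+1 * l))) => [u|]; last first.
  by apply: pb_mul => //; exists (k.+1 * l).
rewrite -[f u in X in _ <= X]card_ord -sum_nat_const; apply: leq_sum => i _.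
have : val i < f u by apply: ltn_ord.
move: (val i) => j jf; apply: leq_trans (hl (u, j)) _; rewrite csize_ext expnM.
apply: leq_expn; move: (hk u); rewrite expnS.
move: jf; move: (f u) (csize u) ((csize u + 2) ^ k) => b a B h1 h2.
have : a * 1 <= a * B by rewrite leq_mul2l; lia.
by rewrite muln1 mulnDl; lia.
Qed.

End Bounds.

Definition reads_words (C : ctx) (u : C) (O : contents) :=
  O 1 =1 wsym (wordy u) /\ O 2 =1 wsym (wordx u).

(* A fragment computing [f] adds its value to the counter [d], given the values
   of the variables in the counters [loc i], and uses the counters from [s] on
   as scratch space. *)
Definition pc (C : ctx) (f : C -> nat) :=
  poly_bounded f /\ exists2 T : C -> nat, poly_bounded T &
  forall (loc : nat -> nat) d s,
    (forall i, i < nvars C -> loc i < s /\ loc i != d) -> d < s ->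
  exists F, forall u O E, reads_words u O ->
    (forall i, i < nvars C -> E (loc i) = var u i) -> (forall j, s <= j -> E j = 0) ->
    tri F O E O (upd E d (E d + f u)) (T u).

Lemma pc_ext (C : ctx) (f g : C -> nat) : f =1 g -> pc f -> pc g.
Proof.
move=> fg [[k bf] [T pT h]]; split; first by exists k => u; rewrite -fg.
exists T => // loc d s hl ds; have [F hF] := h loc d s hl ds.
by exists F => u O E; rewrite -fg; apply: hF.
Qed.

Lemma upd_same T (E : nat -> T) i n j : j = i -> upd E i n j = n.
Proof. by move=> ->; rewrite /upd eqxx. Qed.

Lemma upd_other T (E : nat -> T) i n j : j != i -> upd E i n j = E j.
Proof. by rewrite /upd => /negPf ->. Qed.

Ltac pb := repeat first [apply: pb_const | assumption | apply: pb_add | apply: pb_mul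
  | apply: pb_sum].

Ltac upds := let j := fresh "j" in move=> j; rewrite /upd;
  repeat match goal with |- context [@eq_op _ ?a ?b] => case: (@eqP _ a b) => [?|?] end;
  subst; try lia.
Ltac updj := rewrite /upd;
  repeat match goal with |- context [@eq_op _ ?a ?b] => case: (@eqP _ a b) => [?|?] end;
  subst; try lia.

Lemma pc0 (C : ctx) : pc (fun _ : C => 0).
Proof.
split; first exact: pb_const.
exists (fun=> 1); first exact: pb_const.
move=> loc d s hl ds; exists fskip => u O E _ _ _.
by apply: (tri_conv (tri_skip O E)) => // j; rewrite addn0 /upd; case: eqP => // ->.
Qed.

Lemma pcS (C : ctx) (f : C -> nat) : pc f -> pc (fun u => (f u).+1).
Proof.
move=> [pf [T pT h]]; split.
  by apply: pb_le (pb_add pf (pb_const C 1)) => u; rewrite addn1.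
exists (fun u => T u + 1); first exact: pb_add pT (pb_const C 1).
move=> loc d s hl ds; have [F hF] := h loc d s hl ds.
exists (fseq F (finc d)) => u O E w v z.
apply: tri_seq (hF u O E w v z) _.
by apply: (tri_conv (tri_inc d _ _)) => // j; rewrite /upd; case: eqP => // _; rewrite eqxx addnS.
Qed.

Lemma pc_const (C : ctx) n : pc (fun _ : C => n).
Proof. by elim: n => [|n IH]; [exact: pc0|exact: pcS]. Qed.

Lemma pc_add (C : ctx) (f g : C -> nat) : pc f -> pc g -> pc (fun u => f u + g u).
Proof.
move=> [pf [T pT h]] [pg [T' pT' h']]; split; first exact: pb_add.
exists (fun u => T u + T' u); first exact: pb_add.
move=> loc d s hl ds; have [F hF] := h loc d s hl ds; have [G hG] := h' loc d s hl ds.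
exists (fseq F G) => u O E w v z.
apply: tri_seq (hF u O E w v z) _; apply: (tri_conv (hG u O (upd E d (E d + f u)) w _ _)) => //.
- by move=> i iC; rewrite upd_other ?v //; case: (hl i iC).
- by move=> j sj; rewrite upd_other ?z //; lia.
- by move=> j; rewrite /upd; case: eqP => // _; rewrite eqxx addnA.
Qed.

Lemma pc_var (C : ctx) i : i < nvars C -> pc (fun u : C => var u i).
Proof.
move=> iC.
have pv : poly_bounded (fun u : C => var u i).
  exists 1 => u; rewrite expn1 /csize (bigD1 (Ordinal iC)) //=; lia.
split=> //; exists (fun u => (var u i * (2 + 3) + 3) + (var u i * (1 + 3) + 3)).
  by pb.
move=> loc d s hl ds; have [ls ld] := hl i iC.
(* Reading a counter destroys it: the first loop moves the variable to both [d] and [s], the second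
   one restores it from [s]. *)
exists (fseq (floop (loc i) (fseq (finc d) (finc s))) (floop s (finc (loc i)))).
move=> u O E w v z; have vi := v i iC; have zs : E s = 0 by apply: z.
set n := var u i in vi *.
pose E1 k := upd (upd (upd E d (E d + k)) s k) (loc i) (n - k).
pose E2 k := upd (upd (upd E d (E d + n)) (loc i) k) s (n - k).
apply: (tri_seq (O1 := O) (E1 := E1 n)).
  apply: (tri_ext (E := E1 0) (E' := E1 n)) => //.
    by rewrite /E1; upds.
  apply: (tri_loop (O := fun=> O)) => [k kn|k kn]; first by rewrite /E1 upd_same.
  apply: (tri_time (T := 1 + 1)) => //.
  apply: tri_seq (tri_inc _ _ _) _; apply: (tri_conv (tri_inc _ _ _)) => //.
  by rewrite /E1; upds.
apply: (tri_ext (E := E2 0) (E' := E2 n)).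
- by rewrite /E1 /E2; upds.
- by rewrite /E2; upds.
apply: (tri_loop (O := fun=> O)) => [k kn|k kn]; first by rewrite /E2 upd_same.
by apply: (tri_conv (tri_inc _ _ _)) => //; rewrite /E2; upds.
Qed.

Lemma pc_sum (C : ctx) (f : C -> nat) (g : C -> nat -> nat) :
  pc f -> pc (C := ext C) (fun u => g u.1 u.2) -> pc (fun u => \sum_(i < f u) g u i).
Proof.
move=> [pf [T pT h]] [pg [T' pT' h']].
split; first exact: (pb_sum pf pg).
exists (fun u => T u + ((f u * ((\sum_(i < f u) T' (u, val i) + 1) + 3) + 3) +
                        (f u * (1 + 3) + 3))).
  by pb.
move=> loc d s hl ds; set N := nvars C in hl *.
have [|//|F hF] := h loc s s.+1; first by move=> i /hl [? ?]; lia.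
(* The summation index lives in the counter [s.+1], which goes up while [s], the number of remaining
   terms, goes down. *)
pose loc' i := if i < N then loc i else s.+1.
have [||G hG] := h' loc' d s.+2.
- by move=> i _; rewrite /loc'; case: ifP => [/hl [? ?]|_]; [lia|split=> //; lia].
- lia.
(* The last loop only empties [s.+1], as scratch counters have to be returned at zero. *)
exists (fseq F (fseq (floop s (fseq G (finc s.+1))) (floop s.+1 fskip))) => u O E w v z.
have zs j : s <= j -> E j = 0 by apply: z.
have [zs0 zs1] : E s = 0 /\ E s.+1 = 0 by split; apply: z.
apply: (tri_seq (O1 := O) (E1 := upd E s (f u))).
  have tF : tri F O E O (upd E s (E s + f u)) (T u).
    by apply: hF => // j sj; apply: z; lia.
  by rewrite zs0 in tF.
set n := f u.
pose E1 k := upd (upd (upd E d (E d + \sum_(i < k) g u i)) s.+1 k) s (n - k).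
pose E2 k := upd (E1 n) s.+1 (n - k).
apply: (tri_seq (O1 := O) (E1 := E1 n)).
  apply: (tri_ext (E := E1 0) (E' := E1 n)) => //.
    by rewrite /E1 big_ord0; upds.
  apply: (tri_loop (O := fun=> O)) => [k kn|k kn]; first by rewrite /E1 upd_same.
  set E3 := upd (E1 k) s (n - k).-1.
  have tG : tri G O E3 O (upd E3 d (E3 d + g u k)) (T' (u, k)).
    apply: (hG (u, k)) => // [i iN|j sj] /=; last by rewrite /E3 /E1 -(z j) //; updj.
    rewrite /loc' /E3 /E1 -/N; case: (i =P N) => [->|iN']; first by rewrite ltnn; updj.
    have {}iN : i < N by move: iN iN'; rewrite /= -/N; lia.
    by rewrite iN -v //; have [? ?] := hl i iN; updj.
  apply: (tri_time (T := T' (u, k) + 1)).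
    by rewrite leq_add2r (bigD1 (Ordinal kn)) //= leq_addr.
  refine (tri_seq tG _); apply: (tri_conv (tri_inc _ _ _)) => //.
  by rewrite /E3 /E1 big_ord_recr /=; upds.
apply: (tri_ext (E := E2 0) (E' := E2 n)).
- by rewrite /E2 /E1; upds.
- by rewrite /E2 /E1; upds.
apply: (tri_loop (O := fun=> O)) => [k kn|k kn]; first by rewrite /E2 upd_same.
by apply: (tri_conv (tri_skip _ _)) => //; rewrite /E2; upds.
Qed.

Lemma pc_sub (C : ctx) (f g : C -> nat) : pc f -> pc g -> pc (fun u => f u - g u).
Proof.
move=> [pf [T pT h]] [pg [T' pT' h']]; split.
  by apply: pb_le pf => u; apply: leq_subr.
exists (fun u => T u + (T' u + ((g u * (2 + 3) + 3) + (f u * (1 + 3) + 3)))); first by pb.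
move=> loc d s hl ds.
have [|//|F hF] := h loc s s.+1; first by move=> i /hl [? ?]; lia.
have [||G hG] := h' loc s.+1 s.+2; [by move=> i /hl [? ?]; lia|by lia|].
exists (fseq F (fseq G (fseq (floop s.+1 (fdec s)) (floop s (finc d))))) => u O E w v z.
have [zs0 zs1] : E s = 0 /\ E s.+1 = 0 by split; apply: z.
apply: (tri_seq (O1 := O) (E1 := upd E s (f u))).
  have tF : tri F O E O (upd E s (E s + f u)) (T u).
    by apply: hF => // j sj; apply: z; lia.
  by rewrite zs0 in tF.
apply: (tri_seq (O1 := O) (E1 := upd (upd E s (f u)) s.+1 (g u))).
  set E3 := upd E s (f u).
  have tG : tri G O E3 O (upd E3 s.+1 (E3 s.+1 + g u)) (T' u).
    by rewrite /E3; apply: hG => // [i /[dup] iN /hl [? ?]|j sj]; [rewrite -v //; updj|rewrite -(z j); updj].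
  by apply: (tri_conv tG) => //; rewrite /E3; upds.
(* Decrementing an empty counter does nothing, so repeated decrements yield the truncated
   difference. *)
pose E1 k := upd (upd E s (f u - k)) s.+1 (g u - k).
pose E2 k := upd (upd E s (f u - g u - k)) d (E d + k).
apply: (tri_seq (O1 := O) (E1 := E1 (g u))).
  apply: (tri_ext (E := E1 0) (E' := E1 (g u))) => //; first by rewrite /E1; upds.
  apply: (tri_loop (O := fun=> O)) => [k kn|k kn]; first by rewrite /E1 upd_same.
  by apply: (tri_conv (tri_dec _ _ _)) => //; rewrite /E1; upds.
apply: (tri_time (T := (f u - g u) * (1 + 3) + 3)); first by nia.
apply: (tri_ext (E := E2 0) (E' := E2 (f u - g u))).
- by rewrite /E1 /E2; upds.
- by rewrite /E2; upds.
apply: (tri_loop (O := fun=> O)) => [k kn|k kn]; first by rewrite /E2; updj.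
by apply: (tri_conv (tri_inc _ _ _)) => //; rewrite /E2; upds.
Qed.

(** The three possible tape symbols as numbers: 0 past the end of the word, 1 for [false], 2 for
    [true]. *)
Definition letter (w : seq bool) n := if n < size w then (nth false w n).+1 else 0.

Lemma wsymE w n :
  wsym w n%:Z = if n < size w then Some (inl (nth false w n)) else None.
Proof.
rewrite /wsym; case: ltnP => h; first by rewrite (nth_map false).
by rewrite nth_default // size_map.
Qed.

Section Words.
Variables (C : ctx) (t : nat) (word : C -> seq bool).
Hypothesis t3 : 0 < t < 3.
Hypothesis wordP : forall u O, reads_words u O -> O t =1 wsym (word u).
Hypothesis word_size : forall u, size (word u) <= csize u.

Let moved (O : contents) k : contents := upd O t (fun z => O t (z + k%:Z)%R).

Let tri_right O E k : tri (fright t) (moved O k) E (moved O k.+1) E 1.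
Proof.
apply: (tri_weaken (@tri_move t MoveRight (moved O k) E _)) => //; first by case/andP: t3.
move=> j z _; rewrite /moved /upd eqxx; case: eqP => // _; rewrite /move_head /=.
by congr (O t _); lia.
Qed.

Let tri_left O E k : tri (fleft t) (moved O k.+1) E (moved O k) E 1.
Proof.
apply: (tri_weaken (@tri_move t MoveLeft (moved O k.+1) E _)) => //; first by case/andP: t3.
move=> j z _; rewrite /moved /upd eqxx; case: eqP => // _; rewrite /move_head /=.
by congr (O t _); lia.
Qed.

Let moved0 O i z : moved O 0 i z = O i z.
Proof. by rewrite /moved /upd; case: eqP => // ->; congr (O t _); lia. Qed.

Let tri_back s O E n : E s = n ->
  tri (floop s (fleft t)) (moved O n) E O (upd E s 0) (n * (1 + 3) + 3).
Proof.
move=> En; pose E1 k := upd E s (n - k); pose O1 k := moved O (n - k).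
apply: (tri_weaken (T := n * (1 + 3) + 3) (O1 := O1 0) (E1 := E1 0)
  (O2 := O1 n) (E2 := E1 n)) => //.
- apply: (tri_loop (O := O1) (E := E1)) => [k kn|k kn]; first by rewrite /E1 upd_same.
  rewrite /O1; have -> : n - k = (n - k.+1).+1 by lia.
  by apply: (tri_conv (tri_left _ _ _)) => //; rewrite /E1; upds.
- by rewrite /O1 subn0.
- by rewrite /E1; upds.
- by move=> i z _; rewrite /O1 subnn moved0.
- by rewrite /E1; upds.
Qed.

Lemma pc_letter_tape (f : C -> nat) : pc f -> pc (fun u => letter (word u) (f u)).
Proof.
move=> [pf [T pT h]]; split.
  by apply: pb_le (pb_const C 2) => u; rewrite /letter; case: ifP => // _; case: nth.
exists (fun u => T u + ((f u * (2 + 3) + 3) + (3 + (3 + (f u * (1 + 3) + 3))))); first by pb.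
move=> loc d s hl ds.
have [|//|F hF] := h loc s s.+1; first by move=> i /hl [? ?]; lia.
exists (fseq F (fseq (floop s (fseq (fright t) (finc s.+1)))
  (fseq (fwhen t (pred1 (Some (inl true))) (fseq (finc d) (finc d)))
  (fseq (fwhen t (pred1 (Some (inl false))) (finc d)) (floop s.+1 (fleft t)))))) => u O E w v z.
have [zs0 zs1] : E s = 0 /\ E s.+1 = 0 by split; apply: z.
apply: (tri_seq (O1 := O) (E1 := upd E s (f u))).
  have tF : tri F O E O (upd E s (E s + f u)) (T u).
    by apply: hF => // j sj; apply: z; lia.
  by rewrite zs0 in tF.
pose E1 k := upd (upd E s (f u - k)) s.+1 k.
set n := f u.
apply: (tri_seq (O1 := moved O n) (E1 := E1 n)).
  apply: (tri_weaken (T := n * (2 + 3) + 3) (O1 := moved O 0) (E1 := E1 0) (O2 := moved O n) (E2 := E1 n)) => //.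
  - apply: (tri_loop (O := moved O) (E := E1)) => [k kn|k kn]; first by rewrite /E1; updj.
    apply: (tri_time (T := 1 + 1)) => //.
    refine (tri_seq (tri_right _ _ _) _).
    by apply: (tri_conv (tri_inc _ _ _)) => //; rewrite /E1; upds.
  - by rewrite /E1; upds.
have scan : moved O n t 0%R = if n < size (word u) then Some (inl (nth false (word u) n)) else None.
  by rewrite /moved upd_same // (wordP w) add0r wsymE.
have [_ t3'] := andP t3.
(* [a2] is what the test for [true] has added; the test for [false] then adds the missing 1, if
   any. *)
pose a := letter (word u) n; pose a2 := if a == 2 then 2 else 0.
apply: (tri_seq (E1 := upd (E1 n) d (E d + a2)) (O1 := moved O n)).
  case: (boolP (pred1 (Some (inl true)) (moved O n t 0%R))) => [/[dup] b|/[dup] b] /=.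
    rewrite scan; case: ifP => // nw; case e: (nth _ _ _) => // _.
    apply: tri_whenT => //; refine (tri_seq (tri_inc _ _ _) _).
    apply: (tri_conv (tri_inc _ _ _)) => //.
    by rewrite /a2 /a /letter nw e /= /E1; upds.
  rewrite scan => c; apply: (tri_time (T := 1)) => //.
  apply: (tri_conv (tri_whenF _ _ t3' b)) => //.
  rewrite /a2 /a /letter; case: ifP c => [_|_ _] /=; last by rewrite /E1; upds.
  by case: (nth _ _ _) => //= _; rewrite /E1; upds.
apply: (tri_seq (E1 := upd (E1 n) d (E d + a)) (O1 := moved O n)).
  case: (boolP (pred1 (Some (inl false)) (moved O n t 0%R))) => [/[dup] b|/[dup] b] /=.
    rewrite scan; case: ifP => // nw; case e: (nth _ _ _) => // _.
    apply: (tri_time (T := 2)) => //; apply: tri_whenT => //.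
    apply: (tri_conv (tri_inc _ _ _)) => //.
    by rewrite /a2 /a /letter nw e /= /E1; upds.
  rewrite scan => c; apply: (tri_time (T := 1)) => //.
  apply: (tri_conv (tri_whenF _ _ t3' b)) => //.
  rewrite /a2 /a /letter; case: ifP c => [_|_ _] /=; last by rewrite /E1; upds.
  by case: (nth _ _ _) => //= _; rewrite /E1; upds.
apply: (tri_conv (tri_back (E := upd (E1 n) d (E d + a)) (n := n) _ _)) => //; first by rewrite /E1; updj.
by rewrite /E1; upds.
Qed.

Lemma pc_size_tape : pc (fun u => size (word u)).
Proof.
have pw : poly_bounded (fun u => size (word u)).
  by exists 1 => u; rewrite expn1; apply: leq_trans (word_size u) _; rewrite leq_addr.
split=> //.
exists (fun u => (size (word u) * 4 + 1) + (size (word u) * (1 + 3) + 3)); first by pb.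
move=> loc d s hl ds.
exists (fseq (fwhile t (predC1 None) (fseq (fright t) (fseq (finc s) (finc d))))
             (floop s (fleft t))) => u O E w v z.
have zs0 : E s = 0 by apply: z.
set n := size (word u).
pose E1 k := upd (upd E s k) d (E d + k).
apply: (tri_seq (O1 := moved O n) (E1 := E1 n)).
  apply: (tri_weaken (T := n * 4 + 1) (O1 := moved O 0) (E1 := E1 0) (O2 := moved O n) (E2 := E1 n)) => //.
  - have [_ t3'] := andP t3.
    apply: (tri_while (O := moved O) (E := E1) (t := 3) t3') => [k kn||k kn].
    + by rewrite /= /moved upd_same // (wordP w) add0r wsymE kn.
    + by rewrite /= /moved upd_same // (wordP w) add0r wsymE ltnn.
    apply: (tri_time (T := 1 + (1 + 1))) => //.
    refine (tri_seq (tri_right _ _ _) (tri_seq (tri_inc _ _ _) _)).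
    by apply: (tri_conv (tri_inc _ _ _)) => //; rewrite /E1; upds.
  - by rewrite /E1; upds.
apply: (tri_conv (tri_back (E := E1 n) (n := n) _ _)) => //; first by rewrite /E1; updj.
by rewrite /E1; upds.
Qed.

End Words.

Lemma pc_letterx (C : ctx) (f : C -> nat) : pc f -> pc (fun u => letter (wordx u) (f u)).
Proof. by apply: (pc_letter_tape (t := 2)) => // u O []. Qed.

Lemma pc_lettery (C : ctx) (f : C -> nat) : pc f -> pc (fun u => letter (wordy u) (f u)).
Proof. by apply: (pc_letter_tape (t := 1)) => // u O []. Qed.

Lemma pc_sizex (C : ctx) : pc (fun u : C => size (wordx u)).
Proof.
apply: (pc_size_tape (t := 2)) => // [u O []//|u].
by rewrite /csize -addnA leq_addr.
Qed.

Lemma pc_fst (C : ctx) (f : C -> nat) : pc f -> pc (C := ext C) (fun u => f u.1).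
Proof.
have mono (g : C -> nat) : poly_bounded g -> poly_bounded (C := ext C) (fun u => g u.1).
  move=> [k hk]; exists k => -[u i]; apply: leq_trans (hk u) _.
  by rewrite csize_ext; apply: leq_expn; lia.
move=> [pf [T pT h]]; split; first exact: mono.
exists (fun u => T u.1); first exact: mono.
move=> loc d s hl ds; have [|//|F hF] := h loc d s.
  by move=> i iC; apply: hl => /=; lia.
exists F => u O E w v z; apply: hF => // i iC.
by rewrite v /=; [rewrite ltn_eqF|lia].
Qed.

Lemma pc_snd (C : ctx) : pc (C := ext C) (fun u => u.2).
Proof.
apply: (pc_ext (f := fun u : ext C => var u (nvars C))); last by apply: (pc_var (C := ext C)) => /=.
by move=> u /=; rewrite eqxx.
Qed.

(** * Closure properties of computable functions and predicates *)

Definition pcb (C : ctx) (b : C -> bool) := pc (fun u => nat_of_bool (b u)).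

Section Closure.
Variable C : ctx.
Implicit Types f g : C -> nat.
Implicit Types a b : C -> bool.

Lemma pc_mul f g : pc f -> pc g -> pc (fun u => f u * g u).
Proof.
move=> pf pg; apply: (pc_ext (f := fun u => \sum_(i < f u) g u)).
  by move=> u; rewrite sum_nat_const card_ord.
by apply: (pc_sum (g := fun u _ => g u)) => //; apply: pc_fst.
Qed.

Lemma pcb_ext a b : a =1 b -> pcb a -> pcb b.
Proof. by move=> ab; apply: pc_ext => u; rewrite ab. Qed.

Lemma pcb_le f g : pc f -> pc g -> pcb (fun u => f u <= g u).
Proof.
move=> pf pg; apply: (pc_ext (f := fun u => 1 - (f u - g u))).
  by move=> u; case: leqP => h; lia.
by apply: pc_sub; [exact: pc_const|exact: pc_sub].
Qed.

Lemma pcb_lt f g : pc f -> pc g -> pcb (fun u => f u < g u).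
Proof. by move=> pf pg; apply: pcb_le => //; apply: pcS. Qed.

Lemma pcb_neg a : pcb a -> pcb (fun u => ~~ a u).
Proof.
move=> pa; apply: (pc_ext (f := fun u => 1 - a u)); first by move=> u; case: (a u).
by apply: pc_sub => //; apply: pc_const.
Qed.

Lemma pcb_and a b : pcb a -> pcb b -> pcb (fun u => a u && b u).
Proof.
move=> pa pb; apply: (pc_ext (f := fun u => a u * b u)); last exact: pc_mul.
by move=> u; rewrite mulnb.
Qed.

Lemma pcb_or a b : pcb a -> pcb b -> pcb (fun u => a u || b u).
Proof.
move=> pa pb; apply: (pcb_ext (a := fun u => ~~ (~~ a u && ~~ b u))).
  by move=> u; rewrite negb_and !negbK.
by apply: pcb_neg; apply: pcb_and; apply: pcb_neg.
Qed.

Lemma pcb_imp a b : pcb a -> pcb b -> pcb (fun u => a u ==> b u).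
Proof.
move=> pa pb; apply: (pcb_ext (a := fun u => ~~ a u || b u)).
  by move=> u; rewrite implybE.
by apply: pcb_or => //; apply: pcb_neg.
Qed.

Lemma pcb_eq f g : pc f -> pc g -> pcb (fun u => f u == g u).
Proof.
move=> pf pg; apply: (pcb_ext (a := fun u => (f u <= g u) && (g u <= f u))).
  by move=> u; rewrite eqn_leq.
by apply: pcb_and; apply: pcb_le.
Qed.

Lemma pcb_const (x : bool) : pcb (fun _ : C => x).
Proof. exact: pc_const. Qed.

Lemma pcb_eqb a b : pcb a -> pcb b -> pcb (fun u => a u == b u).
Proof.
move=> pa pb; apply: (pcb_ext (a := fun u => nat_of_bool (a u) == nat_of_bool (b u))).
  by move=> u; case: (a u); case: (b u).
exact: pcb_eq.
Qed.

Lemma pc_if a f g : pcb a -> pc f -> pc g -> pc (fun u => if a u then f u else g u).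
Proof.
move=> pa pf pg; apply: (pc_ext (f := fun u => a u * f u + (1 - a u) * g u)).
  by move=> u; case: (a u); rewrite ?mul1n ?mul0n ?addn0.
apply: pc_add; apply: pc_mul => //; apply: pc_sub => //; exact: pc_const.
Qed.

Lemma pcb_has (p : C -> nat -> bool) f : pc f -> pcb (C:=ext C) (fun u => p u.1 u.2) ->
  pcb (fun u => has (p u) (iota 0 (f u))).
Proof.
move=> pf pp.
apply: (pcb_ext (a := fun u => 0 < \sum_(i < f u) p u i)).
  move=> u; rewrite lt0n sum_nat_eq0 negb_forall.
  apply/existsP/hasP => [[i /= pi]|[i]].
    by exists (val i); [rewrite mem_iota /=|case: (p u i) pi].
  by rewrite mem_iota /= => il pi; exists (Ordinal il); rewrite /= pi.
apply: pcb_lt; first exact: pc_const.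
exact: (pc_sum (g := fun u i => nat_of_bool (p u i))).
Qed.

End Closure.

(** With the indicators of all values at hand, composing with any function on the finite type is a
    finite sum, whatever that function is. *)
Definition pcf (C : ctx) (A : finType) (g : C -> A) := forall a, pcb (fun u => g u == a).

Section Closure2.
Variable C : ctx.
Implicit Types f g : C -> nat.
Implicit Types a b : C -> bool.

Lemma pcb_fst b : pcb b -> pcb (C := ext C) (fun u => b u.1).
Proof. exact: (@pc_fst C (fun u => nat_of_bool (b u))). Qed.

Lemma pcb_all (p : C -> nat -> bool) f : pc f -> pcb (C:=ext C) (fun u => p u.1 u.2) ->
  pcb (fun u => all (p u) (iota 0 (f u))).
Proof.
move=> pf pp; apply: (pcb_ext (a := fun u => ~~ has (fun i => ~~ p u i) (iota 0 (f u)))).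
  by move=> u; rewrite has_predC negbK.
by apply: pcb_neg; apply: pcb_has => //; apply: pcb_neg.
Qed.

Lemma sum_ltn n m : \sum_(i < n) (i < m) = minn m n.
Proof.
elim: n => [|n IH]; first by rewrite big_ord0 minn0.
by rewrite big_ord_recr /= IH; lia.
Qed.

Lemma pc_div f g : pc f -> pc g -> pc (fun u => f u %/ g u).
Proof.
move=> pf pg.
(* The quotient counts the positive multiples of the divisor up to the dividend; for a zero divisor
   the count would be [f u] and not 0. *)
apply: (pc_ext (f := fun u => if g u == 0 then 0 else \sum_(i < f u) (i.+1 * g u <= f u))).
  move=> u; case: eqP => [->|/eqP g0]; first by rewrite divn0.
  rewrite -[RHS](minn_idPl (leq_div _ (g u))) -sum_ltn; apply: eq_bigr => i _.
  by rewrite leq_divRL ?lt0n.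
apply: pc_if; [by apply: pcb_eq => //; exact: pc_const|exact: pc_const|].
apply: (pc_sum (g := fun u i => nat_of_bool (i.+1 * g u <= f u))) => //.
apply: (pcb_le (f := fun u : ext C => u.2.+1 * g u.1)); last exact: pc_fst.
by apply: pc_mul; [apply: pcS; exact: pc_snd|exact: pc_fst].
Qed.

Lemma pc_mod f g : pc f -> pc g -> pc (fun u => f u %% g u).
Proof.
move=> pf pg; apply: (pc_ext (f := fun u => f u - f u %/ g u * g u)).
  by move=> u; rewrite {1}(divn_eq (f u) (g u)) addKn.
by apply: pc_sub => //; apply: pc_mul => //; apply: pc_div.
Qed.

Lemma pc_exp f n : pc f -> pc (fun u => f u ^ n).
Proof.
move=> pf; elim: n => [|n IH]; first exact: pc_const.
apply: (pc_ext (f := fun u => f u * f u ^ n)); first by move=> u; rewrite expnS.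
exact: pc_mul.
Qed.

Lemma pc_poly f (p : {poly nat}) : pc f -> pc (fun u => p.[f u]%R).
Proof.
move=> pf; rewrite /horner; elim: {p}(polyseq p) => [|c s IH]; first exact: pc_const.
by apply: (pc_add (f := fun u => horner_rec s (f u) * f u)); [apply: pc_mul|apply: pc_const].
Qed.

Lemma pc_bigsum I (r : seq I) (F : C -> I -> nat) : (forall i, pc (fun u => F u i)) ->
  pc (fun u => \sum_(i <- r) F u i).
Proof.
move=> pF; elim: r => [|i r IH].
  by apply: (pc_ext (f := fun _ : C => 0)); [move=> u; rewrite big_nil|exact: pc_const].
apply: (pc_ext (f := fun u => F u i + \sum_(j <- r) F u j)).
  by move=> u; rewrite big_cons.
exact: pc_add.
Qed.

Lemma pcb_allseq I (r : seq I) (F : C -> I -> bool) : (forall i, pcb (fun u => F u i)) ->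
  pcb (fun u => all (F u) r).
Proof.
by move=> pF; elim: r => [|i r IH] /=; [exact: pcb_const|exact: pcb_and].
Qed.

Lemma pcb_pcf b : pcb b -> pcf b.
Proof.
move=> pb [].
  by apply: pcb_ext pb => u; case: (b u).
by apply: pcb_ext (pcb_neg pb) => u; case: (b u).
Qed.

Lemma pc_fun (A : finType) (g : C -> A) (h : A -> nat) : pcf g -> pc (fun u => h (g u)).
Proof.
move=> pg; apply: (pc_ext (f := fun u => \sum_(a <- enum A) (g u == a) * h a)).
  move=> u; rewrite big_enum (bigD1 (g u)) //= eqxx mul1n big1 ?addn0 // => a.
  by rewrite eq_sym => /negPf ->.
by apply: pc_bigsum => a; apply: pc_mul; [exact: pg|exact: pc_const].
Qed.

Lemma pcf_fun (A B : finType) (g : C -> A) (h : A -> B) : pcf g -> pcf (fun u => h (g u)).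
Proof. by move=> pg y; exact: (pc_fun (fun x => nat_of_bool (h x == y)) pg). Qed.

Lemma pcb_fun (A : finType) (g : C -> A) (h : A -> bool) : pcf g -> pcb (fun u => h (g u)).
Proof. by move=> pg; exact: (pc_fun (fun x => nat_of_bool (h x)) pg). Qed.

Lemma pcf_pair (A B : finType) (g : C -> A) (h : C -> B) :
  pcf g -> pcf h -> pcf (fun u => (g u, h u)).
Proof.
move=> pg ph [a b]; apply: (pcb_ext (a := fun u => (g u == a) && (h u == b))) => //.
exact: pcb_and.
Qed.

Lemma pcf_nth (A : finType) (x : A) (s : seq A) f : pc f -> pcf (fun u => nth x s (f u)).
Proof.
move=> pf a.
elim: s f pf => [|y s IH] f pf.
  apply: (pcb_ext (a := fun _ : C => x == a)); last exact: pcb_const.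
  by move=> u; rewrite nth_nil.
apply: (pc_ext (f := fun u => if f u == 0 then nat_of_bool (y == a)
                              else nat_of_bool (nth x s (f u - 1) == a))).
  by move=> u; case: (f u) => [|n] //=; rewrite subn1.
apply: pc_if; [by apply: pcb_eq => //; exact: pc_const|exact: pc_const|].
by apply: IH; apply: pc_sub => //; apply: pc_const.
Qed.

End Closure2.

Lemma pcf_ext (C : ctx) (A : finType) (f g : C -> A) : f =1 g -> pcf f -> pcf g.
Proof. by move=> fg pf a; apply: pcb_ext (pf a) => u; rewrite fg. Qed.

(** * From fragments to Turing machines *)

Section MachineOfFragment.
Variable F : frag.

(** Tape 3 has to exist in any case, as the verdict is read from it. *)
Definition last_tape := maxn 3 (\max_(s : fstate F) ftape s).

(* After leaving the fragment, one more step accepts iff tape 3 scans a mark. *)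
Definition tm_trans (q : option (fstate F) + bool) (a : {ffun 'I_last_tape.+1 -> sym}) :
    (option (fstate F) + bool)%type * {ffun 'I_last_tape.+1 -> sym * move} :=
  match q with
  | inl (Some s) =>
      let: (o, b, m) := fnext s (a (inord (ftape s))) in
      (inl o, [ffun i => if val i == ftape s then (b, m) else (a i, Stay)])
  | inl None => (inr (a (inord 3) == mark), [ffun i => (a i, Stay)])
  | inr b => (inr b, [ffun i => (a i, Stay)])
  end.

Definition tm_of : tm :=
  @TM last_tape (option (fstate F) + bool)%type unit (inl (Some (finit F)))
    (fun q => if q is inr _ then true else false)
    (fun q => if q is inr b then b else false) tm_trans.

Definition tapes_are (T : {ffun 'I_last_tape.+1 -> tape (bool + unit)}) (c : contents) :=
  forall i, tape_at (T i) =1 c i.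

Lemma inord_tape i : i <= last_tape -> (inord i : 'I_last_tape.+1) = i :> nat.
Proof. by move=> h; rewrite inordK. Qed.

Lemma ftape_le (s : fstate F) : ftape s <= last_tape.
Proof. by rewrite leq_max (leq_bigmax s) orbT. Qed.

Lemma step_sim s (T : {ffun 'I_last_tape.+1 -> tape (bool + unit)}) c o b m :
  tapes_are T c -> fnext s (c (ftape s) 0%R) = (o, b, m) ->
  exists2 T', step (M := tm_of) (Config (M := tm_of) (inl (Some s)) T) =
                Config (M := tm_of) (inl o) T' & tapes_are T' (act (ftape s) b m c).
Proof.
move=> Tc e; have sle := ftape_le s.
have e' : fnext s (scanned (T (inord (ftape s)))) = (o, b, m).
  by rewrite -e -{2}(inord_tape sle) -Tc.
rewrite /step /=; eexists; first by rewrite ffunE e'.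
move=> i z; rewrite !ffunE /act; case: (val i =P ftape s) => [ei|ni].
  by rewrite tape_at_shift_write /= Tc -ei.
rewrite tape_at_shift_write /= addr0 Tc; case: eqP => // ->.
by rewrite -Tc.
Qed.

Lemma run_sim s c n c' : exits s c n c' -> forall T, tapes_are T c ->
  exists2 T', iter n (step (M := tm_of)) (Config (M := tm_of) (inl (Some s)) T) =
                Config (M := tm_of) (inl None) T' & tapes_are T' c'.
Proof.
elim=> [{}s {}c a m e|{}s s' {}c a m {}n {}c' e _ IH] T Tc.
  exact: step_sim Tc e.
have [T1 e1 T1c] := step_sim Tc e; have [T2 e2 T2c] := IH _ T1c.
by exists T2 => //; rewrite iterSr e1.
Qed.

Definition init_contents (ws : seq (seq bool)) : contents :=
  fun i => wsym (nth [::] ws i).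

Lemma init_sim ws : tapes_are (ctapes (init tm_of ws)) (init_contents ws).
Proof.
move=> i z; rewrite /init /= ffunE /tape_of_seq /init_contents /wsym.
case: z => [n|n] /=; last by rewrite nth_nil.
by case: (nth _ ws i) => [|b s]; case: n => //= n; rewrite !nth_nil.
Qed.

Lemma halted_iter (M : tm) n (c : config M) : halted c -> iter n (@step M) c = c.
Proof. by move=> h; elim: n => //= n ->; rewrite /step; move: h; rewrite /halted => ->. Qed.

Lemma tm_of_run ws n c' t : exits (finit F) (init_contents ws) n c' -> n < t ->
  exists2 T, run tm_of ws t = Config (M := tm_of) (inr (c' 3 0%R == mark)) T & tapes_are T c'.
Proof.
move=> e nt; have [T eT Tc] := run_sim e (init_sim ws).
have l3 : 3 <= last_tape by rewrite leq_maxl.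
have [T' eT' Tc'] : exists2 T', step (M := tm_of) (Config (M := tm_of) (inl None) T) =
    Config (M := tm_of) (inr (c' 3 0%R == mark)) T' & tapes_are T' c'.
  rewrite /step /=; eexists.
    by rewrite !ffunE; congr (Config _ _); rewrite -{2}(inord_tape l3) -Tc.
  move=> i z; rewrite !ffunE tape_at_shift_write /= addr0 Tc; case: eqP => // ->.
  by rewrite -Tc.
exists T' => //; rewrite /run; have -> : t = (t - n.+1) + n.+1 by lia.
by rewrite iterD iterS eT eT' halted_iter.
Qed.

End MachineOfFragment.

Lemma leading_lettersE (M : tm) (s : seq (option (bool + aux M))) (w : seq bool) :
  (forall n, nth None s n = nth None [seq Some (inl b) | b <- w] n) -> leading_letters s = w.
Proof.
elim: w s => [|b w IH] [|a s] h //=.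
- by have /= -> := h 0.
- by have := h 0.
have /= -> := h 0; congr (_ :: _); apply: IH => n; exact: (h n.+1).
Qed.

Local Open Scope ring_scope.
Lemma horner_poly_bound k n : (('X + 2%:P : {poly nat}) ^+ k).[n] = ((n + 2) ^ k)%N.
Proof.
elim: k => [|k IH]; first by rewrite expr0 hornerC.
by rewrite exprS hornerM IH hornerD hornerX hornerC expnS.
Qed.
Local Close Scope ring_scope.

(** * Machines for verifiers and for functions on words *)

Definition words_ctx : ctx :=
  @Ctx (seq bool * seq bool)%type fst snd 0 (fun _ _ => 0).

(** The first tape must be free for the output, so the input is copied to tape 2. The head of the
    first tape stays on the blank after the input, which will end an output written towards the
    left. *)
Definition copy_input : frag :=
  fseq (fwhile 0 (predC1 None)
         (fseq (fwhen 0 (pred1 (Some (inl true))) (fbasic 2 (fun _ => (Some (inl true), MoveRight))))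
         (fseq (fwhen 0 (pred1 (Some (inl false))) (fbasic 2 (fun _ => (Some (inl false), MoveRight))))
         (fseq (fright 0) (finc 0)))))
       (floop 0 (fleft 2)).

Definition input_contents (x y : seq bool) : contents :=
  fun i z => if i == 0 then wsym x (z + (size x)%:Z)%R
             else if i == 1 then wsym y z else wsym x z.

Lemma tri_copy x y :
  tri copy_input (init_contents [:: x; y]) (fun _ => 0) (input_contents x y) (fun _ => 0)
      (size x * 7 + 1 + (size x * (1 + 3) + 3)).
Proof.
set n := size x.
(* After [k] rounds the head of tape 0 is on letter [k], and tape 2 carries the first [k] letters to
   the left of its head; the second loop then brings that head back to the first letter. *)
pose O k : contents := fun i z =>
  if i == 0 then wsym x (z + k%:Z)%R else if i == 1 then wsym y z
  else if (0 <= z + k%:Z)%R && (z < 0)%R then wsym x (z + k%:Z)%R else None.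
have O00 k : O k 0 0%R = wsym x k%:Z by rewrite /O eqxx; congr wsym; lia.
pose E k := upd (fun _ => 0) 0 k.
apply: (tri_seq (O1 := O n) (E1 := E n)).
  apply: (tri_weaken (T := n * 7 + 1) (O1 := O 0) (E1 := E 0) (O2 := O n) (E2 := E n)) => //.
  - apply: (tri_while (O := O) (E := E) (t := 6)) => // [k kn||k kn].
    + by rewrite O00 wsymE kn.
    + by rewrite O00 wsymE ltnn.
    pose O1 : contents := fun i z => if i == 2 then O k.+1 i z else O k i z.
    have sc : O k 0 0%R = Some (inl (nth false x k)) by rewrite O00 wsymE kn.
    have sc1 : O1 0 0%R = Some (inl (nth false x k)) by [].
    have tb b : nth false x k = b ->
      tri (fbasic 2 (fun _ => (Some (inl b), MoveRight))) (O k) (E k) O1 (E k) 1.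
      move=> xb; apply: (tri_weaken (@tri_basic 2 _ _ _ _)) => // i z i3 /=.
      rewrite /upd /O1; case: eqP => // ->; rewrite /O /=.
      case: eqP => [z1|z1].
        have -> : (z + k.+1%:Z = k%:Z)%R by lia.
        by rewrite wsymE kn xb; case: ifP => //; lia.
      have -> : (z + 1 + k = z + k.+1)%R by lia.
      by congr (if _ && _ then _ else _); lia.
    apply: (tri_time (T := 2 + (2 + (1 + 1)))) => //.
    apply: (tri_seq (O1 := if nth false x k then O1 else O k) (E1 := E k)).
      case e: (nth false x k).
        by apply: tri_whenT => //; [rewrite /= sc e|exact: tb].
      by apply: (tri_time (T := 1)) => //; apply: tri_whenF => //; rewrite /= sc e.
    apply: (tri_seq (O1 := O1) (E1 := E k)).
      case e: (nth false x k); last first.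
        by apply: tri_whenT => //; [rewrite /= sc e|exact: tb].
      by apply: (tri_time (T := 1)) => //; apply: tri_whenF => //; rewrite /= sc1 e.
    apply: (tri_seq (O1 := O k.+1) (E1 := E k)).
      apply: (tri_weaken (@tri_move 0 MoveRight _ _ _)) => // i z i3.
      rewrite /upd /move_head /O1 /=; case: eqP => [->|i0] /=.
        by rewrite /O /=; congr wsym; lia.
      by case: ifP => // i2; rewrite /O; case: eqP => // _; case: eqP => //; lia.
    by apply: (tri_conv (tri_inc _ _ _)) => //; rewrite /E; upds.
  - case=> [|[|[|i]]] z //= _; rewrite /O /= /init_contents /=; first by congr wsym; lia.
    by rewrite /wsym; case: z => [m|m] /=; rewrite ?nth_nil //; case: ifP => //; lia.
  - by rewrite /E; upds.
pose O2 k : contents := fun i z => if i == 2 then O n 2 (z - k%:Z)%R else O n i z.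
pose E2 k := upd (fun _ => 0) 0 (n - k).
apply: (tri_weaken (T := n * (1 + 3) + 3) (O1 := O2 0) (E1 := E2 0) (O2 := O2 n) (E2 := E2 n)) => //.
- apply: (tri_loop (O := O2) (E := E2)) => [k kn|k kn]; first by rewrite /E2 upd_same.
  apply: (tri_weaken (@tri_move 2 MoveLeft _ _ _)) => //.
  + move=> i z i3; rewrite /upd /move_head /O2 /=; case: eqP => // _.
    by congr (O n 2 _); lia.
  + by rewrite /E2; upds.
- by move=> i z _; rewrite /O2; case: eqP => // ->; congr (O n 2 _); lia.
- by rewrite /E /E2; upds.
- case=> [|[|[|i]]] z //= _; rewrite /O2 /O /input_contents /=.
  have -> : (z - n%:Z + n%:Z)%R = z by lia.
  case: z => [m|m]; last by [].
  rewrite wsymE -/n; case: ifP => [|h].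
    by case: ltnP => //; lia.
  by case: ltnP h => //; lia.
- by rewrite /E2; upds.
Qed.

Lemma inv_init (ws : seq (seq bool)) : size ws <= 3 ->
  holds_at (init_contents ws) (fun _ => 0) (init_contents ws).
Proof.
move=> s3; split=> // i z; rewrite /init_contents nth_default; last by lia.
by rewrite /wsym counter0; case: z => // n; rewrite nth_nil.
Qed.

Lemma NP_of_pc (L : language) (p : {poly nat}) (V : words_ctx -> nat) : pc V ->
  (forall x, L x <-> exists y, size y <= p.[size x]%R /\ 0 < V (x, y)) -> NP L.
Proof.
move=> [pV [T [k hk] h]] LV.
have [|//|F hF] := h id 0 1; first by [].
(* The value of [V] is in counter 0, that is on tape 3; after a move to the left this tape scans a
   mark iff the value is positive. *)
pose G := fseq (fseq copy_input F) (fleft 3).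
(* The exponent [k] is for [F], and 8 absorbs the linear time of copying, whose coefficients are
   below 2 ^ 7. *)
pose q : {poly nat} := (('X + 2%:P) ^+ (k + 8))%R.
have run_G x y : exists2 T, run (tm_of G) [:: x; y] q.[size x + size y]%R =
    Config (M := tm_of G) (inr (0 < V (x, y))) T & True.
  have tF : tri F (input_contents x y) (fun _ => 0) (input_contents x y)
      (upd (fun _ => 0) 0 (V (x, y))) (T (x, y)).
    exact: hF.
  have [n [c [e ic le]]] := tri_run (tri_seq (tri_copy x y) tF) (@inv_init [:: x; y] isT).
  have [c' e' [_ i2]] := exits_left 0 ic.
  have [|T' -> _] := tm_of_run (t := q.[size x + size y]%R) (exits_seq e e').
    rewrite horner_poly_bound expnD.
    have := hk (x, y); rewrite /csize /= big_ord0 addn0; move: le.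
    set B := size x + size y + 2; set t := T _ => le le'.
    have Bk : 0 < B ^ k by rewrite expn_gt0 /B; lia.
    have B2 : 2 <= B by rewrite /B; lia.
    have B8 : 2 ^ 7 * B <= B ^ 8 by rewrite (expnSr B 7) leq_mul2r (leq_expn 7 B2) orbT.
    have : B ^ k + B ^ 8 <= B ^ k * B ^ 8 + 1.
      have : 0 < B ^ 8 by rewrite expn_gt0 /B; lia.
      by move: Bk; generalize (B ^ k) (B ^ 8) => a b; nia.
    move: B8 le le'; rewrite /B /=; lia.
  by exists T'; rewrite // i2 eqxx /upd eqxx sub0r counter_shift; case: (0 < _).
exists (tm_of G), p, q; split=> [x y|x] /=.
  by have [T' -> _] := run_G x y.
rewrite LV; split=> -[y [ly hy]]; exists y; split=> //; have [T' e _] := run_G x y; move: hy.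
  by rewrite e.
by rewrite e.
Qed.

Lemma poly_time_of_pc (L : words_ctx -> nat) (b : ext words_ctx -> bool) : pc L -> pcb b ->
  poly_time_computable (fun x => mkseq (fun i => b ((x, [::]), i)) (L (x, [::]))).
Proof.
move=> [pL [T pT h]] [pB [T' pT' h']].
have [|//|F hF] := h id 0 1; first by [].
have [|//|G hG] := h' (fun _ => 0) 1 2; first by [].
pose out c := fbasic 0 (fun _ => (Some (inl c), Stay)).
(* Counter 0 is both the loop counter and the index of the letter, so the output is written from its
   last letter to its first. Each letter is first written as [false]; the loop on counter 1, which
   holds the bit, corrects it. *)
pose body := fseq G (fseq (fseq (fleft 0) (out false)) (floop 1 (out true))).
pose P := fseq (fseq copy_input F) (floop 0 body).
pose time (u : words_ctx) := (size (wordx u) * 7 + 1 + (size (wordx u) * (1 + 3) + 3)) + T u +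
   (L u * (\sum_(i < L u) T' (u, val i) + (2 + (1 * (1 + 3) + 3)) + 3) + 3).
have [k hk] : poly_bounded time.
  have ps : poly_bounded (fun u : words_ctx => size (wordx u)) by case: (pc_sizex words_ctx).
  rewrite /time; pb.
exists (tm_of P), (('X + 2%:P) ^+ k.+1)%R => x /=.
set u : words_ctx := (x, [::]); set n := L u.
have tF : tri F (input_contents x [::]) (fun _ => 0) (input_contents x [::])
    (upd (fun _ => 0) 0 n) (T u).
  exact: hF.
pose suf k := [seq b (u, i) | i <- iota (n - k) k].
pose O k : contents := fun i z =>
  if i == 0 then (if z is Posz m then wsym (suf k) m else wsym x (z + (size x)%:Z - k%:Z)%R)
  else input_contents x [::] i z.
pose E k := upd (fun _ => 0) 0 (n - k).
have tL : tri (floop 0 body) (O 0) (E 0) (O n) (E n)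
   (n * (\sum_(i < n) T' (u, val i) + (2 + (1 * (1 + 3) + 3)) + 3) + 3).
  apply: (tri_loop (O := O) (E := E)) => [j jn|j jn]; first by rewrite /E upd_same.
  set i := n - j.+1; have ij : (n - j).-1 = i by rewrite /i; lia.
  have i_n : i < n by rewrite /i; lia.
  pose E1 : nat -> nat := upd (fun _ => 0) 0 i.
  pose a := b (u, i).
  have tG : tri G (O j) E1 (O j) (upd E1 1 (E1 1 + a)) (T' (u, i)).
    apply: (hG (u, i)) => [|[|m] // _|m m2] /=; first by split=> z.
    by rewrite /E1 upd_other //; lia.
  apply: (tri_time (T := T' (u, i) + (2 + (1 * (1 + 3) + 3)))).
    by rewrite leq_add2r (bigD1 (Ordinal i_n)) //= leq_addr.
  apply: (tri_ext (E := E1) (E' := E1)).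
  - by rewrite /E /E1 ij; upds.
  - by rewrite /E /E1 -/i; upds.
  refine (tri_seq tG _).
  pose O1 c : contents := fun t z => if (t == 0) && (z == 0)%R then Some (inl c) else O j.+1 t z.
  apply: (tri_seq (O1 := O1 false) (E1 := upd E1 1 a)).
    refine (tri_seq (T1 := 1) (T2 := 1) (@tri_move 0 MoveLeft (O j) _ _) _) => //.
    apply: (tri_weaken (@tri_basic 0 _ _ _ _)) => // t z t3.
    rewrite /upd /O1 /=; case: (t =P 0) => [->|t0] /=; last by rewrite /O; case: eqP t0.
    rewrite addr0; case: eqP => // z0; rewrite /O /= /move_head /=.
    case: z z0 => [[|m]|m] // _.
      have -> : (m.+1%:Z - 1 = m)%R by lia.
      by rewrite /suf; have -> : n - j = (n - j.+1).+1 by lia.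
    have -> : (Negz m - 1 = Negz m.+1)%R by lia.
    by congr wsym; lia.
  pose E2 c := upd E1 1 (a - c).
  apply: (tri_time (T := a * (1 + 3) + 3)); first by case: (a).
  apply: (tri_weaken (T := a * (1 + 3) + 3) (O1 := O1 false) (O2 := O1 a) (E1 := E2 0) (E2 := E2 a)) => //.
  - pose O2 c := O1 (0 < c).
    apply: (tri_weaken (O1 := O2 0) (O2 := O2 a) (T := a * (1 + 3) + 3) (E1 := E2 0) (E2 := E2 a)) => //.
      apply: (tri_loop (O := O2) (E := E2)) => [c _|c ca]; first by rewrite /E2 upd_same.
      apply: (tri_weaken (@tri_basic 0 _ _ _ _)) => //.
      + move=> t z t3; rewrite /upd /O2 /O1 /=; case: eqP => [->|_] //=.
        by rewrite addr0; case: eqP.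
      + by rewrite /E2; upds.
    by move=> t z t3; rewrite /O2; case: (a).
  - by rewrite /E2 subn0.
  - move=> t z _; rewrite /O1; case: ifP => // /andP[/eqP -> /eqP ->].
    by rewrite /O /= /suf /= -/i.
  - by rewrite /E2 /E1; upds.
have tP : tri P (init_contents [:: x]) (fun _ => 0) (O n) (E n) (time u).
  apply: (tri_seq (O1 := O 0) (E1 := E 0)); last exact: tL.
  apply: (tri_weaken (tri_seq (tri_copy x [::]) tF)) => //.
  - by case=> [|[|[|i]]] z.
  - case=> [|[|[|i]]] // z _; rewrite /input_contents /O /=.
    case: z => [m|m]; last by congr wsym; lia.
    have -> : (m%:Z + (size x)%:Z = (m + size x)%N)%R by lia.
    by rewrite wsymE nth_nil; case: ltnP => //; lia.
  - by rewrite /E; upds.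
have [m [c [e [h1 _] le]]] := tri_run tP (@inv_init [:: x] isT).
have [|T1 -> Tc] := tm_of_run (t := ((('X + 2%:P) ^+ k.+1 : {poly nat}).[size x])%R) e.
  rewrite horner_poly_bound; apply: leq_ltn_trans le _; apply: leq_ltn_trans (hk u) _.
  by rewrite /csize /= big_ord0 !addn0 ltn_exp2l //; lia.
split=> //; apply: (@leading_lettersE (tm_of P)) => j.
have := Tc ord0 (Posz j); rewrite /= => ->.
by rewrite h1 // /O /= /suf subnn.
Qed.

(** * Colourings of complements and triangles *)

Definition co_adj (V : finType) (h : rel V) : rel V := fun u v => (u != v) && ~~ h u v.

Lemma co_adj_sym (V : finType) (h : rel V) : symmetric h -> symmetric (co_adj h).
Proof. by move=> hs u v; rewrite /co_adj eq_sym hs. Qed.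

Lemma co_adj_irrefl (V : finType) (h : rel V) : irreflexive (co_adj h).
Proof. by move=> u; rewrite /co_adj eqxx. Qed.

Definition coG (V : finType) (h : rel V) (hs : symmetric h) : graph :=
  Graph (co_adj_sym hs) (@co_adj_irrefl V h).

(** Chords are allowed: thus a clique on four vertices is excluded as well, which bounds the colour
    classes. *)
Definition no_4cycle (V : finType) (h : rel V) := forall u w v w', u != v -> w != w' ->
  h u w -> h w v -> h v w' -> h w' u -> False.

Definition no_5cycle (V : finType) (h : rel V) := forall v0 v1 v2 v3 v4,
  uniq [:: v0; v1; v2; v3; v4] -> h v0 v1 -> h v1 v2 -> h v2 v3 -> h v3 v4 -> h v4 v0 -> False.

Section Complement.
Variables (V : finType) (h : rel V).
Hypotheses (hs : symmetric h) (h4 : no_4cycle h) (h5 : no_5cycle h).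

Let emb (H : graph) (f : H -> V) : injective f ->
  (forall u v, co_adj h (f u) (f v) = adj u v) ->
  forall u v, u != v -> ~~ adj u v -> h (f u) (f v).
Proof. by move=> fi fa u v uv; rewrite -fa /co_adj (inj_eq fi) uv /= negbK. Qed.

Lemma co_no_induced4 (H : graph) (x y z w : H) : uniq [:: x; y; z; w] ->
  ~~ adj x z -> ~~ adj z y -> ~~ adj y w -> ~~ adj w x -> ~ has_induced H (coG hs).
Proof.
rewrite /= !inE !negb_or => /and4P[/and3P[xy xz xw] /andP[yz yw] zw _].
move=> axz azy ayw awx [f [fi fa]].
apply: (h4 (u := f x) (v := f y) (w := f z) (w' := f w)); rewrite ?(inj_eq fi) //;
  by apply: (emb fi fa); rewrite // eq_sym.
Qed.

Lemma co_no_C5 : ~ has_induced (cycleG 5) (coG hs).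
Proof.
move=> [f [fi fa]].
pose o n (l : n < 5) := Ordinal l : cycleG 5.
apply: (h5 (v0 := f (@o 0 isT)) (v1 := f (@o 2 isT)) (v2 := f (@o 4 isT))
           (v3 := f (@o 1 isT)) (v4 := f (@o 3 isT)));
  by [rewrite /= !inE !(inj_eq fi)|apply: (emb fi fa)].
Qed.

(* The complements of [4P_1], [2P_1 + P_2] and [2P_2] contain a 4-cycle, and that
   of [C_5] is a 5-cycle. *)
Lemma co_free : induced_free [:: cycleG 5; copiesG 4 (pathG 1);
  unionG (copiesG 2 (pathG 1)) (pathG 2); copiesG 2 (pathG 2)] (coG hs).
Proof.
move=> H /= [<-|[<-|[<-|[<-|[]]]]]; first exact: co_no_C5.
- pose o n (l : n < 4) : copiesG 4 (pathG 1) := (Ordinal l, ord0).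
  by apply: (@co_no_induced4 _ (@o 0 isT) (@o 1 isT) (@o 2 isT) (@o 3 isT)).
- pose o n (l : n < 2) : unionG (copiesG 2 (pathG 1)) (pathG 2) := inl (Ordinal l, ord0).
  pose q n (l : n < 2) : unionG (copiesG 2 (pathG 1)) (pathG 2) := inr (Ordinal l).
  by apply: (@co_no_induced4 _ (@o 0 isT) (@o 1 isT) (@q 0 isT) (@q 1 isT)).
pose o n (l : n < 2) m (l' : m < 2) : copiesG 2 (pathG 2) := (Ordinal l, Ordinal l').
by apply: (@co_no_induced4 _ (@o 0 isT 0 isT) (@o 0 isT 1 isT) (@o 1 isT 0 isT) (@o 1 isT 1 isT)).
Qed.

Lemma clique_le3 (A : {set V}) : {in A &, forall u v, u != v -> h u v} -> #|A| <= 3.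
Proof.
move=> cl; rewrite leqNgt; apply/negP => A4.
have /card_gt0P[x xA] : 0 < #|A| by lia.
have /card_gt2P[y [z [w [[yA zA wA] [yz zw wy]]]]] : 2 < #|A :\ x|.
  by move: A4; rewrite (cardsD1 x) xA.
move: yA zA wA; rewrite !inE => /andP[yx yA] /andP[zx zA] /andP[wx wA].
apply: (h4 (u := x) (v := y) (w := z) (w' := w));
  by first [done | by rewrite eq_sym | by apply: cl | by apply: cl; rewrite // eq_sym].
Qed.

Lemma sum_eq_terms (I : finType) (a b : I -> nat) : (forall i, a i <= b i) ->
  \sum_i b i <= \sum_i a i -> forall i, a i = b i.
Proof.
move=> ab le i.
have := leqif_sum (P := predT) (fun i _ => leqif_eq (ab i)).
move=> [le' e]; move: e; rewrite eqn_leq le' le => /esym/forallP/(_ i) /=.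
by move/eqP.
Qed.

Definition triangle_sum m := 3 * \sum_(i < m) i.+1.

Lemma sum_sub m : \sum_(j < m) (m - j) = \sum_(i < m) i.+1.
Proof. by rewrite (reindex_inj rev_ord_inj); apply: eq_bigr => i _ /=; have := ltn_ord i; lia. Qed.

(* With at most three vertices of each colour, the sum is least when every colour
   [1], ..., [m] occurs exactly three times. *)
Lemma colouring_triangles m (c : V -> nat) : #|V| = 3 * m ->
  colouring (G := coG hs) c -> \sum_v c v <= triangle_sum m ->
  forall v, #|[set u | c u == c v]| = 3.
Proof.
move=> Vm [c0 cE] le.
have fib j : #|[set u | c u == j]| <= 3.
  apply: clique_le3 => u v; rewrite !inE => /eqP cu /eqP cv uv.
  by apply/negPn/negP => nh; apply: (cE u v); rewrite ?cu ?cv //= /co_adj uv.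
pose n j := #|[set u | c u <= j]|.
have nS j : n j.+1 = n j + #|[set u | c u == j.+1]|.
  rewrite /n -!sum1_card big_mkcond [X in _ = X + _]big_mkcond [X in _ = _ + X]big_mkcond.
  rewrite -big_split; apply: eq_bigr => u _; rewrite !inE /=.
  by case: (leqP (c u) j.+1); case: (leqP (c u) j); case: eqP; lia.
have n0 : n 0 = 0.
  by apply: eq_card0 => u; rewrite !inE leqNgt c0.
have nle j : n j <= 3 * j.
  by elim: j => [|j IH]; rewrite ?n0 // nS; have := fib j.+1; lia.
(* Layer by layer, each [j] counts the vertices of colour above [j]. Capping the colours at [m]
   leaves [m] layers, which already add up to the budget, so that all the inequalities are
   equalities. *)
have cnt : \sum_v minn m (c v) = \sum_(j < m) (3 * m - n j).
  rewrite (eq_bigr (fun v => \sum_(j < m) nat_of_bool (j < c v))) => [|v _]; last by rewrite sum_ltn minnC.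
  rewrite exchange_big; apply: eq_bigr => j _; rewrite -Vm.
  suff <- : n j + \sum_v (j < c v) = #|V| by rewrite addKn.
  rewrite /n -sum1_card [X in X + _]big_mkcond -big_split -sum1_card.
  by apply: eq_bigr => v _; rewrite inE ltnNge; case: (c v <= j).
have le1 : triangle_sum m <= \sum_(j < m) (3 * m - n j).
  rewrite /triangle_sum -sum_sub big_distrr /=; apply: leq_sum => j _.
  by have := nle j; lia.
have cm v : minn m (c v) = c v.
  by move: v; apply: sum_eq_terms => [v|]; [exact: geq_minr|rewrite cnt; lia].
have nE j : j <= m -> n j = 3 * j.
  have eqs : \sum_v c v = \sum_(j < m) (3 * m - n j).
    by rewrite -cnt; apply: eq_bigr => v _; rewrite cm.
  rewrite leq_eqVlt => /orP[/eqP->|jm].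
    rewrite -Vm /n -cardsT; apply: eq_card => u.
    by rewrite !inE -(cm u) geq_minl.
  have e : 3 * (m - j) = 3 * m - n j.
    apply: (@sum_eq_terms _ (fun j : 'I_m => 3 * (m - j)) (fun j => 3 * m - n j) _ _ (Ordinal jm)).
      by move=> i; have := nle i; lia.
    by rewrite -big_distrr /= sum_sub -eqs.
  by have := nle j; lia.
move=> v; have := c0 v; have := cm v; case: (c v) => // k km _.
have := nS k; rewrite !nE; lia.
Qed.

(** The labels [g] name the triangles. There are [m] of them, and numbering them in any order uses
    each of the first [m] colours three times. *)
Lemma triangles_colouring m (L : eqType) (g : V -> L) : #|V| = 3 * m ->
  (forall u v, g u = g v -> u != v -> h u v) ->
  (forall v, exists u w, [/\ u != v, w != v, u != w, g u = g v & g w = g v]) ->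
  exists2 c : V -> nat, colouring (G := coG hs) c & \sum_v c v <= triangle_sum m.
Proof.
move=> Vm gh g3.
have card3 v : #|[set u | g u == g v]| = 3.
  apply/eqP; rewrite eqn_leq; apply/andP; split.
    by apply: clique_le3 => u w; rewrite !inE => /eqP gu /eqP gw; apply: gh; rewrite gu.
  have [u [w [uv wv uw gu gw]]] := g3 v.
  apply/card_gt2P; exists u, w, v; rewrite !inE gu gw !eqxx; split=> //; split=> //.
  by rewrite eq_sym.
pose s := undup [seq g v | v <- enum V].
have gs v : g v \in s by rewrite mem_undup map_f // mem_enum.
pose c v := (index (g v) s).+1.
exists c.
  split=> // u v /= /andP[uv nh] [] e; move/negP: nh; apply.
  by apply: gh => //; rewrite -(nth_index (g v) (gs u)) e nth_index.
have part (F : nat -> nat) : \sum_v F (index (g v) s) = \sum_(i < size s) 3 * F i.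
  have idx v : index (g v) s < size s by rewrite index_mem.
  rewrite (partition_big (fun v => Ordinal (idx v)) predT) //=.
  apply: eq_bigr => i _.
  have : tnth (in_tuple s) i \in s by apply: mem_tnth.
  rewrite mem_undup => /mapP[v _ ev].
  have iv : index (g v) s = i.
    by rewrite -ev (tnth_nth (g v)) index_uniq ?undup_uniq.
  rewrite (eq_bigr (fun _ => F i)) => [|u /eqP <- //].
  rewrite sum_nat_const -(card3 v); congr (_ * _); apply: eq_card => u.
  rewrite inE -topredE /= -iv; apply/eqnP/eqP => [e|-> //].
  by rewrite -(nth_index (g v) (gs u)) e nth_index.
have sm : size s = m.
  have := part (fun _ => 1); rewrite sum1_card Vm sum_nat_const card_ord; lia.
by rewrite (part succn) /triangle_sum big_distrr sm.
Qed.

End Complement.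

(** * Exact covers as partitions into triangles *)

Section Wheels.
Variables (V : finType) (Q : nat).
Local Notation X := (V * 'I_Q)%type.
Variables (att : X -> option X) (real : pred X).

Definition nx (x : X) : X := (x.1, ordS x.2).
Definition pv (x : X) : X := (x.1, ord_pred x.2).

(** Elements and private apexes are both named by places, and the boolean tells them apart. A pair
    [(true, c)] with [c] not [real] is attached to no wheel; being [tied], it is served by its own
    three copies. *)
Definition apex (x : X) : bool * X := if att x is Some c then (true, c) else (false, x).
Definition tied (o : bool * X) : bool := ~~ o.1 || ~~ real o.2.

(* Three copies of the gadget; [None] marks the rim of a wheel, [Some false] the
   private apex of a rim edge and [Some true] an element to be covered.  The wheel
   of [v] stands for a set of elements: the apex of its rim edge [x] is the element
   [att x], or private.  When the triangles on every other rim edge of an even wheel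
   are taken, the elements of the set are either all covered or all left alone.  The
   three copies of an apex that no wheel has to cover form a triangle. *)
Definition wheel_vertex := ('I_3 * (option bool * X))%type.

Definition wheel_adj : rel wheel_vertex := fun u v =>
  let: (i, (k, x)) := u in let: (j, (l, y)) := v in
  match k, l with
  | None, None => (i == j) && ((y == nx x) || (x == nx y))
  | None, Some b => (i == j) && (((b, y) == apex x) || ((b, y) == apex (pv x)))
  | Some b, None => (i == j) && (((b, x) == apex y) || ((b, x) == apex (pv y)))
  | Some b, Some c => [&& i != j, (b, x) == (c, y) & tied (b, x)]
  end.

Lemma wheel_adj_sym : symmetric wheel_adj.
Proof.
move=> [i [[b|] x]] [j [[c|] y]] //=; rewrite (eq_sym i j) //; last by rewrite orbC.
by rewrite (eq_sym (b, x)); case: ((c, y) =P (b, x)) => [->|_] //; rewrite !andbF.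
Qed.

(** A rim of length at least six has no 4- or 5-cycle and no two vertices joined by both short arcs;
    even length permits taking every other edge. Elements on even edges only, each at most once in a
    wheel, keep apexes from closing short cycles. *)
Hypotheses (Q6 : 6 <= Q) (Qeven : ~~ odd Q).
Hypothesis att_even : forall x c, att x = Some c -> ~~ odd x.2.
Hypothesis att_inj : forall x y c, att x = Some c -> att y = Some c -> x.1 = y.1 -> x = y.
Hypothesis att_real : forall x c, att x = Some c -> real c.

Lemma nxK : cancel nx pv.
Proof. by move=> [v i]; rewrite /nx /pv ordSK. Qed.

Lemma pvK : cancel pv nx.
Proof. by move=> [v i]; rewrite /nx /pv ord_predK. Qed.

Lemma nx_inj : injective nx.
Proof. exact: can_inj nxK. Qed.

Lemma odd_nx x : odd (nx x).2 = ~~ odd x.2.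
Proof.
case: x => v [i iQ] /=; case: (ltngtP i.+1 Q) => [h|h|h]; last 2 first.
- lia.
- by rewrite -h modnn; move: Qeven; rewrite -h /= negbK => ->.
by rewrite modn_small.
Qed.

Lemma iter_nx k x : 0 < k < 6 -> iter k nx x != x.
Proof.
move=> k6; apply/eqP; case: x => v i.
have e m : iter m nx (v, i) = (v, iter m (@ordS Q) i) by elim: m => //= m ->.
have e2 m : iter m (@ordS Q) i = (i + m) %% Q :> nat.
  elim: m => [|m IH] /=; first by rewrite addn0 modn_small.
  by rewrite IH -addn1 modnDml addn1 addnS.
rewrite e => -[] /(congr1 val) /= /eqP; rewrite e2 -{2}(modn_small (ltn_ord i)).
rewrite -{2}[val i]addn0 eqn_modDl mod0n modn_small; lia.
Qed.

Lemma apex_edge x y : apex x = apex y -> x.1 = y.1 -> x = y.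
Proof.
rewrite /apex; case ex: (att x) => [c|]; case ey: (att y) => [d|] // [e]; last by [].
by subst d; apply: att_inj ex ey.
Qed.

Lemma apex_private x x' y' : apex x = apex x' -> apex (nx x) = apex y' ->
  x = x' \/ nx x = y'.
Proof.
rewrite /apex; case ex: (att x) => [c|]; last by case: (att x') => [d|] [] // ->; left.
case ey: (att (nx x)) => [d|]; last by case: (att y') => [d|] _ [] // ->; right.
by have := att_even ey; rewrite odd_nx (att_even ex).
Qed.

Definition rim (x y : X) := y = nx x \/ x = nx y.
Definition spoke (x : X) (o : bool * X) := exists2 e, o = apex e & x = e \/ x = nx e.

Lemma spokeP x o : reflect (spoke x o) ((o == apex x) || (o == apex (pv x))).
Proof.
apply: (iffP orP) => [[/eqP->|/eqP->]|[e -> [->|->]]].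
- by exists x => //; left.
- by exists (pv x) => //; right; rewrite pvK.
- by left.
- by right; rewrite nxK.
Qed.

Lemma rim_sym x y : rim x y -> rim y x.
Proof. by case=> ->; [right|left]. Qed.

Lemma rim_wheel x y : rim x y -> x.1 = y.1.
Proof. by case=> ->. Qed.

Lemma spoke_wheel x e : x = e \/ x = nx e -> x.1 = e.1.
Proof. by case=> ->. Qed.

Lemma nx1 x : x <> nx x.
Proof. by move=> e; have /eqP[] := @iter_nx 1 x isT; rewrite /= -e. Qed.

Lemma nx2 x : x <> nx (nx x).
Proof. by move=> e; have /eqP[] := @iter_nx 2 x isT; rewrite /= -e. Qed.

Lemma nx3 x : x <> nx (nx (nx x)).
Proof. by move=> e; have /eqP[] := @iter_nx 3 x isT; rewrite /= -e. Qed.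

Lemma nx4 x : x <> nx (nx (nx (nx x))).
Proof. by move=> e; have /eqP[] := @iter_nx 4 x isT; rewrite /= -e. Qed.

Lemma nx5 x : x <> nx (nx (nx (nx (nx x)))).
Proof. by move=> e; have /eqP[] := @iter_nx 5 x isT; rewrite /= -e. Qed.

Ltac nx_contra x := have := @nx1 x; have := @nx1 (nx x); have := @nx1 (nx (nx x));
  have := @nx2 x; have := @nx2 (nx x); have := @nx3 x; have := @nx4 x; have := @nx5 x;
  congruence.

Lemma rim2 x y z : rim x y -> rim y z -> x <> z ->
  y = nx x /\ z = nx y \/ x = nx y /\ y = nx z.
Proof.
case=> e [] e' xz; [by left| | |by right].
- by case: xz; apply: nx_inj; rewrite -e -e'.
- by case: xz; rewrite e e'.
Qed.

Lemma rim3 x y z w : rim x y -> rim y z -> rim z w -> x <> z -> y <> w ->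
  [/\ y = nx x, z = nx y & w = nx z] \/ [/\ x = nx y, y = nx z & z = nx w].
Proof.
move=> xy yz zw xz yw; case: (rim2 xy yz xz) => -[e1 e2]; case: (rim2 yz zw yw) => -[e3 e4].
- by left.
- by nx_contra y.
- by nx_contra z.
- by right.
Qed.

(** Within one wheel an apex belongs to a single rim edge, and the two vertices must be its ends. *)
Lemma same_edge x y o : spoke x o -> spoke y o -> x.1 = y.1 -> x <> y -> rim x y.
Proof.
move=> [e -> ex] [e' ee' ey] w xy.
have {}ee' : e = e' by apply: apex_edge => //; rewrite -(spoke_wheel ex) -(spoke_wheel ey).
by subst e'; case: ex ey => ex [] ey; rewrite ex ey in xy *; [case: xy|left|right|case: xy].
Qed.

Lemma rim_spoke x y z o : rim x y -> rim y z -> x <> z -> spoke x o -> spoke z o -> False.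
Proof.
move=> xy yz xz sx sz.
have := same_edge sx sz _ xz; rewrite (rim_wheel xy) (rim_wheel yz) => /(_ erefl) rxz.
by case: (rim2 xy yz xz) => -[e1 e2]; case: rxz => e3; [nx_contra x|nx_contra x|nx_contra z|nx_contra z].
Qed.

Lemma rim3_spoke x y z w o : rim x y -> rim y z -> rim z w -> x <> z -> y <> w -> x <> w ->
  spoke x o -> spoke w o -> False.
Proof.
move=> xy yz zw xz yw xw sx sw.
have := same_edge sx sw _ xw.
rewrite (rim_wheel xy) (rim_wheel yz) (rim_wheel zw) => /(_ erefl) rxw.
by case: (rim3 xy yz zw xz yw) => -[e1 e2 e4]; case: rxw => e3;
  [nx_contra x|nx_contra x|nx_contra w|nx_contra w].
Qed.

Lemma rim_no_4cycle x y z w : rim x y -> rim y z -> rim z w -> rim w x ->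
  x <> z -> y <> w -> False.
Proof.
move=> xy yz zw wx xz yw; case: (rim3 xy yz zw xz yw) => -[e1 e2 e4]; case: wx => e3;
  by [nx_contra x|nx_contra w].
Qed.

Lemma rim_no_5cycle x y z w t : rim x y -> rim y z -> rim z w -> rim w t -> rim t x ->
  x <> z -> y <> w -> z <> t -> False.
Proof.
move=> xy yz zw wt tx xz yw zt; case: (rim3 xy yz zw xz yw) => -[e1 e2 e4];
  case: (rim3 yz zw wt yw zt) => -[e5 e6 e7]; case: tx => e3;
  by [nx_contra x|nx_contra w|nx_contra z|nx_contra t].
Qed.

(* The spokes at [z] end at apexes of the two rim edges at [z], one of which is
   private. *)
Lemma two_spokes x y z o o' : o <> o' -> spoke z o -> spoke z o' -> spoke x o -> spoke y o' ->
  z.1 = x.1 \/ z.1 = y.1.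
Proof.
move=> oo [e oe ez] [e' oe' ez'] [f of_ fx] [f' of' fy].
have consec : e' = nx e \/ e = nx e'.
  case: ez ez' => -> [] h; [|by right|by left|]; case: oo; rewrite oe oe' ?h //.
  by rewrite (nx_inj h).
rewrite (spoke_wheel fx) (spoke_wheel fy); case: consec => c.
  have [] := @apex_private e f f'; rewrite -?oe -?c -?oe' // => <-.
    by left; exact: spoke_wheel ez.
  by right; exact: spoke_wheel ez'.
have [] := @apex_private e' f' f; rewrite -?oe' -?c -?oe // => <-.
  by right; exact: spoke_wheel ez'.
by left; exact: spoke_wheel ez.
Qed.

(** By [two_spokes] both vertices lie in one wheel, where they would be the ends of two distinct rim
    edges. This excludes 4-cycles that alternate between rim and apexes. *)
Lemma two_apexes x y o o' : x <> y -> o <> o' -> spoke x o -> spoke y o -> spoke x o' ->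
  spoke y o' -> False.
Proof.
move=> xy oo sxo syo sxo' syo'.
have w : x.1 = y.1 by case: (two_spokes oo sxo sxo' syo syo').
have [e oe ex] := sxo; have [f of_ fy] := syo.
have [e' oe' ex'] := sxo'; have [f' of' fy'] := syo'.
have ef : e = f.
  by apply: apex_edge; rewrite -?oe -?of_ // -(spoke_wheel ex) -(spoke_wheel fy).
have ef' : e' = f'.
  by apply: apex_edge; rewrite -?oe' -?of' // -(spoke_wheel ex') -(spoke_wheel fy').
have ee : e <> e' by congruence.
by subst f f'; have := @nx2 e; have := @nx2 e'; have := @nx_inj e e';
  case: ex ex' => h1 [] h2; case: fy fy' => h3 [] h4; try congruence; move=> /(_ _); intuition congruence.
Qed.

(** The 5-cycle through two apexes that meet at [z]: one of them is private, so all three rim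
    vertices lie in one wheel and would form a triangle on its rim. *)
Lemma three_spokes x y z o o' : rim x y -> x <> z -> y <> z -> o <> o' ->
  spoke y o -> spoke z o -> spoke z o' -> spoke x o' -> False.
Proof.
move=> xy xz yz oo syo szo szo' sxo'.
have w : z.1 = y.1 by case: (two_spokes oo szo szo' syo sxo') => // ->; exact: rim_wheel.
have ryz := same_edge syo szo (esym w) yz.
have rzx : rim z x.
  by apply: same_edge szo' sxo' _ _; [rewrite w (rim_wheel xy)|apply/nesym].
by case: (rim2 xy ryz xz) => -[e1 e2]; case: rzx => e3; [nx_contra x|nx_contra x|nx_contra z|nx_contra z].
Qed.

Lemma wheel_adjP u v : wheel_adj u v ->
  let: (i, (k, x)) := u in let: (j, (l, y)) := v in
  match k, l with
  | None, None => i = j /\ rim x y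
  | None, Some b => i = j /\ spoke x (b, y)
  | Some b, None => i = j /\ spoke y (b, x)
  | Some b, Some c => [/\ i <> j, (b, x) = (c, y) & tied (b, x)]
  end.
Proof.
case: u v => [i [[b|] x]] [j [[c|] y]] /=.
- by case/and3P=> /eqP ? /eqP ? ?.
- by case/andP=> /eqP -> /spokeP.
- by case/andP=> /eqP -> /spokeP.
- by case/andP=> /eqP -> /orP[] /eqP ?; split=> //; [left|right].
Qed.

Definition core (u : wheel_vertex) := u.2.1 == None.

Ltac ne := solve [ case=> *; subst; match goal with H : _ <> _ |- _ => by apply: H end
  | let e := fresh in move=> e; subst; match goal with H : _ <> _ |- _ => by apply: H end ].

Lemma no_4cycle_core u w v w' : core u -> u != v -> w != w' ->
  wheel_adj u w -> wheel_adj w v -> wheel_adj v w' -> wheel_adj w' u -> False.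
Proof.
case: u w v w' => [i [[b|] x]] [j [k y]] [l [m z]] [n [p t]] // _ uv ww.
move=> /wheel_adjP h1 /wheel_adjP h2 /wheel_adjP h3 /wheel_adjP h4.
case: k m p h1 h2 h3 h4 uv ww => [k|] [m|] [p|] [? h1].
- by move=> [? e2 _] [? e3 _] [? h4] _ /eqP ww; subst; apply: ww; case: e2 e3 => -> -> [-> ->].
- by move=> [? e2 _] [? h3] [? h4]; subst.
- move=> [? h2] [? h3] [? h4] /eqP uv /eqP ww; subst.
  by apply: (two_apexes (x := x) (y := z) _ _ h1 h2 h4 h3); ne.
- move=> [? h2] [? h3] [? h4] /eqP uv /eqP ww; subst.
  by apply: (rim_spoke (rim_sym h4) (rim_sym h3) _ h1 h2); ne.
- by move=> [? h2] [? e3 _] [? h4]; subst.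
- move=> [? h2] [? h3] [? h4] /eqP uv /eqP ww; subst.
  by apply: (rim_spoke (rim_sym h1) (rim_sym h4) _ h2 h3); ne.
- move=> [? h2] [? h3] [? h4] /eqP uv /eqP ww; subst.
  by apply: (rim_spoke h1 h2 _ h4 h3); ne.
move=> [? h2] [? h3] [? h4] /eqP uv /eqP ww; subst.
by apply: (rim_no_4cycle h1 h2 h3 h4); ne.
Qed.

Lemma outer_adj u v : ~~ core u -> ~~ core v -> wheel_adj u v -> u.1 <> v.1 /\ u.2 = v.2.
Proof.
case: u v => [i [[b|] x]] [j [[c|] y]] // _ _ /wheel_adjP[? e _]; split=> //=.
by case: e => -> ->.
Qed.

(** A cycle through a rim vertex is rotated to start there; any other one stays among the copies of
    a single apex, of which there are only three. *)
Lemma wheel_no_4cycle : no_4cycle wheel_adj.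
Proof.
move=> u w v w' uv ww h1 h2 h3 h4.
have [cu|cu] := boolP (core u); first exact: (no_4cycle_core cu uv ww h1 h2 h3 h4).
have [cw|cw] := boolP (core w).
  by apply: (no_4cycle_core cw ww _ h2 h3 h4 h1); rewrite eq_sym.
have [cv|cv] := boolP (core v).
  by apply: (no_4cycle_core cv _ _ h3 h4 h1 h2); rewrite eq_sym.
have [cw'|cw'] := boolP (core w').
  by apply: (no_4cycle_core cw' _ uv h4 h1 h2 h3); rewrite eq_sym.
have [a1 b1] := outer_adj cu cw h1; have [a2 b2] := outer_adj cw cv h2.
have [a3 b3] := outer_adj cv cw' h3; have [a4 b4] := outer_adj cw' cu h4.
have fst_neq (p q : wheel_vertex) : p != q -> p.2 = q.2 -> p.1 != q.1.
  by case: p q => [? ?] [? ?] /= ne e; subst; apply: contra ne => /eqP ->.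
have U : uniq [:: u.1; w.1; v.1; w'.1].
  rewrite /= !inE !negb_or andbT (fst_neq u v uv) ?b1 // (fst_neq w w' ww) ?b2 //.
  by do ![apply/andP; split]; apply/eqP => // /esym.
have := max_card [in [:: u.1; w.1; v.1; w'.1]].
by rewrite (card_uniqP U) card_ord.
Qed.

Lemma no_5cycle_core v0 v1 v2 v3 v4 : core v0 -> uniq [:: v0; v1; v2; v3; v4] ->
  wheel_adj v0 v1 -> wheel_adj v1 v2 -> wheel_adj v2 v3 -> wheel_adj v3 v4 ->
  wheel_adj v4 v0 -> False.
Proof.
move=> c0 /=; rewrite !inE !negb_or => /and5P[/and4P[/eqP u1 /eqP u2 /eqP u3 /eqP u4]].
move=> /and3P[/eqP u5 /eqP u6 /eqP u7] /andP[/eqP u8 /eqP u9] /eqP u10 _.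
move=> /wheel_adjP h1 /wheel_adjP h2 /wheel_adjP h3 /wheel_adjP h4 /wheel_adjP h5.
case: v0 v1 v2 v3 v4 c0 h1 h2 h3 h4 h5 u1 u2 u3 u4 u5 u6 u7 u8 u9 u10
  => [i [[//|] x0]] [j [k x1]] [l [m x2]] [n [p x3]] [o [q x4]] _.
case: k m p q => [k|] [m|] [p|] [q|] /= h1 h2 h3 h4 h5 u1 u2 u3 u4 u5 u6 u7 u8 u9 u10;
  (first [case: h1 => [? h1 _]|case: h1 => [? h1]]);
  (first [case: h5 => [? h5 _]|case: h5 => [? h5]]);
  (first [case: h2 => [? h2 _]|case: h2 => [? h2]]);
  (first [case: h3 => [? h3 _]|case: h3 => [? h3]]);
  (first [case: h4 => [? h4 _]|case: h4 => [? h4]]);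
  subst; try by [].
(* A run of apexes on the cycle consists of copies of one apex, and its ends lie in the same copy as
   the rim vertices. So a run of length two is absurd, and the ends of a longer run coincide. *)
- by case: u7; case: h2 h3 h4 => -> -> [-> ->] [-> ->].
- by case: u6; case: h2 h3 => -> -> [-> ->].
- by apply: (three_spokes h5 _ _ _ h1 h2 h3 h4); ne.
- by apply: (three_spokes (rim_sym h3) _ _ _ h2 h1 h5 h4); ne.
- by apply: (rim3_spoke h3 h4 h5 _ _ _ h2 h1); ne.
- by case: u9; case: h3 h4 => -> -> [-> ->].
- by apply: (three_spokes h1 _ _ _ h2 h3 h4 h5); ne.
- by apply: (rim3_spoke h4 h5 h1 _ _ _ h3 h2); ne.
- by apply: (rim3_spoke h5 h1 h2 _ _ _ h4 h3); ne.
- by apply: (rim3_spoke h1 h2 h3 _ _ _ h5 h4); ne.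
by apply: (rim_no_5cycle h1 h2 h3 h4 h5); ne.
Qed.

Lemma wheel_no_5cycle : no_5cycle wheel_adj.
Proof.
move=> v0 v1 v2 v3 v4 U h1 h2 h3 h4 h5.
have rotU (s : seq wheel_vertex) : uniq s -> uniq (rot 1 s) by rewrite rot_uniq.
have U1 := rotU _ U; have U2 := rotU _ U1; have U3 := rotU _ U2; have U4 := rotU _ U3.
have [c0|c0] := boolP (core v0); first exact: (no_5cycle_core c0 U h1 h2 h3 h4 h5).
have [c1|c1] := boolP (core v1); first exact: (no_5cycle_core c1 U1 h2 h3 h4 h5 h1).
have [c2|c2] := boolP (core v2); first exact: (no_5cycle_core c2 U2 h3 h4 h5 h1 h2).
have [c3|c3] := boolP (core v3); first exact: (no_5cycle_core c3 U3 h4 h5 h1 h2 h3).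
have [_ b1] := outer_adj c0 c1 h1; have [_ b2] := outer_adj c1 c2 h2.
have [_ b3] := outer_adj c2 c3 h3.
have U' : uniq [:: v0.1; v1.1; v2.1; v3.1].
  have : uniq [:: v0; v1; v2; v3] by apply: subseq_uniq U; rewrite /= !eqxx.
  have -> : [:: v0.1; v1.1; v2.1; v3.1] = map fst [:: v0; v1; v2; v3] by [].
  rewrite map_inj_in_uniq // => p q ip iq e.
  have bE r : r \in [:: v0; v1; v2; v3] -> r.2 = v0.2.
    by rewrite !inE => /or4P[] /eqP -> //; rewrite -?b3 -?b2 -?b1.
  by move: e (bE p ip) (bE q iq); case: p q {ip iq} => [? ?] [? ?] /= -> -> ->.
have := max_card [in [:: v0.1; v1.1; v2.1; v3.1]].
by rewrite (card_uniqP U') card_ord.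
Qed.

Definition exact_cover (f : V -> bool) := forall c, real c ->
  exists2 x, att x = Some c /\ f x.1 & forall y, att y = Some c -> f y.1 -> y = x.

(** * From partitions into triangles to exact covers *)

Section FromTriangles.
Variable c : wheel_vertex -> nat.
Hypothesis c_clique : forall u v, c u = c v -> u != v -> wheel_adj u v.
Hypothesis c3 : forall v, #|[set u | c u == c v]| = 3.

Let R x : wheel_vertex := (ord0, (None, x)).
Let O o : wheel_vertex := (ord0, (Some o.1, o.2)).

Definition selected x := c (R x) == c (R (nx x)).

Lemma class_third u v w t : c u = c v -> c w = c v -> u != v -> w != v -> u != w ->
  c t = c v -> [|| t == u, t == v | t == w].
Proof.
move=> cu cw uv wv uw ct; apply/negPn/negP; rewrite !negb_or => /and3P[tu tv tw].
have U : uniq [:: t; u; v; w] by rewrite /= !inE !negb_or tu tv tw uv uw eq_sym wv.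
have /(uniq_leq_size U) : {subset [:: t; u; v; w] <= enum [set z | c z == c v]}.
  by move=> r; rewrite mem_enum !inE => /or4P[] /eqP ->; rewrite ?ct ?cu ?cw.
by rewrite -cardE c3.
Qed.

Let R_inj : injective R.
Proof. by move=> x y /(congr1 (fun u => u.2.2)). Qed.

(* The colour class of a rim vertex is the triangle on one of the two rim edges
   at this vertex. *)
Lemma rim_class x : [/\ c (R (nx x)) = c (R x), c (O (apex x)) = c (R x) & ~~ selected (pv x)] \/
  [/\ c (R (pv x)) = c (R x), c (O (apex (pv x))) = c (R x) & ~~ selected x].
Proof.
have [u [w [uR wR uw cu cw]]] : exists u w,
    [/\ u != R x, w != R x, u != w, c u = c (R x) & c w = c (R x)].
  have := c3 (R x); rewrite (cardsD1 (R x)) inE eqxx => -[] /eqP/cards2P[u [w [uw]]].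
  move=> e; exists u, w.
  have : u \in [set u; w] by rewrite !inE eqxx.
  have : w \in [set u; w] by rewrite !inE eqxx orbT.
  by rewrite -e !inE => /andP[? /eqP ?] /andP[? /eqP ?].
have nbr z : z != R x -> c z = c (R x) ->
    z \in [:: R (nx x); R (pv x); O (apex x); O (apex (pv x))].
  move=> zR cz; have /wheel_adjP := c_clique cz zR.
  case: z {zR cz} => [i [[b|] y]] [->] /= => [/spokeP/orP[]/eqP e|[] e].
  - by rewrite !inE /O -e eqxx !orbT.
  - by rewrite !inE /O -e eqxx !orbT.
  - by rewrite !inE e nxK eqxx !orbT.
  - by rewrite !inE e eqxx.
(* [R x] has four neighbours. Of their six pairs only the two that belong to one rim edge are
   adjacent; [L1] to [L4] exclude the others. *)
have L1 : c (R (nx x)) = c (R x) -> c (R (pv x)) = c (R x) -> False.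
  move=> e1 e2; have /wheel_adjP[_] : wheel_adj (R (nx x)) (R (pv x)).
    apply: c_clique; first by rewrite e1.
    by apply/eqP => /R_inj e; apply: (@nx2 (pv x)); rewrite pvK e.
  by case=> e; [apply: (@nx3 (pv x)); rewrite pvK|apply: (@nx1 x); rewrite [RHS]e pvK].
have L2 : c (R (nx x)) = c (R x) -> c (O (apex (pv x))) = c (R x) -> False.
  move=> e1 e2; have /wheel_adjP[_] : wheel_adj (R (nx x)) (O (apex (pv x))).
    by apply: c_clique; rewrite ?e1.
  move/spokeP; rewrite -surjective_pairing nxK => /orP[] /eqP/apex_edge/(_ erefl) e.
    by apply: (@nx2 (pv x)); rewrite pvK.
  by apply: (@nx1 (pv x)); rewrite pvK.
have L3 : c (R (pv x)) = c (R x) -> c (O (apex x)) = c (R x) -> False.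
  move=> e1 e2; have /wheel_adjP[_] : wheel_adj (R (pv x)) (O (apex x)).
    by apply: c_clique; rewrite ?e1.
  move/spokeP; rewrite -surjective_pairing => /orP[] /eqP/apex_edge/(_ erefl) e.
    by apply: (@nx1 x); rewrite {2}e pvK.
  by apply: (@nx2 (pv (pv x))); rewrite !pvK -e.
have L4 : c (O (apex x)) = c (R x) -> c (O (apex (pv x))) = c (R x) -> False.
  move=> e1 e2; have /wheel_adjP[//] : wheel_adj (O (apex x)) (O (apex (pv x))).
  apply: c_clique; first by rewrite e1.
  apply/eqP => -[] e3 e4; have /apex_edge/(_ erefl) e : apex x = apex (pv x).
    by rewrite [LHS]surjective_pairing e3 e4 -surjective_pairing.
  by apply: (@nx1 x); rewrite {2}e pvK.
have M1 : c (R (nx x)) = c (R x) -> ~~ selected (pv x).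
  by move=> e; apply/negP => /eqP; rewrite pvK => /(L1 e).
have M2 : c (R (pv x)) = c (R x) -> ~~ selected x.
  by move=> e; apply/negP => /eqP e'; apply: L1 e.
have := nbr _ uR cu; have := nbr _ wR cw; rewrite !inE.
by case/or4P=> /eqP ew /or4P[] /eqP eu; move: uw cu cw; rewrite ew eu ?eqxx // => _ cu cw;
  first [by left; split=> //; apply: M1 | by right; split=> //; apply: M2
        | by case: L1 | by case: L2 | by case: L3 | by case: L4].
Qed.

(** The triangle of a rim vertex uses exactly one of the two rim edges at this vertex. *)
Lemma selected_nx x : selected (nx x) = ~~ selected x.
Proof.
have [[e1 _]|[e1 _]] := rim_class (nx x); rewrite ?nxK => ns.
  by rewrite ns /selected e1 eqxx.
by rewrite (negPf ns) /selected -[x in R x]nxK e1 eqxx.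
Qed.

Lemma selected_apex x : selected x -> c (O (apex x)) = c (R x).
Proof. by move=> s; have [[]//|[_ _]] := rim_class x; rewrite s. Qed.

(** A single copy of the gadget determines the cover: selection alternates along the rim, so the
    first rim edge of a wheel decides for all the even ones, which carry the elements. *)
Lemma triangles_exact_cover : exists f, exact_cover f.
Proof.
have Q0 : 0 < Q by lia.
pose f v := selected (v, Ordinal Q0).
have fE v k (kQ : k < Q) : selected (v, Ordinal kQ) = f v (+) odd k.
  elim: k kQ => [|k IH] kQ; first by rewrite addbF; congr (selected (_, _)); apply: val_inj.
  rewrite /= addbN -(IH (ltnW kQ)) -selected_nx; congr (selected (_, _)).
  by apply: val_inj; rewrite /= modn_small.
have fsel x d : att x = Some d -> selected x = f x.1.
  move=> /att_even; case: x => v [k kQ] /= ev.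
  by rewrite fE (negPf ev) addbF.
have apexE x d : att x = Some d -> apex x = (true, d) by rewrite /apex => ->.
exists f => d rd.
have cls x : att x = Some d -> f x.1 -> c (O (true, d)) = c (R x).
  by move=> ax; rewrite -(fsel _ _ ax) => /selected_apex; rewrite (apexE _ _ ax).
(* A real element is not joined to its other copies, so its triangle contains a rim vertex and thus
   stands on a rim edge. *)
have [e ae se] : exists2 e, att e = Some d & selected e.
  have [u ud cu] : exists2 u, u != O (true, d) & c u = c (O (true, d)).
    have := c3 (O (true, d)); rewrite (cardsD1 (O (true, d))) inE eqxx => -[] h.
    have /card_gt0P[u] : 0 < #|[set u | c u == c (O (true, d))] :\ O (true, d)| by rewrite -[#|_|]add0n h.
    by rewrite !inE => /andP[? /eqP ?]; exists u.
  have := wheel_adjP (c_clique cu ud).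
  case: u ud cu => [i [[b|] y]] ud cu /=.
    by case=> ? e; rewrite /tied e /= rd.
  case=> ? [e oe ye]; subst i; rewrite -/(R y) in cu ud.
  have ae : att e = Some d by move: oe; rewrite /apex; case: (att e) => // x [->].
  exists e => //.
  (* The class is made up of [R y], [R z] and the element, so any apex in it is the element, and its
     edge in this wheel is [e]. *)
  have third z : z = nx y \/ z = pv y -> c (R z) = c (R y) ->
      forall g, c (O (apex g)) = c (R y) -> g.1 = e.1 -> e = g.
    move=> zy cz g cg ge; apply: apex_edge => //; rewrite -oe.
    have /or3P[/eqP//|/eqP//|/eqP] : [|| O (true, d) == R z, O (true, d) == R y | O (true, d) == O (apex g)].
      apply: class_third => //; rewrite ?cu //; apply/eqP => // /R_inj zy'.
      by case: zy => zy; [apply: (@nx1 y); rewrite -zy zy'|apply: (@nx1 z); rewrite [in RHS]zy pvK].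
    by case: (apex g) => b p /(congr1 snd) /= [<- <-].
  have [[e1 e2 ns]|[e1 e2 ns]] := rim_class y; case: ye => ye; subst y.
  - by rewrite /selected e1.
  - by have /nx1 := third _ (or_introl erefl) e1 _ e2 erefl.
  - have h := third _ (or_intror erefl) e1 _ e2 erefl.
    by case: (@nx1 (pv e)); rewrite pvK -h.
  - by move: e1; rewrite nxK /selected => ->.
exists e => [|y ay fy]; first by split=> //; rewrite -(fsel _ _ ae).
(* A second edge covering the element would have to start at the other end [nx e] of [e], whose
   position is odd. *)
have /or3P[/eqP/R_inj ye|/eqP/R_inj //|/eqP//] : [|| R y == R (nx e), R y == R e | R y == O (true, d)].
  apply: class_third => //.
  - by move/eqP: se.
  - by apply: cls => //; rewrite -(fsel _ _ ae).
  - by apply/eqP => /R_inj /esym /nx1.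
  - by rewrite -(cls _ ay fy); apply: cls => //; rewrite -(fsel _ _ ae).
by have := att_even ay; rewrite ye odd_nx (att_even ae).
Qed.

End FromTriangles.

(** * From exact covers to partitions into triangles *)

Section ToTriangles.
Variable f : V -> bool.
Hypothesis fP : exact_cover f.

(** Wheels in the cover take their even rim edges, which carry the elements; the others take their
    odd rim edges, whose apexes are all private. *)
Let sel (x : X) := f x.1 (+) odd x.2.

Let sel_nx x : sel (nx x) = ~~ sel x.
Proof. by rewrite /sel odd_nx addbN. Qed.

Let sel_pv x : sel (pv x) = ~~ sel x.
Proof. by rewrite -[in RHS](pvK x) sel_nx negbK. Qed.

(** Only an element can be the apex of two edges, and if both were selected it would be covered
    twice. *)
Let sel_inj x y : sel x -> sel y -> apex x = apex y -> x = y.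
Proof.
move=> sx sy; rewrite /apex; case ax: (att x) => [d|]; case ay: (att y) => [d'|] // [e] //.
subst d'; have [z [_ _] zP] := fP (att_real ax).
have selE w : att w = Some d -> sel w -> f w.1.
  by move=> /att_even/negPf; rewrite /sel => ->; rewrite addbF.
by rewrite (zP x ax (selE _ ax sx)) (zP y ay (selE _ ay sy)).
Qed.

Let edge_of (o : bool * X) := [pick e | sel e && (apex e == o)].

Let edge_of_apex x : sel x -> edge_of (apex x) = Some x.
Proof.
move=> sx; rewrite /edge_of; case: pickP => [y /andP[sy /eqP e]|/(_ x)].
  by rewrite (sel_inj sy sx e).
by rewrite sx eqxx.
Qed.

Let edge_ofP o e : edge_of o = Some e -> sel e /\ apex e = o.
Proof. by rewrite /edge_of; case: pickP => // y /andP[sy /eqP ay] [<-]. Qed.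

Let edge_of_tied o : edge_of o = None -> tied o.
Proof.
case: o => [[] d] //; rewrite /edge_of; case: pickP => // no _; rewrite /tied /=.
apply/negP => /fP[x [ax fx] _]; have := no x.
by rewrite /sel fx (negPf (att_even ax)) /apex ax eqxx.
Qed.

(** A name for the triangle of each vertex: a selected rim edge in one of the copies, or else an
    apex on no selected edge. The latter is tied, since every real element is covered, and its
    triangle joins the three copies. *)
Definition triangle_of (u : wheel_vertex) : 'I_3 * X + bool * X :=
  match u.2 with
  | (None, x) => inl (u.1, if sel x then x else pv x)
  | (Some b, x) => if edge_of (b, x) is Some e then inl (u.1, e) else inr (b, x)
  end.

Let rim_edge x := if sel x then x else pv x.

Let rim_edgeP x e : rim_edge x = e -> sel e /\ (x = e \/ x = nx e).
Proof.
rewrite /rim_edge; case sx: (sel x) => <-; first by split=> //; left.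
by rewrite sel_pv sx pvK; split=> //; right.
Qed.

Lemma triangle_of_adj u v : triangle_of u = triangle_of v -> u != v -> wheel_adj u v.
Proof.
have RO i j x (b : bool) y : triangle_of (i, (None, x)) = triangle_of (j, (Some b, y)) ->
    wheel_adj (i, (None, x)) (j, (Some b, y)).
  rewrite /triangle_of /=; case e: (edge_of _) => [z|] // [<- /rim_edgeP[_ xz]].
  have [_ az] := edge_ofP e; rewrite eqxx -az; apply/spokeP.
  by exists z.
case: u v => [i [[b|] x]] [j [[b'|] y]]; last 3 first.
- by move=> e _; rewrite wheel_adj_sym; apply: RO.
- by move=> e _; apply: RO.
- rewrite /triangle_of /= -/(rim_edge x) -/(rim_edge y) => -[<-] exy ne; rewrite eqxx /=.
  have [_ xe] := rim_edgeP exy; have [_ ye] := rim_edgeP (erefl (rim_edge y)).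
  move: (rim_edge y) xe ye {exy} => t xe ye.
  by case: xe ye ne => -> [] ->; rewrite ?eqxx ?orbT.
rewrite /triangle_of /=; case e1: (edge_of (b, x)) => [p|]; case e2: (edge_of (b', y)) => [q|] //.
  move=> [<- epq] /eqP[]; have [_ ap] := edge_ofP e1; have [_ aq] := edge_ofP e2.
  by move: ap aq; rewrite epq => -> [-> ->].
move=> [eb ex] ne; rewrite eb ex eqxx (edge_of_tied e2) !andbT.
by apply: contra ne => /eqP->; rewrite eb ex.
Qed.

Lemma two_other (i : 'I_3) : exists j k : 'I_3, [/\ j != i, k != i & j != k].
Proof.
exists (ordS i), (ordS (ordS i)); case: i => [[|[|[|i]]] h] //.
Qed.

Lemma triangle_of_two u : exists v w, [/\ v != u, w != u, v != w,
  triangle_of v = triangle_of u & triangle_of w = triangle_of u].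
Proof.
pose RR i x : wheel_vertex := (i, (None, x)).
pose OO i (o : bool * X) : wheel_vertex := (i, (Some o.1, o.2)).
have tR i x : sel x -> triangle_of (RR i x) = inl (i, x) by rewrite /triangle_of /= => ->.
have tR' i x : sel x -> triangle_of (RR i (nx x)) = inl (i, x).
  by move=> sx; rewrite /triangle_of /= sel_nx sx nxK.
have tO i x : sel x -> triangle_of (OO i (apex x)) = inl (i, x).
  by move=> sx; rewrite /triangle_of /= -surjective_pairing edge_of_apex.
have RRn i x : RR i x != RR i (nx x).
  by apply/eqP => /(congr1 (fun u => u.2.2)) /= /nx1.
have ROn i j x o : RR i x != OO j o by apply/eqP => /(congr1 (fun u => u.2.1)).
have ORn i j x o : OO j o != RR i x by rewrite eq_sym.
case: u => [i [[b|] x]].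
  case e: (edge_of (b, x)) => [z|].
    have [sz az] := edge_ofP e; exists (RR i z), (RR i (nx z)).
    have -> : (i, (Some b, x)) = OO i (apex z) by rewrite az.
    by split; [exact: ROn|exact: ROn|exact: RRn|rewrite tR ?tO|rewrite tR' ?tO].
  have [j [k [ji ki jk]]] := two_other i.
  exists (j, (Some b, x)), (k, (Some b, x)); rewrite /triangle_of /= e; split=> //.
  - by apply: contra ji => /eqP[->].
  - by apply: contra ki => /eqP[->].
  - by apply: contra jk => /eqP[->].
rewrite -/(RR i x); have [s xe] := rim_edgeP (erefl (rim_edge x)).
move: (rim_edge x) s xe => z s [] ->.
  by exists (RR i (nx z)), (OO i (apex z)); split;
    [rewrite eq_sym RRn|exact: ORn|exact: ROn|rewrite tR' ?tR|rewrite tO ?tR].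
by exists (RR i z), (OO i (apex z)); split;
  [exact: RRn|exact: ORn|exact: ROn|rewrite tR' ?tR|rewrite tO ?tR'].
Qed.

End ToTriangles.

Theorem wheel_colouring m : #|{: wheel_vertex}| = 3 * m ->
  (exists f, exact_cover f) <->
  exists2 c, colouring (G := coG wheel_adj_sym) c & \sum_u c u <= triangle_sum m.
Proof.
move=> card_m; split=> [[f fP]|[c col le]].
  exact: (triangles_colouring wheel_adj_sym wheel_no_4cycle card_m (triangle_of_adj fP)
    (triangle_of_two fP)).
apply: (@triangles_exact_cover c) => [u v cuv uv|].
  by apply/negPn/negP => nh; case: col => _ /(_ u v); apply=> //; rewrite /= /co_adj uv.
exact: (colouring_triangles wheel_no_4cycle card_m col le).
Qed.

Lemma wheel_free : induced_free [:: cycleG 5; copiesG 4 (pathG 1);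
  unionG (copiesG 2 (pathG 1)) (pathG 2); copiesG 2 (pathG 2)] (coG wheel_adj_sym).
Proof. exact: co_free wheel_no_4cycle wheel_no_5cycle. Qed.

End Wheels.

(** * Tilings as exact covers *)

(* Tilings of a grid with cells [U]; [R false] and [R true] relate a cell to its
   right and upper neighbours. *)
Section Tilings.
Variables (U Tile Col Flag : finType) (flag : U -> Flag) (R : bool -> rel U).
Variables (out inn : bool -> Flag -> Tile -> Col) (ok : Flag -> Tile -> bool).
Variables (tile0 : Tile) (col0 : Col).

Definition tiling (tau : U -> Tile) :=
  (forall u, ok (flag u) (tau u)) /\
  (forall b u w, R b u w -> out b (flag u) (tau u) = inn b (flag w) (tau w)).

(* The set of the tile [t] in the cell [u] covers the cell, the colours [out b]
   of its exits, and all the colours but [inn b] of its entrances. *)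
Definition slot := option (bool * bool * Col).
Definition wheel_size := #|{: slot}|.*2.

(** Slots go to the even rim edges and odd ones stay private, as the wheels require. In a triple,
    the middle boolean is [false] for an exit and [true] for an entrance. *)
Definition slot_of (i : nat) : option slot :=
  if odd i then None else Some (nth (None : slot) (enum {: slot}) i./2).

Lemma slot_index_subproof (s : slot) : (enum_rank s).*2 < wheel_size.
Proof. by rewrite ltn_double. Qed.
Definition slot_index s : 'I_wheel_size := Ordinal (slot_index_subproof s).

Lemma slot_indexK s : slot_of (slot_index s) = Some s.
Proof. by rewrite /slot_of /= odd_double doubleK nth_enum_rank. Qed.

Lemma slot_of_index (i : 'I_wheel_size) s : slot_of i = Some s -> i = slot_index s.
Proof.
rewrite /slot_of; case: ifP => // oi [e]; apply: val_inj => /=.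
have h : i./2 < #|{: slot}|.
  by rewrite -ltn_double (leq_ltn_trans _ (ltn_ord i)) // -[X in _ <= X]odd_double_half leq_addl.
have -> : s = enum_val (Ordinal h) by rewrite (enum_val_nth (None : slot)) e.
by rewrite enum_valK /= -[LHS]odd_double_half oi.
Qed.

Local Notation X := (U * Tile * 'I_wheel_size)%type.

Definition has_succ b u := [exists w, R b u w].
Definition has_pred b u := [exists w, R b w u].

(** The elements of a grid edge are named after its source and the exit slot, so an entrance refers
    to the preceding cell. The geometry enters only through [same], [succ] and [prec], which lets
    the same function serve for numeric coordinates. *)
Definition covers_slot (f : Flag) (t : Tile) (same : bool) (succ prec : bool -> bool)
    (s s' : slot) : bool :=
  match s, s' with
  | None, None => same
  | Some (b, false, g), Some (b', false, g') =>
      [&& b == b', g == g', same, succ b & out b f t == g]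
  | Some (b, true, g), Some (b', false, g') =>
      [&& b == b', g == g', prec b & inn b f t != g]
  | _, _ => false
  end.

Definition covers (x y : X) : bool :=
  let: (u, t, i) := x in let: (w, t', j) := y in
  [&& ok (flag u) t, t' == tile0 &
    if (slot_of i, slot_of j) is (Some s, Some s')
    then covers_slot (flag u) t (w == u) (has_succ^~ u) (fun b => R b w u) s s' else false].

(** An explicit condition for a private apex, without a search for an attached element, in the form
    in which the reduction can compute it. *)
Definition covers_none (x : X) : bool :=
  let: (u, t, i) := x in
  ~~ ok (flag u) t ||
  match slot_of i with
  | None => true
  | Some None => false
  | Some (Some (b, false, g)) => ~~ (has_succ b u && (out b (flag u) t == g))
  | Some (Some (b, true, g)) => ~~ (has_pred b u && (inn b (flag u) t != g))
  end.

Definition tile_att (x : X) : option X := [pick y | covers x y].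

Definition tile_real (c : X) : bool :=
  let: (u, t, i) := c in
  (t == tile0) && match slot_of i with
                  | Some None => true
                  | Some (Some (b, false, _)) => has_succ b u
                  | _ => false
                  end.

Hypothesis Rsucc : forall b u w w', R b u w -> R b u w' -> w = w'.
Hypothesis Rpred : forall b u u' w, R b u w -> R b u' w -> u = u'.
Hypothesis Rirr : forall b u, ~~ R b u u.

Lemma covers_fun x y y' : covers x y -> covers x y' -> y = y'.
Proof.
case: x y y' => [[u t] i] [[w t1] j] [[w' t2] k] /=.
case/and3P=> _ /eqP-> h /and3P[_ /eqP-> h'].
case: (slot_of i) h h' => // s.
case ej: (slot_of j) => [s1|] //; case ek: (slot_of k) => [s2|] //.
rewrite (slot_of_index ej) (slot_of_index ek).
case: s => [[[b []] g]|]; case: s1 {ej} => [[[b1 []] g1]|] //=;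
  case: s2 {ek} => [[[b2 []] g2]|] //=.
- case/and4P=> /eqP-> /eqP-> r _ /and4P[/eqP<- /eqP<- r' _].
  by rewrite (Rpred r r').
- by case/and5P=> /eqP-> /eqP-> /eqP-> _ _ /and5P[/eqP<- /eqP<- /eqP-> _ _].
- by move=> /eqP-> /eqP->.
Qed.

Lemma tile_attE x y : (tile_att x == Some y) = covers x y.
Proof.
rewrite /tile_att; case: pickP => [z cz|no]; last by rewrite no; apply/eqP.
apply/eqP/idP => [[<-] //|cy]; congr Some; exact: covers_fun cz cy.
Qed.

Lemma tile_att_none x : (tile_att x == None) = covers_none x.
Proof.
have -> : (tile_att x == None) = ~~ [exists y, covers x y].
  rewrite /tile_att; case: pickP => [z cz|no]; last first.
    by apply/esym/negP => /existsP[y]; rewrite no.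
  by apply/esym/negbTE; rewrite negbK; apply/existsP; exists z.
case: x => [[u t] i] /=; apply/negP/idP => [no|].
  apply/negPn; apply/negP; rewrite negb_or negbK => /andP[okt h]; apply: no; move: h.
  case ei: (slot_of i) => [[[[b []] g]|]|] //.
  - rewrite negbK => /andP[/existsP[w r] ng]; apply/existsP.
    exists (w, tile0, slot_index (Some (b, false, g))).
    by rewrite slot_indexK /= okt !eqxx r ng.
  - rewrite negbK => /andP[hs ng]; apply/existsP.
    exists (u, tile0, slot_index (Some (b, false, g))).
    by rewrite slot_indexK /= okt !eqxx hs ng.
  - move=> _; apply/existsP; exists (u, tile0, slot_index None).
    by rewrite slot_indexK /= okt !eqxx.
move=> no /existsP[[[w t'] j]] /and3P[okt _]; move: no; rewrite okt /=.
case: (slot_of i) => [[[[b []] g]|]|] //; case: (slot_of j) => [[[[b' []] g']|]|] //.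
- move=> no /and4P[_ _ r ng]; case/negP: no; rewrite ng andbT; apply/existsP; by exists w.
- by move=> /negP no /and5P[_ _ _ hs ng]; case: no; rewrite hs ng.
Qed.

Lemma tile_att_even x c : tile_att x = Some c -> ~~ odd x.2.
Proof.
move/eqP; rewrite tile_attE; case: x c => [[u t] i] [[w t'] j] /= /and3P[_ _].
by rewrite /slot_of; case: (odd i).
Qed.

Lemma tile_att_inj x y c : tile_att x = Some c -> tile_att y = Some c -> x.1 = y.1 -> x = y.
Proof.
move=> /eqP + /eqP; rewrite !tile_attE.
case: x y c => [[u t] i] [[u' t'] k] [[w t''] j] /= + + [eu et].
case/and3P=> _ _ h /and3P[_ _ h']; subst u' t'.
case ei: (slot_of i) h => [s1|] //; case ek: (slot_of k) h' => [s2|] //.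
rewrite (slot_of_index ei) (slot_of_index ek).
case: (slot_of j) => // s.
case: s1 {ei} => [[[b1 []] g1]|]; case: s2 {ek} => [[[b2 []] g2]|] //;
  case: s => [[[b []] g]|] //=.
- by case/and4P=> /eqP-> /eqP-> _ _ /and4P[/eqP-> /eqP-> _ _].
- case/and5P=> _ _ /eqP e _ _ /and4P[_ _ r _].
  by move: r; rewrite e (negPf (Rirr b1 u)).
- case/and4P=> _ _ r _ /and5P[_ _ /eqP e _ _].
  by move: r; rewrite e (negPf (Rirr b2 u)).
- by case/and5P=> /eqP-> /eqP-> _ _ _ /and5P[/eqP-> /eqP-> _ _ _].
Qed.

Lemma tile_att_real x c : tile_att x = Some c -> tile_real c.
Proof.
move/eqP; rewrite tile_attE; case: x c => [[u t] i] [[w t'] j] /= /and3P[_ -> /=].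
case: (slot_of i) => // s; case: (slot_of j) => // s'.
case: s => [[[b []] g]|]; case: s' => [[[b' []] g']|] //=.
- by case/and4P=> /eqP<- _ r _; apply/existsP; exists u.
- by case/and5P=> /eqP<- _ /eqP-> -> _.
Qed.

(** The elements of the cells make the cover choose one tile for each cell. On a grid edge the exit
    covers one colour and the entrance all but one, which is exact iff these two colours agree. *)
Lemma tiling_exact_cover :
  (exists tau, tiling tau) <-> exists f, exact_cover tile_att tile_real f.
Proof.
split=> [[tau [okT match_]]|[f fP]].
  exists (fun v => v.2 == tau v.1) => -[[u t] i] /= /andP[/eqP-> {t}].
  case ei: (slot_of i) => [s|] //; rewrite (slot_of_index ei) => {i ei} hs.
  case: s hs => [[[b []] g] // /existsP[w r]|_]; last first.
    exists (u, tau u, slot_index None) => /=.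
      by split=> //; apply/eqP; rewrite tile_attE /= okT !slot_indexK /= !eqxx.
    move=> [[u' t] j] /eqP; rewrite tile_attE /= slot_indexK => /and3P[_ _].
    case ej: (slot_of j) => [[[[? []] ?]|]|] // /eqP <- /eqP ->.
    by rewrite (slot_of_index ej).
  have hs : has_succ b u by apply/existsP; exists w.
  have mt := match_ _ _ _ r.
  (* The colour [g] of the edge is covered by the exit of [u] if it is the one sent, and otherwise
     by the entrance of [w]. *)
  pose x : X := if out b (flag u) (tau u) == g then (u, tau u, slot_index (Some (b, false, g)))
                else (w, tau w, slot_index (Some (b, true, g))).
  exists x.
    rewrite /x; case: ifP => o; split; rewrite /= ?eqxx //; apply/eqP.
      by rewrite tile_attE /= okT !slot_indexK /= !eqxx hs o.
    by rewrite tile_attE /= okT !slot_indexK /= !eqxx r -mt o.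
  move=> [[u' t] j] /eqP; rewrite tile_attE /= slot_indexK => /and3P[_ _].
  rewrite /x; case ej: (slot_of j) => [[[[b' []] g']|]|] //.
    case/and4P=> /eqP eb /eqP eg r' ng /eqP et; subst b' g' t.
    have e := Rsucc r r'; subst u'; rewrite mt (negPf ng).
    by rewrite (slot_of_index ej).
  case/and5P=> /eqP eb /eqP eg /eqP eu _ ng /eqP et; subst b' g' t u'.
  by rewrite ng (slot_of_index ej).
have cell u : {t | f (u, t) && ok (flag u) t}.
  apply: sigW; have [|x [ax fx] _] := fP (u, tile0, slot_index None).
    by rewrite /= eqxx slot_indexK.
  move: ax fx => /eqP; rewrite tile_attE; case: x => [[u' t] i] /=.
  case/and3P=> okt _; rewrite slot_indexK.
  by case: (slot_of i) => [[[[? []] ?]|]|] // /eqP e ft; subst u'; exists t; rewrite ft okt.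
exists (fun u => sval (cell u)); split=> [u|b u w r]; first by case: (cell u) => t /= /andP[].
case: (cell u) => t /= /andP[ft okt]; case: (cell w) => t' /= /andP[ft' okt'].
pose g := out b (flag u) t; have hs : has_succ b u by apply/existsP; exists w.
have [|x _ xP] := fP (u, tile0, slot_index (Some (b, false, g))).
  by rewrite /= eqxx slot_indexK.
have e1 := xP (u, t, slot_index (Some (b, false, g))) _ ft.
(* If [w] expected another colour, its entrance would cover [g] a second time. *)
apply/eqP/negPn/negP => ne.
have e2 := xP (w, t', slot_index (Some (b, true, g))) _ ft'.
have : (u, t, slot_index (Some (b, false, g))) = (w, t', slot_index (Some (b, true, g))) :> X.
  rewrite e1; last by apply/eqP; rewrite tile_attE /= okt !slot_indexK /= !eqxx hs.
  by rewrite e2 //; apply/eqP; rewrite tile_attE /= okt' !slot_indexK /= !eqxx r eq_sym.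
by move=> /(congr1 (fun x : X => slot_of x.2)); rewrite /= !slot_indexK.
Qed.

Lemma wheel_size_ge6 : 6 <= wheel_size.
Proof.
rewrite /wheel_size -[6]/(3.*2) leq_double; apply/card_gt2P.
exists None, (Some (false, false, col0)), (Some (true, false, col0)).
by split=> //; split.
Qed.

Lemma wheel_size_even : ~~ odd wheel_size.
Proof. by rewrite odd_double. Qed.

End Tilings.

(** * Runs of machines as tilings *)

Lemma subz_neg (a b : nat) : a < b -> (a%:Z - b%:Z)%R = Negz (b - a).-1.
Proof. by rewrite NegzE; lia. Qed.

Lemma subz_nneg (a b : nat) : b <= a -> (a%:Z - b%:Z)%R = (a - b)%N.
Proof. lia. Qed.

Section Tableau.
Variable M : tm.
Local Notation column := {ffun 'I_(extra_tapes M).+1 -> option (bool + aux M)}.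

Definition column_of (c : config M) (z : int) : column := [ffun k => tape_at (ctapes c k) z].

Definition action (q : state M) (a : column) :=
  if halting_state q then (q, [ffun k => (a k, Stay)]) else trans q a.

Definition written (d : state M * column) : column := [ffun k => ((action d.1 d.2).2 k).1].

Definition scan (c : config M) := (cstate c, column_of c 0%R).

(* The tapes after writing and before moving the heads. *)
Definition displayed (c : config M) (z : int) : column :=
  if z == 0%R then written (scan c) else column_of c z.

Lemma scanned_column (c : config M) : [ffun k => scanned (ctapes c k)] = column_of c 0%R.
Proof. by apply/ffunP => k; rewrite !ffunE. Qed.

Lemma step_state (c : config M) : cstate (step c) = (action (cstate c) (column_of c 0%R)).1.
Proof.
rewrite /step /action; case: ifP => // _; rewrite scanned_column.
by case: (trans _ _).
Qed.

(** Each tape moves on its own, so a new column mixes symbols from three neighbouring displayed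
    columns; this is why a tile carries three of them. *)
Lemma step_column (c : config M) z : column_of (step c) z =
  [ffun k => displayed c (z + offset ((action (cstate c) (column_of c 0%R)).2 k).2)%R k].
Proof.
apply/ffunP => k; rewrite !ffunE /displayed /written /scan /=.
rewrite /step /action; case: ifP => hq /=.
  rewrite ffunE /= addr0; case: eqP => [->|_]; rewrite ffunE //.
  by rewrite ?ffunE.
rewrite scanned_column; case e: (trans _ _) => [q acts] /=.
rewrite ffunE tape_at_shift_write; by case: eqP => _; rewrite ffunE //= e.
Qed.

(* A tile shows the state and the scanned symbols, and the displayed columns to
   the left of, at, and to the right of its position relative to the heads. *)
Definition tile := ((state M * column) * (column * column * column))%type.
Definition colour := ((state M * column * column * column) + (state M * column))%type.
Implicit Type t : tile.

Definition next_column t : column := [ffun k =>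
  match ((action t.1.1 t.1.2).2 k).2 with
  | MoveLeft => t.2.1.1 k | Stay => t.2.1.2 k | MoveRight => t.2.2 k end].

(* Whether the cell is in the first row, the last row, the middle column or an
   input position of the certificate, and the input letter. *)
Definition flags := (bool * bool * bool * bool * option bool)%type.
Definition is_first (f : flags) := f.1.1.1.1.
Definition is_last (f : flags) := f.1.1.1.2.
Definition is_centre (f : flags) := f.1.1.2.
Definition is_cert (f : flags) := f.1.2.
Definition input_letter (f : flags) := f.2.

(** In the middle, the displayed column shows the symbols just written; those present before are the
    scanned ones. *)
Definition current_column (f : flags) t : column := if is_centre f then t.1.2 else t.2.1.2.

(** Horizontal colours spread the state and the scanned symbols along the row and make overlapping
    columns agree; vertical ones pass on the next state and column. *)
Definition tile_out (b : bool) (f : flags) t : colour :=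
  if b then inr ((action t.1.1 t.1.2).1, next_column t) else inl (t.1, t.2.1.2, t.2.2).

Definition tile_in (b : bool) (f : flags) t : colour :=
  if b then inr (t.1.1, current_column f t) else inl (t.1, t.2.1.1, t.2.1.2).

Definition letter_or_blank (a : option (bool + aux M)) :=
  if a is Some (inr _) then false else true.

(** The tiling guesses the certificate: its window may hold any letters followed by blanks, a blank
    forcing the next symbol, visible in the right-hand column of the tile, to be blank too. *)
Definition initial_tile (f : flags) t := (t.1.1 == start M) &&
  [forall k : 'I_(extra_tapes M).+1, let a := current_column f t k in
     if val k == 0 then a == omap inl (input_letter f)
     else if (val k == 1) && is_cert f
          then letter_or_blank a && ((a == None) ==> (t.2.2 k == None))
          else a == None].

Definition tile_ok (f : flags) t :=
  [&& is_centre f ==> (t.2.1.2 == written t.1), is_first f ==> initial_tile f t &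
      (is_last f && is_centre f) ==> (halting_state t.1.1 && accepting_state t.1.1)].

Section Grid.
Variables (x : seq bool) (T m : nat).
Hypothesis mT : m <= T.
Local Notation cell := ('I_T.+1 * 'I_(T.*2).+1)%type.

Definition cell_flags (u : cell) : flags :=
  (val u.1 == 0, val u.1 == T, val u.2 == T, T <= u.2 < T + m,
   if (T <= u.2) && (u.2 - T < size x) then Some (nth false x (u.2 - T)) else None).

Definition cell_adj (b : bool) : rel cell := fun u w =>
  if b then (val w.1 == (val u.1).+1) && (val w.2 == val u.2)
  else (val w.1 == val u.1) && (val w.2 == (val u.2).+1).

Lemma init_column ws z k : column_of (init M ws) z k =
  if z is Posz n then nth None [seq Some (inl b) | b <- nth [::] ws k] n else None.
Proof.
rewrite !ffunE; case: z => [n|n] /=; last by rewrite nth_nil.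
by case: (nth _ ws k) => [|b s]; case: n => //= n; rewrite !nth_nil.
Qed.

Lemma accepting_tiling y : size y <= m -> accepting (run M [:: x; y] T) ->
  exists tau, tiling cell_flags cell_adj tile_out tile_in tile_ok tau.
Proof.
move=> ym acc; pose c n := run M [:: x; y] n.
have cS n : c n.+1 = step (c n) by [].
pose pos (u : cell) : int := ((val u.2)%:Z - T%:Z)%R.
pose tau (u : cell) : tile := (scan (c (val u.1)),
  (displayed (c (val u.1)) (pos u - 1)%R, displayed (c (val u.1)) (pos u),
   displayed (c (val u.1)) (pos u + 1)%R)).
have centre u : is_centre (cell_flags u) = (pos u == 0%R).
  by rewrite /is_centre /pos /= subr_eq0.
have current u : current_column (cell_flags u) (tau u) = column_of (c (val u.1)) (pos u).
  by rewrite /current_column centre /= /displayed; case: eqP => [->|].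
exists tau; split=> [u|b u w]; last first.
  rewrite /cell_adj /tile_out /tile_in; case: b => /andP[/eqP e1 /eqP e2].
    congr inr; rewrite current /= e1 cS step_state; congr pair.
    have -> : pos w = pos u by rewrite /pos e2.
    rewrite step_column; apply/ffunP => k; rewrite !ffunE /=.
    by case: (_.2) => /=; rewrite ?addr0.
  congr inl; rewrite /tau e1.
  have -> : pos w = (pos u + 1)%R by rewrite /pos e2; lia.
  by rewrite addrK.
apply/and3P; split; apply/implyP.
- by rewrite centre => /eqP e; rewrite /tau /= e /displayed eqxx.
- rewrite /is_first /= => /eqP u0; rewrite /initial_tile /=.
  have c0 : c (val u.1) = init M [:: x; y] := congr1 c u0.
  rewrite c0 eqxx /=; apply/forallP => k; rewrite current c0 init_column.
  rewrite /input_letter /is_cert /=.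
  have [neg|pos_u] := ltnP u.2 T.
    have -> /= : pos u = Negz (T - u.2).-1 by apply: subz_neg.
    by case: eqP => // _; rewrite andbF.
  have posE : pos u = (u.2 - T)%N by apply: subz_nneg.
  have -> : displayed (init M [:: x; y]) (pos u + 1)%R =
            column_of (init M [:: x; y]) (Posz (u.2 - T).+1).
    rewrite posE /displayed; move: (u.2 - T)%N => n.
    by have -> : (n%:Z + 1)%R = n.+1 by lia.
  rewrite init_column posE.
  case: k => [[|[|k]] kM] //=.
  + case: ltnP => h; last by rewrite nth_default // size_map.
    by rewrite (nth_map false).
  + case: ltnP => h /=; last by rewrite nth_default // size_map; lia.
    have [l|l] := ltnP (u.2 - T) (size y); first by rewrite (nth_map false).
    by rewrite !nth_default ?size_map //; apply: leqW.
  + by rewrite !nth_nil.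
by rewrite /is_last centre /= => /andP[/eqP -> _].
Qed.

Lemma leading_letters_nth (s : seq (option (bool + aux M))) :
  all letter_or_blank s ->
  (forall j, j.+1 < size s -> nth None s j = None -> nth None s j.+1 = None) ->
  forall j, nth None [seq Some (inl b) | b <- leading_letters s] j = nth None s j.
Proof.
elim: s => [|[[b|a]|] s IH] //= al mono j.
  by case: j => //= j; apply: IH => // i; apply: (mono i.+1).
rewrite nth_nil; elim: j => //= j IHj.
have [l|l] := ltnP j (size s); last by rewrite nth_default.
by rewrite -[LHS](mono j) //= -IHj.
Qed.

Lemma size_leading_letters (s : seq (option (bool + aux M))) : size (leading_letters s) <= size s.
Proof. by elim: s => [|[[b|a]|] s IH]. Qed.

Lemma tiling_accepting tau : tiling cell_flags cell_adj tile_out tile_in tile_ok tau ->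
  exists y, size y <= m /\ accepting (run M [:: x; y] T).
Proof.
move=> [ok_tau adj_tau].
pose cl n p : cell := (inord n, inord p).
pose tc n p := tau (cl n p).
pose cur n p := current_column (cell_flags (cl n p)) (tc n p).
have val1 n p : n <= T -> val (cl n p).1 = n by move=> h; rewrite /= inordK.
have val2 n p : p <= T.*2 -> val (cl n p).2 = p by move=> h; rewrite /= inordK.
have horiz n p : n <= T -> p < T.*2 ->
    [/\ (tc n p).1 = (tc n p.+1).1, (tc n p).2.1.2 = (tc n p.+1).2.1.1 &
        (tc n p).2.2 = (tc n p.+1).2.1.2].
  move=> nT pT; have := adj_tau false (cl n p) (cl n p.+1).
  rewrite /cell_adj !val1 // !val2 //; last exact: ltnW.
  by rewrite !eqxx => /(_ isT) [].
have vert n p : n < T -> p <= T.*2 ->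
    (action (tc n p).1.1 (tc n p).1.2).1 = (tc n.+1 p).1.1 /\ next_column (tc n p) = cur n.+1 p.
  move=> nT pT; have := adj_tau true (cl n p) (cl n.+1 p).
  rewrite /cell_adj !val1 // ?val2 //; last exact: ltnW.
  by rewrite !eqxx => /(_ isT) [].
have row n p q : n <= T -> p <= T.*2 -> q <= T.*2 -> (tc n p).1 = (tc n q).1.
  move=> nT; have r0 : forall p, p <= T.*2 -> (tc n p).1 = (tc n 0).1.
    by elim=> // i IH iT; have [<- _ _] := horiz n i nT iT; apply: IH; apply: ltnW.
  by move=> pT qT; rewrite !r0.
have centre n p : p <= T.*2 -> is_centre (cell_flags (cl n p)) = (p == T).
  by move=> pT; rewrite /is_centre /= val2.
have TT : T <= T.*2 by lia.
have curE n p : p <= T.*2 -> p != T -> cur n p = (tc n p).2.1.2.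
  by move=> pT /negPf pn; rewrite /cur /current_column centre // pn.
have curT n : cur n T = (tc n T).1.2 by rewrite /cur /current_column centre // eqxx.
have init0 p : p <= T.*2 -> initial_tile (cell_flags (cl 0 p)) (tc 0 p).
  move=> pT; have /and3P[_ /implyP h _] := ok_tau (cl 0 p); apply: h.
  by rewrite /is_first /= val1.
have [y [ym yP]] : exists y, size y <= m /\
    forall p, p <= T.*2 -> cur 0 p = column_of (init M [:: x; y]) (p%:Z - T%:Z)%R.
  have cert p : p <= T.*2 -> is_cert (cell_flags (cl 0 p)) = (T <= p < T + m).
    by move=> pT; rewrite /is_cert /= val2.
  have other y p k : size y <= m -> p <= T.*2 ->
      (val k = 1 -> T <= p < T + m ->
        cur 0 p k = nth None [seq Some (inl b) | b <- y] (p - T)) ->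
      cur 0 p k = column_of (init M [:: x; y]) (p%:Z - T%:Z)%R k.
    move=> ym pT yk; rewrite init_column.
    have /andP[_ /forallP/(_ k)] := init0 p pT; rewrite -/(cur 0 p) cert //.
    rewrite /input_letter /= val2 //.
    have [neg|pos] := ltnP p T.
      rewrite subz_neg //.
      by rewrite andbF /=; case: ifP => _ /eqP.
    rewrite subz_nneg //.
    case: k yk => [[|[|k]] kM] /= yk.
    - move/eqP->; case: ltnP => h; last by rewrite nth_default // size_map.
      by rewrite (nth_map false).
    - case: (ltnP p) yk => /= h yk; first by move=> _; apply: yk; rewrite ?pos.
      by move/eqP->; rewrite nth_default // size_map; lia.
    - by move/eqP->; rewrite !nth_nil.
  (* A machine with a single tape never sees the certificate, and the empty one will do. *)
  have [k1|nk1] := ltnP 1 (extra_tapes M).+1; last first.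
    exists [::]; split=> // p pT; apply/ffunP => k; apply: other => // e.
    by have := ltn_ord k; move: e => /= ->; rewrite ltnNge nk1.
  pose a j := cur 0 (T + j) (Ordinal k1).
  have aP j : j < m -> letter_or_blank (a j) /\ (j.+1 < m -> a j = None -> a j.+1 = None).
    move=> jm; have pT : T + j <= T.*2 by lia.
    have /andP[_ /forallP/(_ (Ordinal k1))] := init0 _ pT.
    rewrite -/(cur 0 (T + j)) cert //= leq_addr ltn_add2l jm /= -/(a j).
    case/andP=> -> /implyP an; split=> // j1 /eqP/an/eqP.
    (* The next cell is not in the middle column, so its displayed column is its current one. *)
    have [||_ _ ->] := horiz 0 (T + j); [by []|by lia|].
    by rewrite /a addnS curE //; lia.
  pose s := [seq a j | j <- iota 0 m].
  have sz : size s = m by rewrite size_map size_iota.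
  have sE j : j < m -> nth None s j = a j.
    by move=> jm; rewrite (nth_map 0) ?size_iota // nth_iota.
  exists (leading_letters s); split; first by rewrite -[X in _ <= X]sz; exact: size_leading_letters.
  move=> p pT; apply/ffunP => k; apply: other => //.
    by rewrite -[X in _ <= X]sz; exact: size_leading_letters.
  move=> e /andP[Tp pm]; rewrite leading_letters_nth.
  - by rewrite sE ?/a ?subnKC //; [congr (cur _ _ _); apply: val_inj|lia].
  - apply/(all_nthP None) => i; rewrite sz => im; rewrite sE //.
    by have [] := aP i im.
  - move=> i; rewrite sz => im; rewrite !sE //; last exact: ltnW.
    by have [_ h] := aP i (ltnW im); apply: h.
exists y; split=> //; pose c n := run M [:: x; y] n.
(* Row [n] is faithful to the run only at distance at least [n] from the borders, beyond which
   symbols are unconstrained. In row [T] the middle cell alone remains, and it shows the final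
   state. *)
have main n : n <= T -> forall p, n <= p -> p + n <= T.*2 ->
    (tc n p).1.1 = cstate (c n) /\ cur n p = column_of (c n) (p%:Z - T%:Z)%R.
  elim: n => [|n IH] nT p np pn.
    rewrite addn0 in pn; split; last exact: yP.
    by have /andP[/eqP] := init0 p pn.
  have nT' : n <= T := ltnW nT; have pT : p <= T.*2 by lia.
  have scn q : q <= T.*2 -> (tc n q).1 = scan (c n).
    move=> qT; rewrite (row n q T) //; have [||e1 e2] := IH nT' T; [lia|lia|].
    by rewrite [LHS]surjective_pairing e1 -curT e2 subrr.
  have disp q : n <= q -> q + n <= T.*2 -> (tc n q).2.1.2 = displayed (c n) (q%:Z - T%:Z)%R.
    move=> nq qn; have qT : q <= T.*2 by lia.
    rewrite /displayed subr_eq0; case: eqP => [[qe]|ne]; last first.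
      by rewrite -curE //; [have [] := IH nT' q nq qn|apply/eqP => e; apply: ne; rewrite e].
    have /and3P[/implyP h _ _] := ok_tau (cl n q).
    by rewrite -(scn q qT); apply/eqP/h; rewrite centre // qe.
  have [v1 v2] := vert n p nT pT; rewrite -v1 -v2 scn //; split; first by rewrite /c /= step_state.
  rewrite /c /= step_column; apply/ffunP => k; rewrite !ffunE scn //=.
  case: (_.2) => /=.
  - have [||_ e _] := horiz n p.-1; [lia|lia|].
    rewrite prednK in e; last by lia.
    rewrite -e disp; [|lia|lia]; congr (displayed _ _ _); lia.
  - by rewrite addr0 disp //; lia.
  - have [||_ _ ->] := horiz n p; [lia|lia|].
    rewrite disp; [|lia|lia]; congr (displayed _ _ _); lia.
have [||e _] := main T (leqnn T) T; [lia|lia|].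
have /and3P[_ _ /implyP h] := ok_tau (cl T T).
have /h : is_last (cell_flags (cl T T)) && is_centre (cell_flags (cl T T)).
  by rewrite centre // eqxx /is_last /= val1 ?eqxx.
by rewrite -/(tc T T) e.
Qed.

End Grid.
End Tableau.

(** Substituting 0 for the innermost variable gives a candidate function on the smaller context;
    [pc_fst] or [pcb_fst] then fits when the expression does not depend on this variable. *)
Ltac pc_lower := match goal with
  | |- @pc (ext ?C) ?F =>
      let f := eval cbn [fst snd] in (fun v : ct C => F (v, 0)) in apply: (@pc_fst C f)
  | |- @pcb (ext ?C) ?F =>
      let f := eval cbn [fst snd] in (fun v : ct C => F (v, 0)) in apply: (@pcb_fst C f)
  end.

Ltac pcs := cbv beta; lazymatch goal with
  | |- @pcb _ (fun u => @?a u && @?b u) => apply: (@pcb_and _ a b); pcs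
  | |- @pcb _ (fun u => @?a u || @?b u) => apply: (@pcb_or _ a b); pcs
  | |- @pcb _ (fun u => @?a u ==> @?b u) => apply: (@pcb_imp _ a b); pcs
  | |- @pcb _ (fun u => ~~ @?a u) => apply: (@pcb_neg _ a); pcs
  | |- @pcb _ (fun u => @?a u <= @?b u) => apply: (@pcb_le _ a b); pcs
  | |- @pcb _ (fun u => @?a u == @?b u) =>
      first [apply: (@pcb_eq _ a b) | apply: (@pcb_eqb _ a b)]; pcs
  | |- @pcb _ (fun u => all (fun i => @?p u i) (iota 0 (@?f u))) => apply: (@pcb_all _ p f); pcs
  | |- @pcb _ (fun u => has (fun i => @?p u i) (iota 0 (@?f u))) => apply: (@pcb_has _ p f); pcs
  | |- @pc _ (fun u => nat_of_bool (@?b u)) => change (pcb b); pcs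
  | |- @pc _ (fun u => letter _ (@?f u)) =>
      first [apply: (@pc_letterx _ f) | apply: (@pc_lettery _ f)]; pcs
  | |- @pc _ (fun u => @?a u + @?b u) => apply: (@pc_add _ a b); pcs
  | |- @pc _ (fun u => @?a u - @?b u) => apply: (@pc_sub _ a b); pcs
  | |- @pc _ (fun u => @?a u * @?b u) => apply: (@pc_mul _ a b); pcs
  | |- @pc _ (fun u => @?a u %/ @?b u) => apply: (@pc_div _ a b); pcs
  | |- @pc _ (fun u => @?a u %% @?b u) => apply: (@pc_mod _ a b); pcs
  | |- @pc _ (fun u => @?a u ^ ?n) => apply: (@pc_exp _ a n); pcs
  | |- @pc _ (fun u => (@?a u).+1) => apply: (@pcS _ a); pcs
  | |- _ => first [assumption | exact: pc_snd | exact: pc_const | exact: pcb_const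
                  | exact: pc_sizex | pc_lower; pcs | idtac]
  end.

(** * Membership in NP *)

Definition power_of_2 n := all (fun d => (n %% d == 0) && (d %% 2 == 1) ==> (d == 1)) (iota 0 n.+1).

Lemma power_of_2P n : 0 < n -> reflect (exists e, n = 2 ^ e) (power_of_2 n).
Proof.
move=> n0; apply: (iffP allP) => [h|[e ->] d _].
  have [m m2 nE] := @pfactor_coprime 2 n isT n0; exists (logn 2 n).
  have mn : m %| n by rewrite nE dvdn_mulr.
  have := h m; rewrite mem_iota /= ltnS dvdn_leq // => /(_ isT)/implyP.
  move: m2; rewrite coprime2n modn2 => ->; rewrite andbT => /(_ mn)/eqP m1.
  by rewrite {1}nE m1 mul1n.
apply/implyP => /andP[]; rewrite -/(d %| _) => /(dvdn_pfactor _ _ (isT : prime 2))[m _ ->].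
by rewrite modn2; case: m => // m; rewrite oddX.
Qed.

(** The powers of two up to [m] are the first ones, and [2 ^ i] would be the one after the first
    [i]. This compares with [2 ^ i] without ever forming it. *)
Lemma count_powers_of_2 m i : (\sum_(q < m) power_of_2 q.+1 <= i) = (m < 2 ^ i).
Proof.
have -> : \sum_(q < m) power_of_2 q.+1 = \sum_(e < m) (2 ^ e <= m).
  transitivity (\sum_(q < m) \sum_(e < m) (2 ^ e == q.+1)).
    apply: eq_bigr => q _; case: power_of_2P => // [[e eq_e]|no].
      have em : e < m by apply: leq_trans (ltn_ord q); rewrite eq_e ltn_expl.
      rewrite (bigD1 (Ordinal em)) //= eq_e eqxx big1 // => e' /eqP ne.
      case: eqP => // /eqP; rewrite eqn_exp2l // => /eqP e'e; case: ne; exact: val_inj.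
    by rewrite big1 // => e _; case: eqP => // eq_e; case: no; exists e.
  rewrite exchange_big; apply: eq_bigr => e _; case: leqP => le.
    have qm : (2 ^ e).-1 < m by rewrite prednK // expn_gt0.
    rewrite (bigD1 (Ordinal qm)) //= prednK ?expn_gt0 // eqxx big1 // => q /eqP ne.
    case: eqP => // eq_q; case: ne; apply: val_inj; rewrite /= eq_q //.
  by rewrite big1 // => q _; case: eqP => // eq_q; have := ltn_ord q; rewrite -eq_q leqNgt le.
case: (ltnP m (2 ^ i)) => h.
  apply/idP; apply: (@leq_trans (minn i m)); last exact: geq_minl.
  rewrite -sum_ltn; apply: leq_sum => e _.
  case: (ltnP e i) => ei; first exact: leq_b1.
  by rewrite [2 ^ e <= m]leqNgt (leq_trans h) // leq_exp2l.
have im : i < m by apply: leq_trans h; rewrite ltn_expl.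
apply/negbTE; rewrite -ltnNge; apply: (@leq_trans (minn i.+1 m)); first by rewrite (minn_idPl im).
rewrite -sum_ltn; apply: leq_sum => e _; case: (ltnP e i.+1) => // ei.
by rewrite (leq_trans _ h) // leq_exp2l.
Qed.

(** The power itself need not be polynomially bounded; its minimum with [g u] counts the [m < g u]
    below it. *)
Lemma pc_min_exp2 (C : ctx) (f g : C -> nat) : pc f -> pc g -> pc (fun u => minn (2 ^ f u) (g u)).
Proof.
move=> pf pg.
apply: (pc_ext (f := fun u => \sum_(m < g u) (\sum_(q < m) power_of_2 q.+1 <= f u))).
  by move=> u; rewrite -sum_ltn; apply: eq_bigr => m _; rewrite count_powers_of_2.
apply: (pc_sum (g := fun u m => nat_of_bool (\sum_(q < m) power_of_2 q.+1 <= f u))) => //.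
apply: (pcb_le (f := fun u : ext C => \sum_(q < u.2) power_of_2 q.+1)); last by pcs.
apply: (pc_sum (g := fun u q => nat_of_bool (power_of_2 q.+1))); first by pcs.
by rewrite -/(pcb _) /power_of_2; pcs.
Qed.

(** * Graph codes, colourings and induced subgraphs in terms of letters and numbers *)

Lemma nth_allpairs (S T R : Type) (f : S -> T -> R) x0 y0 z0 (s : seq S) (t : seq T) i j :
  i < size s -> j < size t ->
  nth z0 [seq f x y | x <- s, y <- t] (i * size t + j) = f (nth x0 s i) (nth y0 t j).
Proof.
elim: s i => // x s IH [|i] /= si tj; rewrite nth_cat size_map.
  by rewrite add0n tj (nth_map y0).
by rewrite mulSn -addnA ltnNge leq_addr /= addKn IH.
Qed.

Definition mat (w : seq bool) n i j := letter w (n.+1 + (i * n + j)) == 2.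

Definition header (w : seq bool) n :=
  [&& all (fun i => letter w i == 2) (iota 0 n), letter w n == 1 & n.+1 + n * n <= size w].

Lemma letter2 w i : (letter w i == 2) = nth false w i.
Proof. by rewrite /letter; case: ltnP => [_|h]; [case: nth|rewrite nth_default]. Qed.

Lemma header_inj w n n' : header w n -> header w n' -> n = n'.
Proof.
have lt a b : header w a -> header w b -> a < b -> False.
  move=> /and3P[_ /eqP ha _] /and3P[/allP hb _ _] ab.
  by have := hb a; rewrite mem_iota ha /= => /(_ ab).
by move=> h h'; case: (ltngtP n n') => // c; [case: (lt _ _ h h')|case: (lt _ _ h' h)].
Qed.

Lemma encodesP w (G : graph) k : encodes w G k <->
  [/\ header w #|G|, (forall i j : 'I_#|G|, mat w #|G| i j = adj (enum_val i) (enum_val j)) &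
    k = int_of_bits (drop (#|G|.+1 + #|G| * #|G|) w)].
Proof.
set n := #|G|.
have sz : size (graph_code G) = n.+1 + n * n.
  by rewrite /graph_code size_cat size_nseq /= size_allpairs -cardE addnS.
have code_nth i j : i < n -> j < n -> forall s,
    nth false (graph_code G ++ s) (n.+1 + (i * n + j)) =
    nth false [seq adj u v | u <- enum G, v <- enum G] (i * n + j).
  move=> li lj s; rewrite nth_cat sz ltn_add2l.
  have -> : i * n + j < n * n by nia.
  by rewrite /graph_code nth_cat size_nseq -/n ltnNge addSn leqW ?leq_addr //= -addnS addKn.
have enumE (i : 'I_n) : nth (enum_val i) (enum G) i = enum_val i.
  by rewrite -enum_val_nth.
have matE (i j : 'I_n) :
    nth false [seq adj u v | u <- enum G, v <- enum G] (i * n + j) = adj (enum_val i) (enum_val j).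
  have se : size (enum G) = n by rewrite -cardE.
  have := @nth_allpairs _ _ _ (@adj G) (enum_val i) (enum_val j) false (enum G) (enum G) i j.
  by rewrite se => -> //; rewrite !enumE.
split=> [[s [-> <-]]|[/and3P[/allP h1 /eqP h2 h3] h4 ->]].
  split; last by rewrite drop_size_cat.
    apply/and3P; split; last by rewrite size_cat sz leq_addr.
      apply/allP => i; rewrite mem_iota /= => li.
      by rewrite letter2 nth_cat sz ltn_addr ?ltnS ?(ltnW li) // /graph_code nth_cat size_nseq li nth_nseq li.
    rewrite /letter size_cat sz -addnA addSn ltnS leq_addr nth_cat sz ltn_addr //.
    by rewrite /graph_code nth_cat size_nseq ltnn subnn.
  by move=> i j; rewrite /mat letter2 code_nth // matE.
exists (drop (n.+1 + n * n) w); split=> //.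
rewrite -{1}(cat_take_drop (n.+1 + n * n) w); congr cat.
have sizet : size (take (n.+1 + n * n) w) = n.+1 + n * n by rewrite size_takel.
apply: (@eq_from_nth _ false) => [|i]; first by rewrite sizet sz.
rewrite sizet => li; rewrite nth_take //.
rewrite /graph_code nth_cat size_nseq -/n.
case: (ltngtP i n) => ni.
- by rewrite nth_nseq ni -letter2 h1 // mem_iota.
- have [j ij] : exists j, i = n.+1 + j by exists (i - n.+1); lia.
  subst i; rewrite addSnnS addKn /=.
  have jn : j < n * n by lia.
  have n0 : 0 < n by case: (n) jn.
  have l1 : j %/ n < n by rewrite ltn_divLR.
  have l2 : j %% n < n by rewrite ltn_pmod.
  have := h4 (Ordinal l1) (Ordinal l2); rewrite -matE /= -divn_eq /mat letter2 /=.
  by rewrite -divn_eq addSnnS.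
- by rewrite ni subnn /=; move: h2; rewrite /letter; case: ifP => // _; case: nth.
Qed.

Definition numeric_colouring w n (c : nat -> nat) :=
  (forall i, i < n -> 0 < c i) /\ (forall i j, i < n -> j < n -> mat w n i j -> c i != c j).

Lemma encodes_colouring w (G : graph) k : encodes w G k ->
  has_colouring_of_sum_at_most G k <->
  exists2 c, numeric_colouring w #|G| c & ((\sum_(i < #|G|) c i)%N%:Z <= k)%R.
Proof.
move=> /encodesP[_ matE _]; split=> [[c [[c0 cE] le]]|[c [c0 cE] le]].
  pose c' i := oapp (fun j : 'I_#|G| => c (enum_val j)) 0 (insub i).
  have c'E (i : 'I_#|G|) : c' i = c (enum_val i) by rewrite /c' valK.
  exists c'; last first.
    rewrite (eq_bigr _ (fun i _ => c'E i)).
    move: le; rewrite (reindex (fun i : 'I_#|G| => enum_val i)) //.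
    by apply: onW_bij; apply: enum_val_bij.
  split=> [i li|i j li lj]; first by rewrite (c'E (Ordinal li)).
  rewrite (matE (Ordinal li) (Ordinal lj)) (c'E (Ordinal li)) (c'E (Ordinal lj)).
  by move=> a; apply/eqP/cE.
exists (fun v => c (enum_rank v)); split.
  split=> [v|u v a]; first exact: c0.
  by apply/eqP/cE => //; rewrite matE !enum_rankK.
rewrite (reindex (fun i : 'I_#|G| => enum_val i)) /=; last by apply: onW_bij; apply: enum_val_bij.
by rewrite (eq_bigr (fun i : 'I_#|G| => c i)) // => i _; rewrite enum_valK.
Qed.

(** Maps from a fixed graph on [k] vertices to [n] vertices become numbers below [n ^ k],
    polynomially many, so the search for an induced copy is a bounded quantifier. *)
Lemma digits_exist n (g : nat -> nat) k : (forall i, i < k -> g i < n) ->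
  exists2 code, code < n ^ k & forall i, i < k -> code %/ n ^ i %% n = g i.
Proof.
elim: k => [|k IH] gn; first by exists 0.
have [i ik|code cn cE] := IH; first by apply: gn; apply: ltnW.
have n0 : 0 < n by apply: leq_ltn_trans (gn k (ltnSn k)).
exists (code + g k * n ^ k).
  rewrite expnS; have := gn k (ltnSn k) => gk.
  apply: (@leq_trans ((g k).+1 * n ^ k)); first by rewrite mulSn ltn_add2r.
  by rewrite leq_mul2r gk orbT.
move=> i; rewrite ltnS leq_eqVlt => /orP[/eqP->|ik].
  by rewrite divnDMl ?expn_gt0 ?n0 // divn_small // add0n modn_small // gn.
have -> : n ^ k = n ^ (k - i.+1) * n * n ^ i.
  by rewrite -expnSr -expnD; congr (_ ^ _); lia.
by rewrite mulnA divnDMl ?expn_gt0 ?n0 // mulnA addnC modnMDl cE.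
Qed.

Definition digit n code i := code %/ n ^ i %% n.

Definition induced_by (H : graph) w n code := all (fun p : H * H =>
    let a := digit n code (enum_rank p.1) in let b := digit n code (enum_rank p.2) in
    ((p.1 != p.2) ==> (a != b)) && (mat w n a b == adj p.1 p.2)) (enum {: H * H}).

Definition numeric_has_induced (H : graph) w n :=
  has (induced_by H w n) (iota 0 (n ^ #|H|)).

Lemma has_inducedE w (G : graph) k (H : graph) : encodes w G k -> 0 < #|H| ->
  has_induced H G <-> numeric_has_induced H w #|G|.
Proof.
move=> /encodesP[_ matE _] H0; set n := #|G|.
split=> [[f [fi fa]]|/hasP[code]].
  pose g i := oapp (fun j : 'I_#|H| => val (enum_rank (f (enum_val j)))) 0 (insub i).
  have gE v : g (enum_rank v) = enum_rank (f v) by rewrite /g valK /= enum_rankK.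
  have [|code cn cE] := @digits_exist n g #|H|.
    by move=> i iH; rewrite /g insubT /= ltn_ord.
  apply/hasP; exists code; first by rewrite mem_iota.
  apply/allP => -[u v] _; rewrite /= /digit !cE // !gE matE !enum_rankK fa eqxx andbT.
  apply/implyP; apply: contra => /eqP/val_inj/enum_rank_inj/fi ->.
  exact: eqxx.
rewrite mem_iota /= => cn /allP indP.
have n0 : 0 < n by rewrite lt0n; apply/eqP => e; move: cn; rewrite e exp0n.
pose f (v : H) : G := enum_val (Ordinal (ltn_pmod (code %/ n ^ enum_rank v) n0)).
have fP u v := indP (u, v) (mem_enum _ _).
exists f; split=> [u v|u v].
  move/enum_val_inj => -[] e; apply/eqP/negPn/negP => uv.
  by have /andP[/implyP/(_ uv)] := fP u v; rewrite /digit e eqxx.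
have /andP[_ /eqP <-] := fP u v.
by rewrite /digit -matE.
Qed.

Lemma pcb_mat (C : ctx) (a i j : C -> nat) : pc a -> pc i -> pc j ->
  pcb (fun u => mat (wordx u) (a u) (i u) (j u)).
Proof. by move=> pa pi pj; rewrite /mat; pcs. Qed.

Lemma pcb_numeric_has_induced (C : ctx) (a : C -> nat) (H : graph) : pc a ->
  pcb (fun u => numeric_has_induced H (wordx u) (a u)).
Proof.
move=> pa; apply: (@pcb_has _ (fun u code => induced_by H (wordx u) (a u) code)); first by pcs.
apply: pcb_allseq => -[p q]; rewrite /=.
have pd (v : H) : pc (C := ext C) (fun u => digit (a u.1) u.2 (enum_rank v)) by rewrite /digit; pcs.
apply: pcb_and.
  apply: pcb_imp; first exact: pcb_const.
  by apply: pcb_neg; apply: pcb_eq; apply: pd.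
apply: (@pcb_eqb (ext C)); last exact: pcb_const.
apply: (@pcb_mat (ext C) (fun u => a u.1)); [by pcs|exact: pd|exact: pd].
Qed.

Definition bits_value (s : seq bool) := foldr (fun (b : bool) m => b + m.*2) 0 s.

Lemma bits_valueE s L : size s <= L -> bits_value s = \sum_(i < L) nth false s i * 2 ^ i.
Proof.
elim: s L => [|b s IH] L /=.
  by move=> _; rewrite big1 // => i _; rewrite nth_nil.
case: L => // L sL; rewrite big_ord_recl /= expn0 muln1; congr addn.
rewrite (IH L) // -muln2 big_distrl /=; apply: eq_bigr => i _.
by rewrite /bump /= expnS -mulnA (mulnC 2).
Qed.

(** Either some set bit has weight at least [S], and both sides hold, or capping changes the weight
    of no set bit. *)
Lemma bits_value_min s L S : size s <= L ->
  (S <= bits_value s) = (S <= \sum_(i < L) nth false s i * minn (2 ^ i) S).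
Proof.
move=> sL; rewrite (bits_valueE sL); apply/idP/idP => h; last first.
  by apply: leq_trans h _; apply: leq_sum => i _; rewrite leq_mul2l geq_minl orbT.
have [big|small] := boolP [exists i : 'I_L, nth false s i && (S <= 2 ^ i)].
  have [i /andP[si Si]] := existsP big.
  by rewrite (bigD1 i) //= si mul1n (minn_idPr Si) leq_addr.
apply: leq_trans h _; apply: leq_sum => i _; case si: (nth _ _ _) => //.
rewrite !mul1n leq_min leqnn; apply/ltnW; rewrite ltnNge.
by move: small; rewrite negb_exists => /forallP/(_ i); rewrite si.
Qed.

(* The certificate lists the colours in unary, padded to [L] letters each. *)
Definition cert_colour y L i := 1 + \sum_(j < L) (letter y (i * L + j) == 2).

(* Capping [2 ^ i] keeps all the values polynomially bounded. *)
Definition within_budget (w : seq bool) t S :=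
  if letter w t == 2
  then (S == 0) && all (fun i => letter w (t.+1 + i) != 2) (iota 0 (size w))
  else S <= \sum_(i < size w) (letter w (t.+1 + i) == 2) * minn (2 ^ i) S.

Lemma within_budgetE w t S : within_budget w t S = (S%:Z <= int_of_bits (drop t w))%R.
Proof.
rewrite /within_budget /int_of_bits -/(bits_value _) letter2.
have -> : head false (drop t w) = nth false w t by rewrite -nth0 nth_drop addn0.
have sb : size (behead (drop t w)) <= size w by rewrite size_behead size_drop; lia.
have nb i : nth false (behead (drop t w)) i = nth false w (t.+1 + i).
  by rewrite nth_behead nth_drop addnS addSn.
case: (nth false w t); last first.
  rewrite expr0 mul1r lez_nat (bits_value_min _ sb); congr (_ <= _).
  by apply: eq_bigr => i _; rewrite nb letter2.
(* With a minus sign, a sum of colours fits only if both it and the absolute value vanish. *)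
rewrite expr1 mulN1r; set v := bits_value _.
have -> : all (fun i => letter w (t.+1 + i) != 2) (iota 0 (size w)) = (v == 0).
  rewrite /v (bits_valueE sb) sum_nat_eq0; apply/allP/forallP => h i.
    have := h i; rewrite mem_iota /= ltn_ord => /(_ isT).
    by rewrite letter2 -nb => /negPf ->.
  rewrite mem_iota /= => iw; have := h (Ordinal iw).
  by rewrite nb letter2 /= muln_eq0 expn_eq0 orbF; case: nth.
by case: eqP => [->|]; case: eqP => [->|] //=; lia.
Qed.

Definition verifies (w y : seq bool) n :=
  [&& header w n,
      all (fun i => all (fun j => mat w n i j == mat w n j i) (iota 0 n)) (iota 0 n),
      all (fun i => ~~ mat w n i i) (iota 0 n),
      all (fun i => all (fun j => mat w n i j ==>
          (cert_colour y (n * n) i != cert_colour y (n * n) j)) (iota 0 n)) (iota 0 n) &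
      within_budget w (n.+1 + n * n) (\sum_(i < n) cert_colour y (n * n) i)].

Definition verifier (Hs : seq graph) (w y : seq bool) :=
  has (fun n => verifies w y n && all (fun H => ~~ numeric_has_induced H w n) Hs)
      (iota 0 (size w).+1).

(* When the budget is at least [n * n], the colours [1], ..., [n] will do. *)
Lemma bounded_colouring w n c k : (forall i, i < n -> ~~ mat w n i i) ->
  numeric_colouring w n c -> ((\sum_(i < n) c i)%N%:Z <= k)%R ->
  exists c', [/\ numeric_colouring w n c', ((\sum_(i < n) c' i)%N%:Z <= k)%R &
    forall i, i < n -> c' i <= (n * n).+1].
Proof.
move=> irr nc le; have [big|small] := lerP (n * n)%N%:Z k.
  exists succn; split=> [|| i ni]; last by nia.
    split=> // i j ni nj m; rewrite eqSS; apply: contraTneq m => ->; exact: irr.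
  apply: le_trans big; rewrite lez_nat.
  apply: (@leq_trans (\sum_(i < n) n)); first by apply: leq_sum => i _.
  by rewrite sum_nat_const card_ord.
exists c; split=> // i ni; apply: leqW.
have : c i <= \sum_(j < n) c j by rewrite (bigD1 (Ordinal ni)) //= leq_addr.
by move: le small; move: (\sum_(j < n) c j) => S; lia.
Qed.

(** Colours are positive, so a block of [n * n] letters records [c i - 1]; this fits, as colours may
    be taken at most [n * n + 1]. *)
Definition certificate n (c : nat -> nat) :=
  mkseq (fun t => t %% (n * n) < c (t %/ (n * n)) - 1) (n * (n * n)).

Lemma cert_colourE n c i : i < n -> 0 < c i <= (n * n).+1 ->
  cert_colour (certificate n c) (n * n) i = c i.
Proof.
move=> ni /andP[c0 cn]; rewrite /cert_colour.
have L0 : 0 < n * n by rewrite muln_gt0 (leq_ltn_trans _ ni).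
rewrite (eq_bigr (fun j : 'I_(n * n) => nat_of_bool (j < c i - 1))).
  by rewrite sum_ltn (minn_idPl _) ?subnKC // leq_subLR add1n.
move=> j _; rewrite letter2 /certificate nth_mkseq; last first.
  apply: (@leq_trans (i.+1 * (n * n))); first by rewrite mulSn addnC ltn_add2r.
  by rewrite leq_mul2r ni orbT.
have jn := ltn_ord j.
by rewrite modnMDl modn_small // divnMDl // divn_small // addn0.
Qed.

Lemma numeric_graph w n : header w n ->
  all (fun i => all (fun j => mat w n i j == mat w n j i) (iota 0 n)) (iota 0 n) ->
  all (fun i => ~~ mat w n i i) (iota 0 n) ->
  exists2 G : graph, #|G| = n & encodes w G (int_of_bits (drop (n.+1 + n * n) w)).
Proof.
move=> hw sy ir.
have asym : symmetric (fun i j : 'I_n => mat w n i j).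
  move=> i j; suff /eqP : mat w n i j == mat w n j i by [].
  move/allP: sy => /(_ i); rewrite mem_iota add0n ltn_ord => /(_ isT).
  by move=> /allP/(_ j); rewrite mem_iota add0n ltn_ord => /(_ isT).
have airr : irreflexive (fun i j : 'I_n => mat w n i j).
  move=> i; apply/negbTE; move/allP: ir => /(_ i); rewrite mem_iota add0n ltn_ord.
  exact.
pose G := Graph asym airr; have cG : #|G| = n := card_ord n.
exists G => //; apply/encodesP; rewrite -[int_of_bits _]/((fun m => int_of_bits (drop (m.+1 + m * m) w)) n) -cG.
split=> //; first by rewrite cG.
move=> i j; have e (l : 'I_#|G|) : val (enum_val l : 'I_n) = l.
  have := enum_valK l => /(congr1 val) /= <-.
  by rewrite enum_rank_ord.
have -> : mat w #|G| i j = mat w n i j := congr1 (fun m => mat w m i j) cG.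
by rewrite /= /G /= -(e i) -(e j).
Qed.

Lemma verifierP (Hs : seq graph) w : (forall H : graph, List.In H Hs -> 0 < #|H|) ->
  chromatic_sum (induced_free Hs) w <->
  exists y, size y <= size w ^ 3 /\ verifier Hs w y.
Proof.
move=> Hs0.
have free (G : graph) k : encodes w G k ->
    induced_free Hs G <-> all (fun H => ~~ numeric_has_induced H w #|G|) Hs.
  move=> enc; elim: Hs Hs0 => [|H Hs IH] Hs0; first by split=> // _ H [].
  have [|h1 h2] := IH; first by move=> H' H'in; apply: Hs0; right.
  have hH := has_inducedE enc (Hs0 H (or_introl erefl)).
  split=> [fr|/andP[nH /h2 fr] H' [<-|]]; last 2 first.
  - by move=> /hH; apply/negP.
  - exact: fr.
  apply/andP; split; last by apply: h1 => H' H'in; apply: fr; right.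
  by apply/negP => /hH; apply: fr; left.
split=> [[G [k [enc fr col]]]|[y [_ /hasP[n _ /andP[v fr]]]]].
  have [hw matE kE] := (encodesP w G k).1 enc; set n := #|G| in hw matE kE.
  have [c nc le] := (encodes_colouring enc).1 col.
  have mE i j : i < n -> j < n -> exists u v, mat w n i j = @adj G u v /\
      mat w n j i = @adj G v u /\ (i = j -> u = v).
    move=> ni nj; exists (enum_val (Ordinal ni)), (enum_val (Ordinal nj)).
    split; first exact: (matE (Ordinal ni) (Ordinal nj)).
    split; first exact: (matE (Ordinal nj) (Ordinal ni)).
    by move=> e; congr enum_val; apply: val_inj.
  have irr i : i < n -> ~~ mat w n i i.
    by move=> ni; have [u [v [-> [_ ->]]]] := mE i i ni ni; rewrite // adj_irrefl.
  have [c' [nc' le' bc']] := bounded_colouring irr nc le.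
  have nw : n <= size w by have /and3P[_ _] := hw; lia.
  have ccE i : i < n -> cert_colour (certificate n c') (n * n) i = c' i.
    by move=> ni; apply: cert_colourE => //; rewrite (bc' i ni) (nc'.1 i ni).
  exists (certificate n c'); split.
    rewrite size_mkseq; have -> : n * (n * n) = n ^ 3 by rewrite !expnS expn0 muln1.
    exact: leq_expn.
  apply/hasP; exists n; first by rewrite mem_iota /= ltnS.
  rewrite ((free G k enc).1 fr) andbT /verifies hw /=; apply/and4P; split.
  - apply/allP => i; rewrite mem_iota /= => ni; apply/allP => j; rewrite mem_iota /= => nj.
    by have [u [v [-> [-> _]]]] := mE i j ni nj; rewrite adj_sym.
  - by apply/allP => i; rewrite mem_iota /=; apply: irr.
  - apply/allP => i; rewrite mem_iota /= => ni; apply/allP => j; rewrite mem_iota /= => nj.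
    by apply/implyP => m; rewrite !ccE //; apply: nc'.2 m.
  - rewrite within_budgetE -kE (eq_bigr (fun i : 'I_n => c' i)) // => i _.
    exact: ccE.
have /and5P[hw sy ir pr bd] := v.
have [G cG enc] := numeric_graph hw sy ir.
exists G, (int_of_bits (drop (n.+1 + n * n) w)); split=> //.
  by apply/(free G _ enc); rewrite cG.
apply/(encodes_colouring enc); rewrite cG; exists (cert_colour y (n * n)).
  split=> [i _|i j ni nj m]; first by [].
  have /allP/(_ i) := pr; rewrite mem_iota add0n ni => /(_ isT)/allP/(_ j).
  by rewrite mem_iota add0n nj => /(_ isT)/implyP; apply.
by rewrite -within_budgetE.
Qed.

Lemma pcb_within_budget (C : ctx) (t S : C -> nat) : pc t -> pc S ->
  pcb (fun u => within_budget (wordx u) (t u) (S u)).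
Proof.
move=> pt pS.
pose A u := letter (wordx u) (t u) == 2.
pose B u := (S u == 0) && all (fun i => letter (wordx u) ((t u).+1 + i) != 2) (iota 0 (size (wordx u))).
pose D u := S u <= \sum_(i < size (wordx u)) (letter (wordx u) ((t u).+1 + i) == 2) * minn (2 ^ i) (S u).
have pA : pcb A by rewrite /A; pcs.
have pB : pcb B.
  apply: pcb_and; first by pcs.
  apply: (@pcb_all C (fun u i => letter (wordx u) ((t u).+1 + i) != 2)); first exact: pc_sizex.
  apply: pcb_neg; apply: (@pcb_eq (ext C) _ (fun _ => 2)); last exact: pc_const.
  by apply: (@pc_letterx (ext C) (fun u => (t u.1).+1 + u.2)); pcs.
have pD : pcb D.
  apply: pcb_le => //.
  apply: (@pc_sum C _ (fun u i => (letter (wordx u) ((t u).+1 + i) == 2) * minn (2 ^ i) (S u))).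
    exact: pc_sizex.
  apply: (@pc_mul (ext C)); last by apply: (@pc_min_exp2 (ext C) snd (fun u => S u.1)); pcs.
  apply: (@pcb_eq (ext C) _ (fun _ => 2)); last exact: pc_const.
  by apply: (@pc_letterx (ext C) (fun u => (t u.1).+1 + u.2)); pcs.
apply: (pcb_ext (a := fun u => (A u && B u) || (~~ A u && D u))).
  by move=> u; rewrite /within_budget -/(A u); case: (A u); rewrite ?orbF.
by apply: pcb_or; apply: pcb_and => //; apply: pcb_neg.
Qed.

Lemma pc_verifier (Hs : seq graph) : pcb (C := words_ctx) (fun u => verifier Hs u.1 u.2).
Proof.
rewrite /verifier.
apply: (@pcb_has words_ctx (fun u n => verifies u.1 u.2 n &&
  all (fun H => ~~ numeric_has_induced H u.1 n) Hs)).
  by apply: pcS; exact: (pc_sizex words_ctx).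
set C1 := ext words_ctx.
have pn : pc (C := C1) (fun u => u.2) by exact: pc_snd.
apply: pcb_and; last first.
  by apply: pcb_allseq => H; apply: pcb_neg; apply: (@pcb_numeric_has_induced C1 snd).
have pcc (C : ctx) (n i : C -> nat) : pc n -> pc i ->
    pc (fun u => cert_colour (wordy u) (n u * n u) (i u)).
  move=> p1 p2; apply: (@pc_add _ (fun _ => 1)); first exact: pc_const.
  apply: (@pc_sum _ _ (fun u j => nat_of_bool (letter (wordy u) (i u * (n u * n u) + j) == 2))).
    by pcs.
  apply: (@pcb_eq (ext C) (fun u => letter (wordy u) (i u.1 * (n u.1 * n u.1) + u.2)) (fun _ => 2)).
    by apply: (@pc_lettery (ext C) (fun u => i u.1 * (n u.1 * n u.1) + u.2)); pcs.
  exact: pc_const.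
have pS : pc (C := C1) (fun u => \sum_(i < u.2) cert_colour u.1.2 (u.2 * u.2) i).
  apply: (@pc_sum C1 (fun u => u.2) (fun u i => cert_colour u.1.2 (u.2 * u.2) i)) => //.
  by apply: (pcc (ext C1) (fun u => u.1.2) (fun u => u.2)); pcs.
have pw := @pcb_within_budget C1 (fun u => u.2.+1 + u.2 * u.2) _ _ pS.
have pm (C : ctx) (n i j : C -> nat) := @pcb_mat C n i j.
rewrite /verifies /header; apply: pcb_and; last apply: pcb_and; last apply: pcb_and;
  last apply: pcb_and.
- by pcs.
- apply: (@pcb_all C1 (fun u i => all (fun j => mat u.1.1 u.2 i j == mat u.1.1 u.2 j i) (iota 0 u.2))) => //.
  apply: (@pcb_all (ext C1) (fun u j => mat u.1.1.1 u.1.2 u.2 j == mat u.1.1.1 u.1.2 j u.2)); first by pcs.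
  apply: (@pcb_eqb (ext (ext C1))); first by apply: (pm (ext (ext C1)) (fun u => u.1.1.2) (fun u => u.1.2) snd); pcs.
  by apply: (pm (ext (ext C1)) (fun u => u.1.1.2) snd (fun u => u.1.2)); pcs.
- apply: (@pcb_all C1 (fun u i => ~~ mat u.1.1 u.2 i i)) => //.
  by apply: pcb_neg; apply: (pm (ext C1) (fun u => u.1.2) snd snd); pcs.
- apply: (@pcb_all C1 (fun u i => all (fun j => mat u.1.1 u.2 i j ==>
    (cert_colour u.1.2 (u.2 * u.2) i != cert_colour u.1.2 (u.2 * u.2) j)) (iota 0 u.2))) => //.
  apply: (@pcb_all (ext C1) (fun u j => mat u.1.1.1 u.1.2 u.2 j ==>
    (cert_colour u.1.1.2 (u.1.2 * u.1.2) u.2 != cert_colour u.1.1.2 (u.1.2 * u.1.2) j))); first by pcs.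
  apply: pcb_imp; first by apply: (pm (ext (ext C1)) (fun u => u.1.1.2) (fun u => u.1.2) snd); pcs.
  apply: pcb_neg; apply: (@pcb_eq (ext (ext C1))).
    by apply: (pcc (ext (ext C1)) (fun u => u.1.1.2) (fun u => u.1.2)); pcs.
  by apply: (pcc (ext (ext C1)) (fun u => u.1.1.2) snd); pcs.
- by apply: pw; pcs.
Qed.

Theorem chromatic_sum_NP (Hs : seq graph) : (forall H : graph, List.In H Hs -> 0 < #|H|) ->
  NP (chromatic_sum (induced_free Hs)).
Proof.
move=> Hs0; apply: (@NP_of_pc _ ('X^3)%R _ (pc_verifier Hs)) => x.
rewrite (verifierP x Hs0); split=> -[y [sy vy]]; exists y; split=> //.
- by rewrite hornerXn.
- by rewrite lt0b.
- by move: sy; rewrite hornerXn.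
- by move: vy; rewrite lt0b.
Qed.

(** Products are enumerated lexicographically, so the coordinates of a vertex can be computed from
    its rank by division with remainder. *)
Lemma nth_enum_prod (A B : finType) (a0 : A) (b0 : B) i : i < #|A| * #|B| ->
  nth (a0, b0) (enum {: A * B}) i = (nth a0 (enum A) (i %/ #|B|), nth b0 (enum B) (i %% #|B|)).
Proof.
move=> li; have B0 : 0 < #|B| by case: #|B| li; rewrite ?muln0.
have -> : enum {: A * B} = [seq (a, b) | a <- enum A, b <- enum B].
  by rewrite [LHS]enumT [Finite.enum]unlock.
rewrite {1}(divn_eq i #|B|) [X in _ * X + _]cardE (nth_allpairs _ a0 b0) // -cardE.
  by rewrite ltn_divLR.
by rewrite ltn_pmod.
Qed.

Lemma nth_enum_vertex (A K B C D S : finType) a0 k0 b0 c0 d0 s0 n :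
  n < #|{: A * (K * (B * C * D * S))}| ->
  let N1 := #|B| * #|C| * #|D| * #|S| in let N0 := #|K| * N1 in let r := n %% N0 %% N1 in
  nth (a0, (k0, (b0, c0, d0, s0))) (enum {: A * (K * (B * C * D * S))}) n =
  (nth a0 (enum A) (n %/ N0), (nth k0 (enum K) (n %% N0 %/ N1),
    (nth b0 (enum B) (r %/ #|S| %/ #|D| %/ #|C|), nth c0 (enum C) (r %/ #|S| %/ #|D| %% #|C|),
     nth d0 (enum D) (r %/ #|S| %% #|D|), nth s0 (enum S) (r %% #|S|)))) /\
  r %/ #|S| %/ #|D| < #|B| * #|C|.
Proof.
rewrite !card_prod => ln N1 N0 r.
have N0_gt0 : 0 < N0 by move: ln; rewrite -/N1 -/N0 [0 < N0]lt0n; apply: contraTneq => ->; rewrite muln0.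
have N1_gt0 : 0 < N1 by move: N0_gt0; rewrite muln_gt0 => /andP[].
have lr : r < N1 by apply: ltn_pmod.
have [BC0 [D0 S0]] : 0 < #|B| * #|C| /\ 0 < #|D| /\ 0 < #|S|.
  by move: N1_gt0; rewrite /N1 !muln_gt0 => /andP[/andP[-> ->] ->].
have lBCD : r %/ #|S| < #|B| * #|C| * #|D| by rewrite ltn_divLR.
have lBC : r %/ #|S| %/ #|D| < #|B| * #|C| by rewrite ltn_divLR.
split=> //.
rewrite nth_enum_prod ?card_prod // nth_enum_prod ?card_prod ?ltn_pmod //.
by rewrite nth_enum_prod ?card_prod // nth_enum_prod ?card_prod // nth_enum_prod.
Qed.

(** * Computing the reduction *)

Section NumericGraph.
Variables (M : tm).
Local Notation tile := (tile M).
Local Notation colour := (colour M).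
Local Notation Q := (wheel_size colour).

Definition blank_column : {ffun 'I_(extra_tapes M).+1 -> option (bool + aux M)} := [ffun=> None].
Definition blank_tile : tile := ((start M, blank_column), (blank_column, blank_column, blank_column)).

(* The vertices of the reduction graph, with the coordinates of the cells in [nat]. *)
Definition num_place := (nat * nat * tile * 'I_Q)%type.
Definition num_vertex := ('I_3 * (option bool * num_place))%type.

Section Fixed.
Variables (x : seq bool) (T m : nat).
Local Notation cell := ('I_T.+1 * 'I_(T.*2).+1)%type.
Local Notation place := (cell * tile * 'I_Q)%type.

Definition att : place -> option place :=
  tile_att (cell_flags x m) (@cell_adj T) (@tile_out M) (@tile_in M) (@tile_ok M) blank_tile.
Definition real : pred place := tile_real (@cell_adj T) blank_tile.

Definition reduction_adj := @wheel_adj (cell * tile)%type Q att real.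

Definition num_of (y : place) : num_place := (val y.1.1.1, val y.1.1.2, y.1.2, y.2).

(** The three-entry list is a table indexed by the value of [letter]: no letter, [false], [true]. *)
Definition num_flags (t p : nat) : flags :=
  (t == 0, t == T, p == T, T <= p < T + m,
   nth None [:: None; Some false; Some true] (if T <= p then letter x (p - T) else 0)).

Definition num_succ (b : bool) (t p : nat) := if b then t < T else p < T.*2.
Definition num_pred (b : bool) (t p : nat) := if b then 0 < t else 0 < p.
Definition num_cell_adj (b : bool) (t p t' p' : nat) :=
  if b then (t' == t.+1) && (p' == p) else (t' == t) && (p' == p.+1).

(** Predicates on the two directions are given by two booleans, which makes the adjacency test a
    function of finite-valued data. *)
Definition pick2 (a b : bool) : bool -> bool := fun c => if c then a else b.

Definition num_covers (y z : num_place) : bool :=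
  let: (t, p, a, i) := y in let: (t', p', a', j) := z in
  [&& tile_ok (num_flags t p) a, a' == blank_tile &
    if (slot_of colour i, slot_of colour j) is (Some s, Some s')
    then covers_slot (@tile_out M) (@tile_in M) (num_flags t p) a ((t' == t) && (p' == p))
           (pick2 (num_succ true t p) (num_succ false t p))
           (pick2 (num_cell_adj true t' p' t p) (num_cell_adj false t' p' t p)) s s' else false].

Definition num_covers_none (y : num_place) : bool :=
  let: (t, p, a, i) := y in
  ~~ tile_ok (num_flags t p) a ||
  match slot_of colour i with
  | None => true
  | Some None => false
  | Some (Some (b, false, g)) =>
      ~~ (pick2 (num_succ true t p) (num_succ false t p) b && (tile_out b (num_flags t p) a == g))
  | Some (Some (b, true, g)) =>
      ~~ (pick2 (num_pred true t p) (num_pred false t p) b && (tile_in b (num_flags t p) a != g))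
  end.

Definition num_place_real (y : num_place) : bool :=
  let: (t, p, a, i) := y in
  (a == blank_tile) && match slot_of colour i with
                  | Some None => true
                  | Some (Some (b, false, _)) => pick2 (num_succ true t p) (num_succ false t p) b
                  | _ => false
                  end.

Definition num_nx (y : num_place) : num_place := (y.1, ordS y.2).
Definition num_pv (y : num_place) : num_place := (y.1, ord_pred y.2).

(** Comparison with an apex is replaced by the explicit tests [num_covers] and [num_covers_none],
    and the case distinction by a disjunction to which the closure properties apply. *)
Definition num_adj (u v : num_vertex) : bool :=
  let: (i, (k, y)) := u in let: (j, (l, z)) := v in
  [|| [&& k == None, l == None, i == j & (z == num_nx y) || (y == num_nx z)],
      [&& k == None, l == Some true, i == j & num_covers y z || num_covers (num_pv y) z],
      [&& k == None, l == Some false, i == j &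
          (num_covers_none y && (z == y)) || (num_covers_none (num_pv y) && (z == num_pv y))],
      [&& l == None, k == Some true, i == j & num_covers z y || num_covers (num_pv z) y],
      [&& l == None, k == Some false, i == j &
          (num_covers_none z && (y == z)) || (num_covers_none (num_pv z) && (y == num_pv z))] |
      [&& i != j, k == l, y == z & (k == Some false) || (k == Some true) && ~~ num_place_real y]].

Definition num_co_adj (u v : num_vertex) := (u != v) && ~~ num_adj u v.

Lemma cell_succ b (u : cell) : has_succ (@cell_adj T) b u = num_succ b u.1 u.2.
Proof.
case: u => t p; apply/existsP/idP => [[[t' p']]|]; rewrite /cell_adj /num_succ; case: b => /=.
- by case/andP=> /eqP e _; have := ltn_ord t'; rewrite e.
- by case/andP=> _ /eqP e; have := ltn_ord p'; rewrite e.
- by move=> tT; exists (inord t.+1, p); rewrite /= inordK ?eqxx.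
- by move=> tT; exists (t, inord p.+1); rewrite /= inordK ?eqxx.
Qed.

Lemma cell_pred b (u : cell) : has_pred (@cell_adj T) b u = num_pred b u.1 u.2.
Proof.
case: u => t p; apply/existsP/idP => [[[t' p']]|]; rewrite /cell_adj /num_pred; case: b => /=.
- by case/andP=> /eqP ->.
- by case/andP=> _ /eqP ->.
- move=> t0; exists (inord t.-1, p); rewrite /= inordK ?prednK ?eqxx //.
  by apply: ltnW; apply: ltn_ord.
- move=> t0; exists (t, inord p.-1); rewrite /= inordK ?prednK ?eqxx //.
  by apply: ltnW; apply: ltn_ord.
Qed.

Lemma num_flagsE (u : cell) : cell_flags x m u = num_flags u.1 u.2.
Proof.
rewrite /cell_flags /num_flags /=; congr pair; case: (T <= u.2) => //=.
by rewrite /letter; case: ltnP => // _; case: nth.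
Qed.

Lemma num_coversE (y z : place) :
  covers (cell_flags x m) (@cell_adj T) (@tile_out M) (@tile_in M) (@tile_ok M) blank_tile y z =
  num_covers (num_of y) (num_of z).
Proof.
case: y z => [[[t p] a] i] [[[t' p'] a'] j]; rewrite /= num_flagsE /=.
case: (tile_ok _ _) => //=; case: (a' == _) => //=.
case: (slot_of colour i) => // s; case: (slot_of colour j) => // s'.
case: s => [[[b []] g]|]; case: s' => [[[b' []] g']|] //=.
by rewrite cell_succ; case: b.
Qed.

Lemma num_covers_noneE (y : place) :
  covers_none (cell_flags x m) (@cell_adj T) (@tile_out M) (@tile_in M) (@tile_ok M) y =
  num_covers_none (num_of y).
Proof.
case: y => [[[t p] a] i]; rewrite /= num_flagsE /=; congr orb.
case: (slot_of colour i) => [[[[b []] g]|]|] //; rewrite ?cell_succ ?cell_pred /=; by case: b.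
Qed.

Lemma num_place_realE (y : place) : real y = num_place_real (num_of y).
Proof.
case: y => [[[t p] a] i]; rewrite /real /=; congr andb.
by case: (slot_of colour i) => [[[[b []] g]|]|] //; rewrite ?cell_succ; case: b.
Qed.

Lemma cell_adj_succ b (u w w' : cell) : cell_adj b u w -> cell_adj b u w' -> w = w'.
Proof.
case: u w w' => [t p] [t1 p1] [t2 p2]; rewrite /cell_adj.
by case: b => /andP[/eqP e1 /eqP e2] /andP[/eqP e3 /eqP e4]; congr pair; apply: val_inj => /=;
  rewrite ?e1 ?e2 ?e3 ?e4.
Qed.

Lemma cell_adj_pred b (u u' w : cell) : cell_adj b u w -> cell_adj b u' w -> u = u'.
Proof.
case: u u' w => [t p] [t1 p1] [t2 p2]; rewrite /cell_adj /=.
by case: b => /andP[/eqP e1 /eqP e2] /andP[/eqP e3 /eqP e4]; congr pair; apply: val_inj => /=;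
  move: e1 e2 e3 e4; lia.
Qed.

Lemma cell_adj_irr b (u : cell) : ~~ cell_adj b u u.
Proof. by case: u => t p; rewrite /cell_adj /=; case: b; apply/negP => /andP[/eqP ? /eqP ?]; lia. Qed.

Lemma att_Some (y z : place) : (att y == Some z) = num_covers (num_of y) (num_of z).
Proof. by rewrite -num_coversE; apply: tile_attE; exact: cell_adj_pred. Qed.

Lemma att_None (y : place) : (att y == None) = num_covers_none (num_of y).
Proof. by rewrite -num_covers_noneE; apply: tile_att_none. Qed.

Lemma num_of_inj : injective num_of.
Proof.
move=> [[[t p] a] i] [[[t' p'] a'] j] [e1 e2 -> ->].
by rewrite (val_inj e1) (val_inj e2).
Qed.

Definition num_of_vertex (u : wheel_vertex (cell * tile)%type Q) : num_vertex :=
  (u.1, (u.2.1, num_of u.2.2)).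

Lemma num_of_vertex_inj : injective num_of_vertex.
Proof.
move=> [i [k y]] [j [l z]] e.
have e1 : i = j := congr1 fst e; have e2 : k = l := congr1 (fun w : num_vertex => w.2.1) e.
have e3 : y = z := num_of_inj (congr1 (fun w : num_vertex => w.2.2) e).
by rewrite e1 e2 e3.
Qed.

Lemma apexE (b : bool) (y z : place) : ((b, z) == apex att y) =
  if b then num_covers (num_of y) (num_of z) else num_covers_none (num_of y) && (num_of z == num_of y).
Proof.
rewrite -att_Some -att_None (inj_eq num_of_inj) /apex; case: (att y) => [c|]; case: b => //.
by apply/eqP/eqP => [[->]|[->]].
Qed.

Local Arguments num_covers : simpl never.
Local Arguments num_covers_none : simpl never.
Local Arguments num_place_real : simpl never.
Local Arguments num_of : simpl never.

Lemma num_adjE (u v : wheel_vertex (cell * tile)%type Q) :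
  reduction_adj u v = num_adj (num_of_vertex u) (num_of_vertex v).
Proof.
case: u v => [i [k y]] [j [l z]]; rewrite /reduction_adj /wheel_adj /num_adj /num_of_vertex /=.
have nxE w : num_nx (num_of w) = num_of (nx w) by [].
have pvE w : num_pv (num_of w) = num_of (pv w) by [].
rewrite !nxE !pvE !(inj_eq num_of_inj) -num_place_realE.
have orF (c : bool) : c = [|| c, false, false, false, false | false] by case: c.
case: k => [b|]; case: l => [c|]; rewrite ?andbF ?orbF //=.
- have -> : ((b, y) == (c, z)) = (b == c) && (y == z) by [].
  rewrite /tied /=; case: (i == j) => //=; case: (y == z); last by rewrite !andbF.
  by rewrite !andbT; case: b; case: c.
- by rewrite !apexE -?att_Some; case: b; rewrite ?andbF ?orbF /= ?(inj_eq num_of_inj).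
- by rewrite !apexE -?att_Some; case: c; rewrite ?andbF ?orbF /= ?(inj_eq num_of_inj).
Qed.

Definition decode (a : nat) : num_vertex :=
  let N2 := T.+1 * (T.*2).+1 * #|{: tile}| in
  let N1 := N2 * Q in
  let N0 := #|{: option bool}| * N1 in
  let r := a %% N0 %% N1 in
  (nth ord0 (enum 'I_3) (a %/ N0),
   (nth None (enum {: option bool}) (a %% N0 %/ N1),
    (r %/ Q %/ #|{: tile}| %/ (T.*2).+1, r %/ Q %/ #|{: tile}| %% (T.*2).+1,
     nth blank_tile (enum {: tile}) (r %/ Q %% #|{: tile}|),
     nth (slot_index (None : slot colour)) (enum 'I_Q) (r %% Q)))).

Definition default_vertex : wheel_vertex (cell * tile)%type Q :=
  (ord0, (None, (ord0, ord0, blank_tile, slot_index (None : slot colour)))).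

Lemma decodeE a : a < #|{: wheel_vertex (cell * tile)%type Q}| ->
  num_of_vertex (nth default_vertex (enum {: wheel_vertex (cell * tile)%type Q}) a) = decode a.
Proof.
rewrite /wheel_vertex /default_vertex => la.
have [-> l] := nth_enum_vertex ord0 None ord0 ord0 blank_tile (slot_index (None : slot colour)) la.
rewrite /decode; move: l; rewrite !card_ord => l.
rewrite /num_of_vertex /num_of /=.
have P0 : 0 < (T.*2).+1 by [].
by rewrite !nth_enum_ord ?ltn_pmod // ltn_divLR.
Qed.

Definition num_graph_adj a b := num_co_adj (decode a) (decode b).

Lemma num_graph_adjE a b : let N := #|{: wheel_vertex (cell * tile)%type Q}| in
  a < N -> b < N ->
  co_adj reduction_adj (nth default_vertex (enum {: wheel_vertex (cell * tile)%type Q}) a)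
     (nth default_vertex (enum {: wheel_vertex (cell * tile)%type Q}) b) = num_graph_adj a b.
Proof.
move=> N la lb; rewrite /num_graph_adj /num_co_adj -!decodeE // (inj_eq num_of_vertex_inj).
by rewrite -num_adjE.
Qed.
End Fixed.
End NumericGraph.

Ltac pcfs := cbv beta; lazymatch goal with
  | |- @pcf _ _ (fun u => (@?a u, @?b u)) => apply: (pcf_pair (g := a) (h := b)); pcfs
  | |- _ => first [assumption | apply: pcb_pcf; pcs | idtac]
  end.

Ltac pairs := cbv beta; lazymatch goal with
  | |- @pcf _ _ (fun u => (@?a u, @?b u)) => apply: (pcf_pair (g := a) (h := b)); pairs
  | |- _ => idtac
  end.

Lemma pcf_eq (C : ctx) (A : finType) (f g : C -> A) : pcf f -> pcf g -> pcb (fun u => f u == g u).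
Proof.
move=> pf pg; apply: (@pcb_fun C _ (fun u => (f u, g u)) (fun v => v.1 == v.2)).
exact: pcf_pair.
Qed.

(** * Computability of the adjacency relation *)

Section ComputeAdjacency.
Variables (M : tm) (C : ctx) (T m : C -> nat).
Hypotheses (pT : pc T) (pm : pc m).
Local Notation Q := (wheel_size (colour M)).

Definition pc_place (y : C -> num_place M) :=
  [/\ pc (fun u => (y u).1.1.1), pc (fun u => (y u).1.1.2),
      pcf (fun u => (y u).1.2) & pcf (fun u => (y u).2)].

Lemma pc_place_nx y : pc_place y -> pc_place (fun u => num_nx (y u)).
Proof. by case=> h1 h2 h3 h4; split=> //; apply: pcf_fun h4. Qed.

Lemma pc_place_pv y : pc_place y -> pc_place (fun u => num_pv (y u)).
Proof. by case=> h1 h2 h3 h4; split=> //; apply: pcf_fun h4. Qed.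

Lemma pc_place_eq y z : pc_place y -> pc_place z -> pcb (fun u => y u == z u).
Proof.
move=> [h1 h2 h3 h4] [g1 g2 g3 g4].
apply: (pcb_ext (a := fun u => [&& (y u).1.1.1 == (z u).1.1.1, (y u).1.1.2 == (z u).1.1.2,
   (y u).1.2 == (z u).1.2 & (y u).2 == (z u).2])).
  by move=> u; case: (y u) (z u) => [[[? ?] ?] ?] [[[? ?] ?] ?]; rewrite !xpair_eqE /= !andbA.
apply: pcb_and; first exact: pcb_eq.
apply: pcb_and; first exact: pcb_eq.
by apply: pcb_and; apply: pcf_eq.
Qed.

Let flags_of (y : C -> num_place M) u :=
  num_flags (wordx u) (T u) (m u) (y u).1.1.1 (y u).1.1.2.

Let pcf_flags y : pc_place y -> pcf (flags_of y).
Proof.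
move=> [h1 h2 _ _]; rewrite /flags_of /num_flags; pcfs.
apply: pcf_nth; apply: pc_if; [by pcs| |exact: pc_const].
apply: (@pc_letterx C (fun u => (y u).1.1.2 - T u)); exact: pc_sub.
Qed.

Let pcb_succ b y : pc_place y -> pcb (fun u => num_succ (T u) b (y u).1.1.1 (y u).1.1.2).
Proof.
move=> [h1 h2 _ _]; rewrite /num_succ; case: b; first by pcs.
apply: (pcb_ext (a := fun u => (y u).1.1.2 < T u * 2)); first by move=> u; rewrite muln2.
by pcs.
Qed.

Let pcb_pred b y : pc_place y -> pcb (fun u => num_pred b (y u).1.1.1 (y u).1.1.2).
Proof. by move=> [h1 h2 _ _]; rewrite /num_pred; case: b; pcs. Qed.

Let pcb_cell_adj b y z : pc_place y -> pc_place z ->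
  pcb (fun u => num_cell_adj b (y u).1.1.1 (y u).1.1.2 (z u).1.1.1 (z u).1.1.2).
Proof. by move=> [h1 h2 _ _] [g1 g2 _ _]; rewrite /num_cell_adj; case: b; pcs. Qed.

Lemma pcb_num_covers y z : pc_place y -> pc_place z ->
  pcb (fun u => num_covers (wordx u) (T u) (m u) (y u) (z u)).
Proof.
move=> py pz; have [h1 h2 h3 h4] := py; have [g1 g2 g3 g4] := pz.
(* Apart from the coordinates of the cells, all the data range over finite types that depend on the
   machine only. Once the coordinates are reduced to flags and comparisons, the test is a fixed
   finite function. *)
pose F (v : flags * tile M * 'I_Q * tile M * 'I_Q * bool * bool * bool * bool * bool) :=
  let: (f, a, i, a', j, same, s1, s0, r1, r0) := v in
  [&& tile_ok f a, a' == blank_tile M &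
    if (slot_of (colour M) i, slot_of (colour M) j) is (Some s, Some s')
    then covers_slot (@tile_out M) (@tile_in M) f a same (pick2 s1 s0) (pick2 r1 r0) s s' else false].
apply: (pcb_ext (a := fun u => F (flags_of y u, (y u).1.2, (y u).2, (z u).1.2, (z u).2,
   ((z u).1.1.1 == (y u).1.1.1) && ((z u).1.1.2 == (y u).1.1.2),
   num_succ (T u) true (y u).1.1.1 (y u).1.1.2, num_succ (T u) false (y u).1.1.1 (y u).1.1.2,
   num_cell_adj true (z u).1.1.1 (z u).1.1.2 (y u).1.1.1 (y u).1.1.2,
   num_cell_adj false (z u).1.1.1 (z u).1.1.2 (y u).1.1.1 (y u).1.1.2))).
  by move=> u; rewrite /flags_of; case: (y u) (z u) => [[[? ?] ?] ?] [[[? ?] ?] ?].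
apply: (@pcb_fun C _ _ F); pairs => //.
- exact: pcf_flags.
- by pcfs.
- exact/pcb_pcf/pcb_succ.
- exact/pcb_pcf/pcb_succ.
- exact/pcb_pcf/pcb_cell_adj.
- exact/pcb_pcf/pcb_cell_adj.
Qed.

Lemma pcb_num_covers_none y : pc_place y ->
  pcb (fun u => num_covers_none (wordx u) (T u) (m u) (y u)).
Proof.
move=> py; have [h1 h2 h3 h4] := py.
pose F (v : flags * tile M * 'I_Q * bool * bool * bool * bool) :=
  let: (f, a, i, s1, s0, r1, r0) := v in
  ~~ tile_ok f a ||
  match slot_of (colour M) i with
  | None => true
  | Some None => false
  | Some (Some (b, false, g)) => ~~ (pick2 s1 s0 b && (tile_out b f a == g))
  | Some (Some (b, true, g)) => ~~ (pick2 r1 r0 b && (tile_in b f a != g))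
  end.
apply: (pcb_ext (a := fun u => F (flags_of y u, (y u).1.2, (y u).2,
   num_succ (T u) true (y u).1.1.1 (y u).1.1.2, num_succ (T u) false (y u).1.1.1 (y u).1.1.2,
   num_pred true (y u).1.1.1 (y u).1.1.2, num_pred false (y u).1.1.1 (y u).1.1.2))).
  by move=> u; rewrite /flags_of; case: (y u) => [[[? ?] ?] ?].
apply: (@pcb_fun C _ _ F); pairs => //.
- exact: pcf_flags.
- exact/pcb_pcf/pcb_succ.
- exact/pcb_pcf/pcb_succ.
- exact/pcb_pcf/pcb_pred.
- exact/pcb_pcf/pcb_pred.
Qed.

Lemma pcb_num_place_real y : pc_place y -> pcb (fun u => num_place_real (T u) (y u)).
Proof.
move=> py; have [h1 h2 h3 h4] := py.
pose F (v : tile M * 'I_Q * bool * bool) :=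
  let: (a, i, s1, s0) := v in
  (a == blank_tile M) && match slot_of (colour M) i with
                  | Some None => true
                  | Some (Some (b, false, _)) => pick2 s1 s0 b
                  | _ => false
                  end.
apply: (pcb_ext (a := fun u => F ((y u).1.2, (y u).2,
   num_succ (T u) true (y u).1.1.1 (y u).1.1.2, num_succ (T u) false (y u).1.1.1 (y u).1.1.2))).
  by move=> u; case: (y u) => [[[? ?] ?] ?].
apply: (@pcb_fun C _ _ F); pairs => //.
- exact/pcb_pcf/pcb_succ.
- exact/pcb_pcf/pcb_succ.
Qed.

Definition pc_vertex (v : C -> num_vertex M) :=
  [/\ pcf (fun u => (v u).1), pcf (fun u => (v u).2.1) & pc_place (fun u => (v u).2.2)].

Lemma pcb_num_co_adj v w : pc_vertex v -> pc_vertex w ->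
  pcb (fun u => num_co_adj (wordx u) (T u) (m u) (v u) (w u)).
Proof.
move=> [v1 v2 v3] [w1 w2 w3].
have pii := pcf_eq v1 w1; have pkk := pcf_eq v2 w2; have pyz := pc_place_eq v3 w3.
have pzy := pc_place_eq w3 v3.
have vk a : pcb (fun u => (v u).2.1 == a) by [].
have wk a : pcb (fun u => (w u).2.1 == a) by [].
have c1 := pcb_num_covers v3 w3; have c2 := pcb_num_covers (pc_place_pv v3) w3.
have c3 := pcb_num_covers w3 v3; have c4 := pcb_num_covers (pc_place_pv w3) v3.
have d1 := pcb_num_covers_none v3; have d2 := pcb_num_covers_none (pc_place_pv v3).
have d3 := pcb_num_covers_none w3; have d4 := pcb_num_covers_none (pc_place_pv w3).
have e1 := pc_place_eq w3 (pc_place_nx v3); have e2 := pc_place_eq v3 (pc_place_nx w3).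
have e3 := pc_place_eq w3 (pc_place_pv v3); have e4 := pc_place_eq v3 (pc_place_pv w3).
have rr := pcb_num_place_real v3.
pose E u := num_adj (wordx u) (T u) (m u) ((v u).1, ((v u).2.1, (v u).2.2)) ((w u).1, ((w u).2.1, (w u).2.2)).
apply: (pcb_ext (a := fun u =>
  ~~ [&& (v u).1 == (w u).1, (v u).2.1 == (w u).2.1 & (v u).2.2 == (w u).2.2] && ~~ E u)).
  move=> u; rewrite /E /num_co_adj; case: (v u) (w u) => [i [k y]] [j [l z]].
  by rewrite !xpair_eqE.
apply: pcb_and; first by apply: pcb_neg; apply: pcb_and => //; apply: pcb_and.
apply: pcb_neg; rewrite /E /num_adj.
by repeat first [assumption | apply: vk | apply: wk | apply: pcb_or | apply: pcb_and | apply: pcb_neg].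
Qed.

Lemma pc_vertex_decode a : pc a -> pc_vertex (fun u => decode M (T u) (a u)).
Proof.
move=> pa; pose N1 u := (T u).+1 * (T u * 2).+1 * #|{: tile M}| * Q.
pose N0 u := #|{: option bool}| * N1 u.
have pN1 : pc N1 by rewrite /N1; pcs.
have pN0 : pc N0 by rewrite /N0; pcs.
pose r u := a u %% N0 u %% N1 u; have pr : pc r by rewrite /r; pcs.
pose b u := r u %/ Q %/ #|{: tile M}|; have pb_ : pc b by rewrite /b; pcs.
have N1E u : (T u).+1 * ((T u).*2).+1 * #|{: tile M}| * Q = N1 u by rewrite /N1 muln2.
have TE u : ((T u).*2).+1 = (T u * 2).+1 by rewrite muln2.
have dE u : decode M (T u) (a u) = (nth ord0 (enum 'I_3) (a u %/ N0 u),
  (nth None (enum {: option bool}) (a u %% N0 u %/ N1 u),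
   (b u %/ (T u * 2).+1, b u %% (T u * 2).+1,
    nth (blank_tile M) (enum {: tile M}) (r u %/ Q %% #|{: tile M}|),
    nth (slot_index (None : slot (colour M))) (enum 'I_Q) (r u %% Q)))).
  by rewrite /decode N1E TE.
split; last split.
- apply: (pcf_ext (f := fun u => nth ord0 (enum 'I_3) (a u %/ N0 u))) => [u|]; first by rewrite dE.
  by apply: pcf_nth; pcs.
- apply: (pcf_ext (f := fun u => nth None (enum {: option bool}) (a u %% N0 u %/ N1 u))) => [u|].
    by rewrite dE.
  by apply: pcf_nth; pcs.
- apply: (pc_ext (f := fun u => b u %/ (T u * 2).+1)) => [u|]; first by rewrite dE.
  by pcs.
- apply: (pc_ext (f := fun u => b u %% (T u * 2).+1)) => [u|]; first by rewrite dE.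
  by pcs.
- apply: (pcf_ext (f := fun u => nth (blank_tile M) (enum {: tile M}) (r u %/ Q %% #|{: tile M}|)))
    => [u|]; first by rewrite dE.
  by apply: pcf_nth; pcs.
- apply: (pcf_ext (f := fun u => nth (slot_index (None : slot (colour M))) (enum 'I_Q) (r u %% Q)))
    => [u|]; first by rewrite dE.
  by apply: pcf_nth; pcs.
Qed.

Lemma pcb_num_graph_adj a b : pc a -> pc b ->
  pcb (fun u => num_graph_adj M (wordx u) (T u) (m u) (a u) (b u)).
Proof. by move=> pa pb; apply: pcb_num_co_adj; apply: pc_vertex_decode. Qed.

End ComputeAdjacency.

(** * NP-hardness *)

Section Reduction.
Variables (M : tm) (x : seq bool) (T m : nat).
Hypothesis mT : m <= T.

Definition reduction_graph : graph := coG (wheel_adj_sym (@att M x T m) (@real M T)).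

(** There are three copies of three kinds of vertices for each place, so this is a third of the
    order and the number of colours in an optimal colouring. *)
Definition third_order := 3 * (T.+1 * (T * 2).+1 * #|{: tile M}| * wheel_size (colour M)).

Lemma card_reduction_graph : #|reduction_graph| = 3 * third_order.
Proof.
rewrite /third_order muln2 -[LHS]/#|{: wheel_vertex ('I_T.+1 * 'I_(T.*2).+1 * tile M)%type (wheel_size (colour M))}|.
by rewrite /wheel_vertex 2!card_prod card_ord card_option card_bool 3!card_prod !card_ord.
Qed.

Lemma reduction_graph_correct :
  (exists y, size y <= m /\ accepting (run M [:: x; y] T)) <->
  has_colouring_of_sum_at_most reduction_graph (triangle_sum third_order).
Proof.
have Rs := @cell_adj_succ T; have Rp := @cell_adj_pred T; have Ri := @cell_adj_irr T.
have tc := tiling_exact_cover (cell_flags x m) (@tile_out M) (@tile_in M) (@tile_ok M)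
  (blank_tile M) Rs Rp.
have wc := @wheel_colouring _ _ (@att M x T m) (@real M T)
  (wheel_size_ge6 (inr (start M, blank_column M) : colour M)) (wheel_size_even _)
  (tile_att_even Rp) (tile_att_inj Rp Ri) (tile_att_real Rp) _ card_reduction_graph.
split=> [[y [ym acc]]|[c [col le]]].
  have [c col le] := wc.1 (tc.1 (accepting_tiling mT ym acc)).
  by exists c; split.
have [tau tau_tiling] := tc.2 (wc.2 (ex_intro2 _ _ c col le)).
exact: tiling_accepting mT _ tau_tiling.
Qed.

Lemma reduction_graph_free : induced_free [:: cycleG 5; copiesG 4 (pathG 1);
  unionG (copiesG 2 (pathG 1)) (pathG 2); copiesG 2 (pathG 2)] reduction_graph.
Proof.
apply: wheel_free.
- exact: wheel_size_ge6 (inr (start M, blank_column M) : colour M).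
- exact: wheel_size_even.
- exact: tile_att_even (@cell_adj_pred T).
- exact: tile_att_inj (@cell_adj_pred T) (@cell_adj_irr T).
Qed.

Lemma reduction_graph_bits : graph_code reduction_graph = nseq (3 * third_order) true ++ false ::
  mkseq (fun j => num_graph_adj M x T m (j %/ (3 * third_order)) (j %% (3 * third_order)))
        (3 * third_order * (3 * third_order)).
Proof.
rewrite /graph_code card_reduction_graph; congr (_ ++ _ :: _); set N := 3 * _.
have sN : size (enum reduction_graph) = N by rewrite -cardE card_reduction_graph.
apply: (@eq_from_nth _ false) => [|j]; first by rewrite size_allpairs sN size_mkseq.
rewrite size_allpairs sN => lj; rewrite nth_mkseq //.
have N0 : 0 < N by case: (N) lj.
have l1 : j %/ N < N by rewrite ltn_divLR.
have l2 : j %% N < N by rewrite ltn_pmod.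
have cN : #|{: wheel_vertex ('I_T.+1 * 'I_(T.*2).+1 * tile M)%type (wheel_size (colour M))}| = N.
  exact: card_reduction_graph.
rewrite -num_graph_adjE ?cN // {1}(divn_eq j N).
have := @nth_allpairs _ _ _ (@adj reduction_graph) (default_vertex M T) (default_vertex M T) false
  (enum reduction_graph) (enum reduction_graph) (j %/ N) (j %% N).
by rewrite sN => ->.
Qed.

End Reduction.

(* As [K < 2 ^ j] for large [j], capping the divisor does not change the quotient,
   and keeps it polynomially bounded. *)
Definition kbit K j := (K %/ minn (2 ^ j) K.+1) %% 2 == 1.

Lemma sum_bits K L : \sum_(j < L) (K %/ 2 ^ j %% 2) * 2 ^ j = K %% 2 ^ L.
Proof.
elim: L => [|L IH]; first by rewrite big_ord0 expn0 modn1.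
rewrite big_ord_recr /= IH [in RHS](divn_eq K (2 ^ L)) [in RHS](divn_eq (K %/ 2 ^ L) 2).
set r := K %% 2 ^ L; set q := K %/ 2 ^ L.
have rL : r < 2 ^ L by rewrite ltn_pmod // expn_gt0.
have b2 : q %% 2 < 2 by rewrite ltn_pmod.
have -> : (q %/ 2 * 2 + q %% 2) * 2 ^ L + r = q %/ 2 * 2 ^ L.+1 + (r + q %% 2 * 2 ^ L).
  by rewrite expnS mulnDl -mulnA -addnA (addnC r).
rewrite modnMDl [RHS]modn_small // expnS.
by move: (q %% 2) b2 => [|[|//]] _; lia.
Qed.

(** [K] binary digits suffice because [K < 2 ^ K]; this wasteful length is harmless, as the budget
    itself is polynomially bounded. *)
Lemma kbit_value K : int_of_bits (false :: mkseq (kbit K) K) = K.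
Proof.
rewrite /int_of_bits /= expr0 mul1r -/(bits_value _); congr Posz.
have E : \sum_(j < K) (K %/ 2 ^ j %% 2) * 2 ^ j = K.
  by rewrite sum_bits; apply: modn_small; exact: ltn_expl.
rewrite (@bits_valueE _ K) ?size_mkseq //; rewrite -[RHS]E.
apply: eq_bigr => j _; rewrite nth_mkseq // /kbit; congr (_ * _).
have -> : K %/ minn (2 ^ j) K.+1 = K %/ 2 ^ j.
  case: (leqP (2 ^ j) K.+1) => h; first by [].
  by rewrite !divn_small // ltnW.
by case: (_ %% 2) (ltn_pmod (K %/ 2 ^ j) (isT : 0 < 2)) => [|[|//]].
Qed.

Lemma mkseq_cat A (f : nat -> A) a b : mkseq f (a + b) = mkseq f a ++ mkseq (fun i => f (a + i)) b.
Proof.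
by rewrite /mkseq iotaD map_cat add0n; congr cat; rewrite -[a in iota a b]addn0 iotaDl -map_comp.
Qed.

(** A word determines its graph only up to renaming the vertices, and the language admits any graph
    it encodes; colourings are carried over through the common matrix. *)
Lemma encodes_same w (G G' : graph) k k' : encodes w G k -> encodes w G' k' ->
  k = k' /\ (has_colouring_of_sum_at_most G k <-> has_colouring_of_sum_at_most G' k').
Proof.
move=> e e'; have [h _ hk] := (encodesP _ _ _).1 e; have [h' _ hk'] := (encodesP _ _ _).1 e'.
have ek : k = k' by rewrite hk hk' (header_inj h h').
split=> //; rewrite -ek in e' *.
by rewrite (encodes_colouring e) (encodes_colouring e') (header_inj h h').
Qed.

Lemma horner_nat_mono (p : {poly nat}) a b : a <= b -> p.[a]%R <= p.[b]%R.
Proof.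
move=> ab; rewrite /horner; elim: {p}(polyseq p) => //= c s IH.
by apply: leq_add => //; apply: leq_mul.
Qed.

(** * The reduction as a function on words *)

Section Hardness.
Variables (M : tm) (p q : {poly nat}).

Definition cert_bound (x : seq bool) := p.[size x]%R.
(** The first summand is enough time for all admissible certificates; the second makes the grid wide
    enough to hold the certificate. *)
Definition time_bound (x : seq bool) := q.[size x + cert_bound x]%R + cert_bound x.
Definition reduction_order x := 3 * third_order M (time_bound x).
Definition budget x := triangle_sum (third_order M (time_bound x)).

(** The strict inequalities make the letters [N] and [N.+1 + N * N] false: they end the unary order
    and give the sign of the budget. *)
Definition reduction_bit (x : seq bool) (i : nat) : bool :=
  let N := reduction_order x in
  (i < N) ||
  (if i < N.+1 + N * N
   then (N < i) && num_graph_adj M x (time_bound x) (cert_bound x) ((i - N.+1) %/ N) ((i - N.+1) %% N)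
   else (N.+1 + N * N < i) && kbit (budget x) (i - (N.+2 + N * N))).

Definition reduction (x : seq bool) : seq bool :=
  mkseq (reduction_bit x) (reduction_order x + 1 + reduction_order x * reduction_order x + 1 + budget x).

Lemma reductionE x : reduction x =
  graph_code (reduction_graph M x (time_bound x) (cert_bound x)) ++
  false :: mkseq (kbit (budget x)) (budget x).
Proof.
rewrite reduction_graph_bits /reduction.
set N := reduction_order x; have -> : 3 * third_order M (time_bound x) = N by [].
rewrite (_ : _ + budget x = N + (1 + (N * N + (1 + budget x)))); last by rewrite -/N; move: (N); lia.
rewrite (mkseq_cat _ N) -catA; congr cat.
  apply: (@eq_from_nth _ true) => [|i]; first by rewrite size_mkseq size_nseq.
  by rewrite size_mkseq => iN; rewrite nth_mkseq // nth_nseq iN /reduction_bit -/N iN.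
rewrite (mkseq_cat _ 1) /= addn0; congr cons.
  by rewrite /reduction_bit -/N ltnn ltn_addr.
rewrite (mkseq_cat _ (N * N)); congr cat.
  apply/eq_in_map => i; rewrite mem_iota /= => iN; rewrite /reduction_bit -/N addnA addn1.
  have -> : (N.+1 + i < N) = false by apply/negbTE; rewrite -leqNgt ltnW ?leq_addr.
  by rewrite ltn_add2l iN ltn_addr //= addKn.
rewrite (mkseq_cat _ 1) /= addn0; congr cons.
  by rewrite /reduction_bit -/N; set P := N * N; rewrite !ifF ?orbF; lia.
apply/eq_in_map => i _; rewrite /reduction_bit -/N; set P := N * N.
have -> : N + (1 + (P + (1 + i))) = N.+2 + P + i by lia.
rewrite addKn; have -> : (N.+2 + P + i < N) = false by lia.
have -> : (N.+2 + P + i < N.+1 + P) = false by lia.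
by have -> : N.+1 + P < N.+2 + P + i by lia.
Qed.

Lemma pc_cert_bound (C : ctx) : pc (fun u : C => cert_bound (wordx u)).
Proof. by apply: pc_poly; apply: pc_sizex. Qed.

Lemma pc_time_bound (C : ctx) : pc (fun u : C => time_bound (wordx u)).
Proof.
apply: pc_add; last exact: pc_cert_bound.
by apply: pc_poly; apply: pc_add; [exact: pc_sizex|exact: pc_cert_bound].
Qed.

Lemma pc_third_order (C : ctx) : pc (fun u : C => third_order M (time_bound (wordx u))).
Proof. by have := pc_time_bound C; rewrite /third_order => pt; pcs. Qed.

Lemma pc_budget (C : ctx) : pc (fun u : C => budget (wordx u)).
Proof.
apply: pc_mul; first exact: pc_const.
apply: (@pc_sum C _ (fun _ i => i.+1)); first exact: pc_third_order.
by apply: pcS; exact: pc_snd.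
Qed.

Lemma pcb_reduction_bit : pcb (C := ext words_ctx) (fun u => reduction_bit u.1.1 u.2).
Proof.
set C := ext words_ctx.
pose N (u : C) := reduction_order (wordx u).
have pN : pc N by apply: pc_mul; [exact: pc_const|exact: pc_third_order].
have pi : pc (C := C) (fun u => u.2) by exact: pc_snd.
pose A (u : C) := num_graph_adj M (wordx u) (time_bound (wordx u)) (cert_bound (wordx u))
  ((u.2 - (N u).+1) %/ N u) ((u.2 - (N u).+1) %% N u).
pose B (u : C) := kbit (budget (wordx u)) (u.2 - ((N u).+2 + N u * N u)).
have pA : pcb A.
  apply: (@pcb_num_graph_adj M C (fun u => time_bound (wordx u)) (fun u => cert_bound (wordx u))
     (pc_time_bound C) (pc_cert_bound C)); by pcs.
have pB : pcb B.
  apply: (@pcb_eq C (fun u => (budget (wordx u) %/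
    minn (2 ^ (u.2 - ((N u).+2 + N u * N u))) (budget (wordx u)).+1) %% 2) (fun _ => 1)); last exact: pc_const.
  have pb := pc_budget C.
  apply: (@pc_mod C (fun u => budget (wordx u) %/
    minn (2 ^ (u.2 - ((N u).+2 + N u * N u))) (budget (wordx u)).+1) (fun _ => 2)); last exact: pc_const.
  apply: (@pc_div C (fun u => budget (wordx u))) => //.
  by apply: (@pc_min_exp2 C (fun u => u.2 - ((N u).+2 + N u * N u))); pcs.
pose D (u : C) := u.2 < (N u).+1 + N u * N u.
have pD : pcb D by rewrite /D; pcs.
apply: (pcb_ext (a := fun u : C => (u.2 < N u) ||
  (D u && ((N u < u.2) && A u) || ~~ D u && (((N u).+1 + N u * N u < u.2) && B u)))).
  by move=> u; rewrite /reduction_bit /D; congr orb; case: ifP => // _; rewrite orbF.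
by pcs.
Qed.

Lemma pc_reduction_size : pc (C := words_ctx) (fun u =>
  reduction_order u.1 + 1 + reduction_order u.1 * reduction_order u.1 + 1 + budget u.1).
Proof.
have pN : pc (C := words_ctx) (fun u => reduction_order u.1).
  by apply: pc_mul; [exact: pc_const|exact: pc_third_order].
by have pb := pc_budget words_ctx; pcs.
Qed.

Lemma reduction_poly_time : poly_time_computable reduction.
Proof. exact: poly_time_of_pc pc_reduction_size pcb_reduction_bit. Qed.

Lemma cert_bound_le x : cert_bound x <= time_bound x.
Proof. exact: leq_addl. Qed.

Lemma reduction_encodes x : encodes (reduction x)
  (reduction_graph M x (time_bound x) (cert_bound x)) (budget x).
Proof. by exists (false :: mkseq (kbit (budget x)) (budget x)); rewrite reductionE kbit_value. Qed.

Lemma reduction_correct x :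
  (exists y, size y <= cert_bound x /\ accepting (run M [:: x; y] (time_bound x))) <->
  chromatic_sum (induced_free [:: cycleG 5; copiesG 4 (pathG 1);
    unionG (copiesG 2 (pathG 1)) (pathG 2); copiesG 2 (pathG 2)]) (reduction x).
Proof.
rewrite (reduction_graph_correct M x (cert_bound_le x)); split=> [col|[G [k [e _ col]]]].
  exists (reduction_graph M x (time_bound x) (cert_bound x)), (budget x).
  by split=> //; [exact: reduction_encodes|exact: reduction_graph_free].
by have [_ <-] := encodes_same e (reduction_encodes x).
Qed.

End Hardness.

Lemma chromatic_sum_NP_hard :
  NP_hard (chromatic_sum (induced_free [:: cycleG 5; copiesG 4 (pathG 1);
    unionG (copiesG 2 (pathG 1)) (pathG 2); copiesG 2 (pathG 2)])).
Proof.
move=> L [M [p [q [halts LE]]]]; exists (reduction M p q).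
split=> [|x]; first exact: reduction_poly_time.
(* The grid needs one running time for all certificates; running on after halting changes
   nothing. *)
have runE y : size y <= cert_bound p x ->
    run M [:: x; y] (time_bound p q x) = run M [:: x; y] q.[size x + size y]%R.
  move=> ym; have le : q.[size x + size y]%R <= time_bound p q x.
    apply: leq_trans (leq_addr _ _); apply: horner_nat_mono.
    by rewrite leq_add2l.
  by rewrite /run -(subnK le) iterD halted_iter //; exact: halts.
rewrite -reduction_correct LE.
by split=> -[y [ym acc]]; exists y; split=> //; move: acc; rewrite runE.
Qed.

Theorem theorem20 :
  NP_complete
    (chromatic_sum
       (induced_free [:: cycleG 5;
                         copiesG 4 (pathG 1);
                         unionG (copiesG 2 (pathG 1)) (pathG 2);
                         copiesG 2 (pathG 2)])).
Proof.
split; last exact: chromatic_sum_NP_hard.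
apply: chromatic_sum_NP => H /= [|[|[|[|[]]]]] <-.
all: rewrite -?[#|_|]/#|{: _}| ?card_sum ?card_prod ?card_ord //.
Qed.
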